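(* There is a constant $c_1>0$ such that $$\limsup_{n\to\infty}\frac1n\log P\big[\|X_n\|\le c_1 n\big]<0,$$ and consequently $$\liminf_{n\to\infty}\frac{\|X_n\|}{n}\ge c_1\qquad P\text{-a.s.}$$
   Context: Let $(X_n)_{n\ge 0}$ be the following random walk in $\mathbb{R}^2$ on a probability space $(\Omega,\mathcal F,P)$: $X_0=0$, and for $n\ge 0$, given $X_0,\dots,X_n$, the point $X_{n+1}$ is uniformly distributed on the unit circle centered at $X_n$, conditioned on the event that the straight line segment $\overline{X_n,X_{n+1}}$ does not intersect the interior $K_n^o$ of the convex hull $K_n$ of $\{X_0,X_1,\dots,X_n\}$. Here $\|\cdot\|$ is the Euclidean norm. *)

(* Defs.v *)
From HB Require Import structures.
From mathcomp Require Import all_boot all_order all_algebra.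
From mathcomp Require Import all_classical all_reals all_analysis.
Set Implicit Arguments. Unset Strict Implicit. Unset Printing Implicit Defensive.
Import Order.TTheory GRing.Theory Num.Theory.
Import numFieldNormedType.Exports.
Local Open Scope classical_set_scope.
Local Open Scope ring_scope.

(* Points of R^2 are pairs (x, y) : R * R (product topology = Euclidean one,
   product sigma-algebra of Borel sets = Borel sets of R^2). *)
Section Defs.
Variable R : realType.
Local Notation pt := (R * R)%type.

Definition padd (p q : pt) : pt := (p.1 + q.1, p.2 + q.2).
Definition pscale (t : R) (p : pt) : pt := (t * p.1, t * p.2).
Definition enorm (p : pt) : R := Num.sqrt (p.1 ^+ 2 + p.2 ^+ 2).
Definition unitv (theta : R) : pt := (cos theta, sin theta).

Definition hull_pts (x : nat -> pt) (n : nat) : set pt :=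
  [set p | exists lam : nat -> R,
     (forall k, 0 <= lam k) /\ \sum_(k < n.+1) lam k = 1 /\
     p.1 = \sum_(k < n.+1) lam k * (x k).1 /\
     p.2 = \sum_(k < n.+1) lam k * (x k).2].

Definition allowed_angles (x : nat -> pt) (n : nat) : set R :=
  [set theta : R | 0 <= theta < 2 * pi /\
     forall t : R, 0 <= t <= 1 ->
       ~ (interior (hull_pts x n : set (R * R)%type)) (padd (x n) (pscale t (unitv theta)))].

Definition elog (v : \bar R) : \bar R :=
  if v == 0%E then -oo%E else (ln (fine v))%:E.
End Defs.

Definition hist_sigma d (T : measurableType d) (R : realType)
  (X : nat -> T -> (R * R)%type) (n : nat) : set (set T) :=
  smallest (sigma_algebra setT)
    [set A | exists k (B : set ((R * R)%type)), (k <= n)%N /\ measurable B /\ A = X k @^-1` B].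

(* X is the random walk of the paper on (T, P):
   X_0 = 0, each X_k is measurable, and the conditional law of X_{n+1}
   given X_0, ..., X_n is X_n + unitv(Theta) with Theta uniform on the
   allowed angle set (normalized Lebesgue measure). *)
Definition hull_avoiding_walk d (T : measurableType d) (R : realType)
  (P : probability T R) (X : nat -> T -> (R * R)%type) : Prop :=
  (forall w, X 0%N w = (0, 0)) /\
  (forall k, measurable_fun setT (X k)) /\
  (forall (n : nat) (C : set T) (B : set R),
     hist_sigma X n C -> measurable B ->
     P (C `&` [set w | exists theta, B theta /\ 0 <= theta < 2 * pi /\
                 X n.+1 w = padd (X n w) (unitv theta)])
     = (\int[P]_(w in C)
          ((fine (lebesgue_measure (B `&` allowed_angles (fun k => X k w) n)) /
            fine (lebesgue_measure (allowed_angles (fun k => X k w) n)))%:E))%E).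

Definition speed d (T : measurableType d) (R : realType)
  (X : nat -> T -> (R * R)%type) (w : T) (n : nat) : \bar R :=
  (enorm (X n w) / n%:R)%:E.

(* Main.v *)
Require Import Defs.
From HB Require Import structures.
From mathcomp Require Import all_boot all_order all_algebra.
From mathcomp Require Import all_classical all_reals all_analysis.
From mathcomp Require Import measurable_realfun ring lra.
Set Implicit Arguments. Unset Strict Implicit. Unset Printing Implicit Defensive.
Import Order.TTheory GRing.Theory Num.Theory.
Import numFieldNormedType.Exports.
Local Open Scope classical_set_scope.
Local Open Scope ring_scope.

(** Write X_n for the position after n steps. Seen from X_n, the past fills a cone of opening at
    most pi, which contains the direction of the origin at angles alpha and beta from its two
    sides; the allowed directions are those outside this cone, and the average of the radial
    increment over them is (sin alpha + sin beta) / |allowed| >= 0 up to O(1/|X_n|). This is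
    bounded below unless the cone is thin or nearly a half-plane. To deal with these positions
    one subtracts from |X_n| a small multiple of penalty = max (0, max_(k < n) (42 + g_k)),
    where g_k is the depth of X_n in a thin rhombus with opposite vertices 0 and X_k: in a
    degenerate position the penalty is at least 40, and it drops by about 40 |sin| of the angle
    between the step and the radial direction, hence on average by a positive amount. Thus the
    potential |X_n| - eps penalty has bounded increments and drift at least 2 eps, so that
    exp (- l potential) decreases geometrically in mean for small l; Markov's inequality gives
    the exponential bound, and the Borel-Cantelli lemma the almost sure one. *)

(** Why the penalty falls in degenerate positions: a past point seen nearly in the direction of the
    origin is the far vertex of a rhombus that a transversal step leaves sideways. If the past fills
    almost a half-plane, some past point lies farther out close to the radial ray, the walker is
    inside its rhombus, and the hull forbids steps towards the crowded side, so transversal motion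
    leads away from the axes of the points there. The average uses |sin| >= sin^2, whose mean is at
    least 1/4 because the allowed directions fill half a turn: a gain of 40/4 against a loss of 8.
    Near the origin the O(1/|X_n|) correction helps, being the positive curvature term of the norm.
    The law of the walk raises two more obstacles. It reads 0/0 = 0 when the allowed set is null, so
    the walker must first be shown to be almost surely never interior to the hull. And its
    dependence on the history is not known to be measurable, so conditional expectations are
    replaced by finite sums over short arcs, with errors small against the drift. *)

(** * Depth in a thin rhombus and its change under a unit step *)

Section Rhombus.
Variable R : realFieldType.
Implicit Types N x y r a b s t : R.

(* Nonnegative exactly on the rhombus with opposite vertices (0, 0) and (N, 0) and sides of
   slope 1/40 and -1/40. *)
Definition rhombus_depth N x y : R := Num.min (N - x) x - 40 * `|y|.

Lemma unit_abs_le1 a b : a ^+ 2 + b ^+ 2 = 1 -> [/\ -1 <= a, a <= 1, -1 <= b & b <= 1].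
Proof. by move=> h; split; nra. Qed.

Lemma ler_mul_unit a b : -1 <= a -> a <= 1 -> - `|b| <= a * b <= `|b|.
Proof.
move=> h1 h2; have a1 : `|a| <= 1 by rewrite ler_norml h1 h2.
have : `|a * b| <= `|b| by rewrite normrM ler_piMl.
by rewrite ler_norml.
Qed.

Lemma rhombus_depth_lipschitz N x y x' y' e : `|x' - x| <= e -> `|y' - y| <= e ->
  rhombus_depth N x' y' <= rhombus_depth N x y + 41 * e.
Proof.
rewrite /rhombus_depth => hx hy.
have hy' : `|y| <= `|y'| + e.
  have := ler_normB y' (y' - y); rewrite opprB addrC subrK => h.
  by apply: (le_trans h); rewrite lerD2l.
move: hx; rewrite ler_norml => /andP[hx1 hx2].
have hm : Num.min (N - x') x' <= Num.min (N - x) x + e.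
  by rewrite /Num.min; case: ifP; case: ifP; lra.
lra.
Qed.

(* In the next three lemmas the walker stands at distance r from the origin, (a, b) are the
   coordinates of the unit vector along the axis of the rhombus relative to the walker's
   radial direction, and (s, t) are those of its step. *)
Lemma rhombus_depth_sideways r a b s t N : 200 <= r -> a ^+ 2 + b ^+ 2 = 1 -> s ^+ 2 + t ^+ 2 = 1 ->
  a <= 0 \/ 1 / 20 < `|b| ->
  rhombus_depth N ((r + s) * a + t * b) ((r + s) * b - t * a) <= - 40.
Proof.
move=> hr hab hst h; have [a1 a2 b1 b2] := unit_abs_le1 hab.
have [s1 s2 t1 t2] := unit_abs_le1 hst.
have hmin : Num.min (N - ((r + s) * a + t * b)) ((r + s) * a + t * b) <= (r + s) * a + t * b.
  by rewrite ge_min lexx orbT.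
have hy : r * `|b| - 2 <= `|(r + s) * b - t * a|.
  have -> : r * `|b| = `|r * b| by rewrite normrM ger0_norm//; lra.
  have : `|r * b| <= `|(r + s) * b - t * a| + `|t * a - s * b|.
    have {1}-> : r * b = (r + s) * b - t * a + (t * a - s * b) by ring.
    exact: ler_normD.
  have : `|t * a - s * b| <= 2.
    have /andP[u1 u2] := ler_mul_unit b s1 s2.
    have /andP[v1 v2] := ler_mul_unit a t1 t2.
    have ha : `|a| <= 1 by rewrite ler_norml a1 a2.
    have hb : `|b| <= 1 by rewrite ler_norml b1 b2.
    by rewrite ler_norml; apply/andP; split; lra.
  lra.
have hta : (r + s) * a + t * b <= r * a + 2.
  have /andP[u1 u2] := ler_mul_unit a s1 s2.
  have /andP[v1 v2] := ler_mul_unit b t1 t2.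
  have ha : `|a| <= 1 by rewrite ler_norml a1 a2.
  have hb : `|b| <= 1 by rewrite ler_norml b1 b2.
  rewrite mulrDl; lra.
rewrite /rhombus_depth.
set m := Num.min _ _ in hmin *; set y := `|_ - _| in hy *.
have hy0 : 0 <= y by rewrite /y.
(* If [|b|] exceeds 1/20, the term 40 r |b| exceeds 2 r and outweighs [r * a]; otherwise [a <= 0]
   forces [a <= -1/2], and [r * a <= -100] suffices. Both use [200 <= r]. *)
suff : r * a + 2 - 40 * y <= -40 by lra.
have hb0 : 0 <= `|b| by [].
case: (leP `|b| (1 / 20)) => hb; last by nra.
have a0 : a <= 0 by case: h => //; lra.
have b2' : b ^+ 2 <= 1 / 400 by rewrite -(real_normK (num_real b)); nra.
have : a <= -(1/2) by nra.
nra.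
Qed.

(** In the walker's frame the far vertex is (N a, N b), and the last hypothesis puts it behind the
    walker in a cone of slope 1/160. In the main case a step towards the axis regains at most 40 r
    |b| <= 80 N |b|, whereas the walker is already 151 N |b| past the vertex along the axis; what
    remains is -40 |t| up to rounding. *)
Lemma rhombus_depth_behind r a b s t N : 200 <= r -> a ^+ 2 + b ^+ 2 = 1 -> s ^+ 2 + t ^+ 2 = 1 ->
  0 < N -> 160 * (N * `|b|) <= r - N * a ->
  rhombus_depth N ((r + s) * a + t * b) ((r + s) * b - t * a) <= 6 - 40 * `|t|.
Proof.
move=> hr hab hst N0 h; have [a1 a2 b1 b2] := unit_abs_le1 hab.
have [s1 s2 t1 t2] := unit_abs_le1 hst.
have ht1 : `|t| <= 1 by rewrite ler_norml t1 t2.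
have [a0|a0] := leP a 0.
  by have := @rhombus_depth_sideways r a b s t N hr hab hst (or_introl a0); lra.
have [hb|hb] := ltP (1/20) `|b|.
  by have := @rhombus_depth_sideways r a b s t N hr hab hst (or_intror hb); lra.
have hb0 : 0 <= `|b| by [].
have b2' : b ^+ 2 <= 1 / 400 by rewrite -(real_normK (num_real b)); nra.
have a19 : 19 / 20 <= a by nra.
have /andP[sa1 sa2] := ler_mul_unit a s1 s2.
have /andP[tb1 tb2] := ler_mul_unit b t1 t2.
have /andP[sb1 sb2] := ler_mul_unit b s1 s2.
have ha1 : `|a| = a by rewrite ger0_norm// ltW.
rewrite ha1 in sa1 sa2.
set x := (r + s) * a + t * b.
have hx1 : r * a - 1 - 1/20 <= x by rewrite /x mulrDl; lra.
have hy : (19/20) * `|t| - 1 / 20 - r * `|b| <= `|(r + s) * b - t * a|.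
  have e1 : `|t * a| <= `|(r + s) * b - t * a| + `|(r + s) * b|.
    have {1}-> : t * a = (r + s) * b - ((r + s) * b - t * a) by ring.
    by rewrite [leRHS]addrC ler_normB.
  have e2 : `|(r + s) * b| <= r * `|b| + `|b|.
    rewrite mulrDl (le_trans (ler_normD _ _))// !normrM (ger0_norm (_ : 0 <= r)); last lra.
    rewrite lerD2l ler_piMl// ler_norml s1 s2//.
  have e3 : (19/20) * `|t| <= `|t * a| by rewrite normrM ha1 mulrC ler_wpM2l.
  lra.
rewrite /rhombus_depth.
set y := `|_ - _| in hy *.
have y0 : 0 <= y by rewrite /y.
(* If the vertex is less than half way out, [N - x] is below -80 and no finer estimate is needed. *)
have [pr|pr] := ltP (N * a) (r / 2).
  have : Num.min (N - x) x <= N - x by rewrite ge_min lexx.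
  set m := Num.min _ _; move=> hm.
  have : 19 / 20 * N <= N * a by rewrite mulrC ler_pM2l.
  have : 19 / 20 * r <= r * a by rewrite mulrC ler_pM2l//; lra.
  lra.
have : Num.min (N - x) x <= N - x by rewrite ge_min lexx.
set m := Num.min _ _; move=> hm.
(* N - r a = N b^2 - a (r - N a), and r - N a >= 160 N |b| *)
have e : N - r * a = N * b ^+ 2 - a * (r - N * a).
  rewrite -[X in X - _]mulr1 -hab; ring.
have Nb0 : 0 <= N * `|b| by rewrite mulr_ge0// ltW.
have e1 : 152 * (N * `|b|) <= a * (r - N * a).
  have : a * (160 * (N * `|b|)) <= a * (r - N * a) by rewrite ler_pM2l.
  have : 19/20 * (160 * (N * `|b|)) <= a * (160 * (N * `|b|)) by rewrite ler_wpM2r//; lra.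
  lra.
have e2 : N * b ^+ 2 <= N * `|b|.
  rewrite ler_pM2l// -(real_normK (num_real b)); nra.
have e3 : N - r * a + 151 * (N * `|b|) <= 0 by lra.
have e4 : r * `|b| <= 2 * (N * `|b|).
  have Na : N * a <= N by rewrite ler_piMr// ltW.
  have rN : r <= 2 * N by lra.
  by rewrite mulrA ler_wpM2r.
lra.
Qed.

(** The axis lies on one side of the radial ray and the step goes to the other, up to 1/400. The
    distance to the axis grows by about |t| while the other part of the depth gains at most 21/20;
    the slack 6 covers this and the rounding. The value -40 is for axes far off the radial
    direction. *)
Lemma rhombus_depth_beside r a b s t N : 200 <= r -> a ^+ 2 + b ^+ 2 = 1 -> s ^+ 2 + t ^+ 2 = 1 ->
  b <= 0 -> - (1 / 400) <= t ->
  rhombus_depth N ((r + s) * a + t * b) ((r + s) * b - t * a) <=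
    Num.max (- 40) (rhombus_depth N (r * a) (r * b) + 6 - 40 * `|t|).
Proof.
move=> hr hab hst bN ht; have [a1 a2 b1 b2] := unit_abs_le1 hab.
have [s1 s2 t1 t2] := unit_abs_le1 hst.
rewrite le_max.
have [a0|a0] := leP a 0.
  by rewrite (@rhombus_depth_sideways r a b s t N hr hab hst (or_introl a0)).
have [hb|hb] := ltP (1/20) `|b|.
  by rewrite (@rhombus_depth_sideways r a b s t N hr hab hst (or_intror hb)).
apply/orP; right.
have hb0 : 0 <= `|b| by [].
have b2' : b ^+ 2 <= 1 / 400 by rewrite -(real_normK (num_real b)); nra.
have a19 : 19 / 20 <= a by nra.
have /andP[sa1 sa2] := ler_mul_unit a s1 s2.
have /andP[tb1 tb2] := ler_mul_unit b t1 t2.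
have /andP[sb1 sb2] := ler_mul_unit b s1 s2.
have ha1 : `|a| = a by rewrite ger0_norm// ltW.
rewrite ha1 in sa1 sa2.
have hbn : `|b| = - b by rewrite ler0_norm.
have hrb : `|r * b| = - (r * b).
  by rewrite ler0_norm// mulr_ge0_le0//; lra.
have hta : `|t| - 1 / 200 - 1 / 20 <= t * a.
  have [t0|t0] := leP 0 t.
    rewrite ger0_norm//.
    have : t * (19 / 20) <= t * a by rewrite ler_wpM2l.
    lra.
  rewrite ltr0_norm//.
  have : t * 1 <= t * a by rewrite ler_nM2l.
  lra.
have hy : `|r * b| + `|t| - 1/200 - 1/10 <= `|(r + s) * b - t * a|.
  have := ler_norm (- ((r + s) * b - t * a)); rewrite normrN => h.
  apply: le_trans h; rewrite hrb mulrDl; lra.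
have hm : Num.min (N - ((r + s) * a + t * b)) ((r + s) * a + t * b)
    <= Num.min (N - r * a) (r * a) + 21/20.
  rewrite !mulrDl /Num.min; move: sa1 sa2 tb1 tb2 hb a2; clear => *.
  by case: ifP; case: ifP; lra.
rewrite /rhombus_depth.
set m := Num.min _ _ in hm *; set m' := Num.min _ _ in hm *.
set y := `|_ - _| in hy *; lra.
Qed.

End Rhombus.

(** * The penalty in the plane: increments, and lower bounds in degenerate positions *)

Section Plane.
Variable R : realType.
Local Notation pt := (R * R)%type.
Implicit Types p q s u v X Y : pt.

Definition dotp p q : R := p.1 * q.1 + p.2 * q.2.
Definition crsp p q : R := p.1 * q.2 - p.2 * q.1.

Lemma enorm_ge0 p : 0 <= enorm p. Proof. exact: sqrtr_ge0. Qed.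

Lemma sqr_enorm p : enorm p ^+ 2 = dotp p p.
Proof. by rewrite sqr_sqrtr ?addr_ge0 ?sqr_ge0// /dotp !expr2. Qed.

Lemma enorm_gt0 p : p != 0 -> 0 < enorm p.
Proof.
move=> p0; rewrite sqrtr_gt0 lt_neqAle addr_ge0 ?sqr_ge0// andbT eq_sym.
apply: contra p0; rewrite paddr_eq0 ?sqr_ge0// !sqrf_eq0 => /andP[/eqP h1 /eqP h2].
by case: p h1 h2 => ? ? /= -> ->.
Qed.

Lemma enorm0 : enorm (0 : pt) = 0.
Proof. by rewrite /enorm /= !expr0n/= addr0 sqrtr0. Qed.

Lemma dotp_crsp_sqr p q : dotp p q ^+ 2 + crsp p q ^+ 2 = dotp p p * dotp q q.
Proof. by rewrite /dotp /crsp; ring. Qed.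

Lemma dotp_le p q : `|dotp p q| <= enorm p * enorm q.
Proof.
rewrite -[leRHS]ger0_norm ?mulr_ge0 ?enorm_ge0// -ler_sqr ?nnegrE// !real_normK ?num_real//.
by rewrite exprMn !sqr_enorm -dotp_crsp_sqr lerDl sqr_ge0.
Qed.

Lemma crsp_le p q : `|crsp p q| <= enorm p * enorm q.
Proof.
rewrite -[leRHS]ger0_norm ?mulr_ge0 ?enorm_ge0// -ler_sqr ?nnegrE// !real_normK ?num_real//.
by rewrite exprMn !sqr_enorm -dotp_crsp_sqr lerDr sqr_ge0.
Qed.

Lemma enorm_padd p q : enorm (padd p q) <= enorm p + enorm q.
Proof.
rewrite -ler_sqr ?nnegrE ?addr_ge0 ?enorm_ge0// sqrrD !sqr_enorm.
have := dotp_le p q => /ler_normlW.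
rewrite /padd /dotp/=; lra.
Qed.

Lemma enorm_scale r p : 0 <= r -> enorm (pscale r p) = r * enorm p.
Proof.
move=> r0; rewrite /enorm /pscale/= !exprMn -mulrDr sqrtrM ?sqr_ge0//.
by rewrite sqrtr_sqr ger0_norm.
Qed.

Lemma dotp_unitv (t : R) : dotp (unitv t) (unitv t) = 1.
Proof. by rewrite /dotp/unitv/= -!expr2 cos2Dsin2. Qed.

Lemma enorm_unitv (t : R) : enorm (unitv t) = 1.
Proof. by rewrite /enorm/= cos2Dsin2 sqrtr1. Qed.

Lemma enorm1_sqr p : enorm p = 1 -> p.1 ^+ 2 + p.2 ^+ 2 = 1.
Proof. by move=> h; rewrite !expr2 -[LHS]/(dotp p p) -sqr_enorm h expr1n. Qed.

(* Depth of X in the rhombus with opposite vertices 0 and Y. *)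
Definition depth_along X Y : R :=
  rhombus_depth (enorm Y) (dotp X Y / enorm Y) (crsp X Y / enorm Y).

(** The offset 42 leaves room on both sides: a depth of -3/2, as in a thin cone, still gives a term
    above 40, and a depth of at most -40 gives a term of at most 2, negligible next to a penalty of
    40. The origin spans no rhombus. *)
Definition penalty_term X Y : R := if Y == 0 then 0 else 42 + depth_along X Y.

(** The current position [x n] is excluded: it becomes a vertex only once the walker has left it. *)
Definition penalty (x : nat -> pt) (n : nat) X : R :=
  \big[Num.max/0]_(k < n) penalty_term X (x k).

Lemma bigmax_ub (f : nat -> R) n k : (k < n)%N -> f k <= \big[Num.max/0]_(i < n) f i.
Proof. by move=> kn; rewrite (le_bigmax _ (fun i : 'I_n => f i) (Ordinal kn)). Qed.

Lemma bigmax_lub (f : nat -> R) n c : 0 <= c -> (forall k, (k < n)%N -> f k <= c) ->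
  \big[Num.max/0]_(i < n) f i <= c.
Proof. by move=> c0 h; apply: bigmax_le => // i _; exact: h. Qed.

Lemma penalty_ge0 x n X : 0 <= penalty x n X.
Proof. exact: bigmax_ge_id. Qed.

Lemma depth_along_lipschitz X s Y : Y != 0 -> depth_along (padd X s) Y <= depth_along X Y + 41 * enorm s.
Proof.
move=> Y0; have N0 := enorm_gt0 Y0.
apply: rhombus_depth_lipschitz.
- rewrite -mulrBl (_ : _ - _ = dotp s Y); last by rewrite /dotp/padd/=; ring.
  by rewrite normrM normfV (gtr0_norm N0) ler_pdivrMr// dotp_le.
- rewrite -mulrBl (_ : _ - _ = crsp s Y); last by rewrite /crsp/padd/=; ring.
  by rewrite normrM normfV (gtr0_norm N0) ler_pdivrMr// crsp_le.
Qed.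

Lemma penalty_lipschitz x n X s : penalty x n (padd X s) <= penalty x n X + 41 * enorm s.
Proof.
have s0 := enorm_ge0 s.
apply: (@bigmax_lub (fun k => penalty_term (padd X s) (x k))).
  by have := penalty_ge0 x n X; lra.
move=> k kn; have := @bigmax_ub (fun k => penalty_term X (x k)) n k kn.
rewrite -/(penalty x n X) /penalty_term; case: eqP => [_|/eqP xk0]; first by lra.
by have := depth_along_lipschitz X s xk0; lra.
Qed.

Lemma penaltyS x n X c : penalty x n X <= c -> penalty_term X (x n) <= c -> penalty x n.+1 X <= c.
Proof.
move=> h1 h2; apply: (@bigmax_lub (fun k => penalty_term X (x k))).
  exact: le_trans (penalty_ge0 x n X) h1.
move=> k; rewrite ltnS leq_eqVlt => /predU1P[->//|kn].
exact: le_trans (@bigmax_ub (fun k => penalty_term X (x k)) n k kn) h1.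
Qed.

(** A unit step from the vertex leaves the coordinate along the axis at least [enorm X - 1], so the
    depth is at most 1. *)
Lemma penalty_term_self X s : enorm s = 1 -> penalty_term (padd X s) X <= 43.
Proof.
move=> s1; rewrite /penalty_term; case: eqP => [_|/eqP X0]; first by lra.
have N0 := enorm_gt0 X0.
have : rhombus_depth (enorm X) (dotp (padd X s) X / enorm X) (crsp (padd X s) X / enorm X) <= 1.
  rewrite /rhombus_depth; set y := `|_|.
  have y0 : 0 <= y by rewrite /y.
  set a := _ / _.
  have : Num.min (enorm X - a) a <= enorm X - a by rewrite ge_min lexx.
  have : enorm X - a <= 1.
    rewrite /a (_ : dotp (padd X s) X = dotp X X + dotp s X); last by rewrite /dotp/padd/=; ring.
    rewrite -sqr_enorm mulrDl expr2 mulfK ?gt_eqF//.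
    have : - (dotp s X / enorm X) <= 1.
      rewrite -mulNr ler_pdivrMr//.
      have := dotp_le s X; rewrite s1 => /ler_normlP[]; lra.
    lra.
  lra.
rewrite /depth_along; lra.
Qed.

(** A crude bound (41 from old terms, 43 for the new vertex), enough wherever the norm alone has a
    drift bounded below. *)
Lemma penalty_step_le x n s : enorm s = 1 ->
  penalty x n.+1 (padd (x n) s) <= penalty x n (x n) + 83.
Proof.
move=> s1; apply: penaltyS.
  by have := penalty_lipschitz x n (x n) s; rewrite s1; lra.
by have := penalty_term_self (x n) s1; have := penalty_ge0 x n (x n); lra.
Qed.

Section frame.
Variables (r : R) (u : pt).
Hypotheses (r200 : 200 <= r) (u1 : enorm u = 1).

(** Here [a] and [b] are the cosine and sine of the angle from the radial direction [u] to the axis;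
    this brings depths into the form of the three rhombus lemmas. *)
Lemma depth_along_frame s Y : Y != 0 ->
  let a := dotp u Y / enorm Y in let b := crsp u Y / enorm Y in
  [/\ a ^+ 2 + b ^+ 2 = 1,
  depth_along (pscale r u) Y = rhombus_depth (enorm Y) (r * a) (r * b) &
  depth_along (padd (pscale r u) s) Y =
    rhombus_depth (enorm Y) ((r + dotp u s) * a + crsp u s * b) ((r + dotp u s) * b - crsp u s * a)].
Proof.
move=> Y0 a b; have N0 := enorm_gt0 Y0.
have uu := enorm1_sqr u1.
split.
- rewrite /a /b !expr_div_n -mulrDl dotp_crsp_sqr -!sqr_enorm u1 expr1n mul1r.
  by rewrite divff// expf_neq0// gt_eqF.
- by rewrite /depth_along /a /b; congr rhombus_depth; rewrite mulrA; congr (_ / _);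
    rewrite /dotp /crsp /pscale/=; ring.
- rewrite /depth_along /a /b; congr rhombus_depth; rewrite !mulrA -?mulrDl -?mulrBl; congr (_ / _).
    rewrite /dotp /crsp /padd /pscale /= mulrDl.
    transitivity (r * (u.1 * Y.1 + u.2 * Y.2) + (u.1 ^+ 2 + u.2 ^+ 2) * (s.1 * Y.1 + s.2 * Y.2)).
      by rewrite uu; ring.
    by ring.
  rewrite /dotp /crsp /padd /pscale /= mulrDl.
  transitivity (r * (u.1 * Y.2 - u.2 * Y.1) + (u.1 ^+ 2 + u.2 ^+ 2) * (s.1 * Y.2 - s.2 * Y.1)).
    by rewrite uu; ring.
  by ring.
Qed.

Let frame_unit s : enorm s = 1 -> dotp u s ^+ 2 + crsp u s ^+ 2 = 1.
Proof. by move=> s1; rewrite dotp_crsp_sqr -!sqr_enorm u1 s1 !expr1n mulr1. Qed.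

Lemma depth_along_behind s Y : Y != 0 -> enorm s = 1 ->
  160 * `|crsp u Y| <= r - dotp u Y ->
  depth_along (padd (pscale r u) s) Y <= 6 - 40 * `|crsp u s|.
Proof.
move=> Y0 s1 h; have N0 := enorm_gt0 Y0.
have [hab _ ->] := depth_along_frame s Y0.
apply: rhombus_depth_behind => //; first exact: frame_unit.
have -> : enorm Y * `|crsp u Y / enorm Y| = `|crsp u Y|.
  by rewrite normrM normfV (gtr0_norm N0) mulrC divfK// gt_eqF.
by rewrite [enorm Y * _]mulrC divfK// gt_eqF.
Qed.

Lemma depth_along_beside s Y : Y != 0 -> enorm s = 1 ->
  (crsp u Y <= 0 /\ - (1/400) <= crsp u s) \/ (0 <= crsp u Y /\ crsp u s <= 1/400) ->
  depth_along (padd (pscale r u) s) Y <=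
    Num.max (- 40) (depth_along (pscale r u) Y + 6 - 40 * `|crsp u s|).
Proof.
move=> Y0 s1 h; have N0 := enorm_gt0 Y0.
have [hab -> ->] := depth_along_frame s Y0; have hst := frame_unit s1.
case: h => -[h1 h2].
  by apply: rhombus_depth_beside => //; rewrite ler_pdivrMr// mul0r.
set a := _ / _ in hab *; set b := crsp u Y / _ in hab *.
set t := crsp u s in hst h2 *.
have tN N x y : rhombus_depth N x (- y) = rhombus_depth N x y by rewrite /rhombus_depth normrN.
have := @rhombus_depth_beside R r a (- b) (dotp u s) (- t) (enorm Y) r200.
rewrite (_ : r * - b = - (r * b)); last by rewrite mulrN.
rewrite normrN.
rewrite (_ : (r + dotp u s) * - b - - t * a = - ((r + dotp u s) * b - t * a)); last by ring.
rewrite !tN mulrNN; apply => //; rewrite ?sqrrN//.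
- by rewrite oppr_le0 divr_ge0// ltW.
- lra.
Qed.

(** The floor 40 makes the bound uniform: the term of a point behind is at most 42 + 6 - 40 |t|
    whatever it was before, and 48 is at most the penalty plus 8; the term of a point beside falls
    from its own old value. The new vertex [x n] counts as a point behind, with equality 0 = 0 in
    that condition. *)
Lemma penalty_step_bad x n s : x n = pscale r u -> enorm s = 1 -> 40 <= penalty x n (x n) ->
  (forall k, (k < n)%N -> x k != 0 ->
    160 * `|crsp u (x k)| <= r - dotp u (x k) \/
    (crsp u (x k) <= 0 /\ - (1/400) <= crsp u s) \/ (0 <= crsp u (x k) /\ crsp u s <= 1/400)) ->
  penalty x n.+1 (padd (x n) s) <= penalty x n (x n) + 8 - 40 * `|crsp u s|.
Proof.
move=> xn s1 V40 hk; have h200 := r200.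
have t1 : `|crsp u s| <= 1 by have := crsp_le u s; rewrite u1 s1 mulr1.
apply: penaltyS.
  apply: (@bigmax_lub (fun k => penalty_term (padd (x n) s) (x k))); first by lra.
  move=> k kn; have := @bigmax_ub (fun k => penalty_term (x n) (x k)) n k kn.
  rewrite -/(penalty x n (x n)) /penalty_term; case: eqP => [_|/eqP xk0]; first by lra.
  rewrite !xn in V40 *.
  case: (hk k kn xk0) => h.
    by have := depth_along_behind xk0 s1 h; lra.
  have := depth_along_beside xk0 s1 h; rewrite le_max => /orP[]; lra.
have xn0 : x n != 0.
  apply/eqP => h.
  have : enorm (x n) = r by rewrite xn enorm_scale ?u1 ?mulr1//; lra.
  rewrite h enorm0; lra.
rewrite /penalty_term (negbTE xn0).
have : 160 * `|crsp u (x n)| <= r - dotp u (x n).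
  have -> : crsp u (x n) = 0 by rewrite xn /crsp/=; ring.
  have -> : dotp u (x n) = r.
    by have := enorm1_sqr u1; rewrite xn /dotp/= => h; rewrite -[RHS]mulr1 -h; ring.
  by rewrite normr0 mulr0 subrr.
move/(depth_along_behind xn0 s1); rewrite {2 4}xn.
rewrite -xn.
lra.
Qed.

End frame.

(** With d and c the radial and transversal parts of s, the new norm E satisfies (E - (r + d)) (E +
    r + d) = c^2 and E + r + d <= 2 (r + 1). The quadratic term supplies the drift near the
    origin. *)
Lemma enorm_step_ge (r : R) u s : 0 < r -> enorm u = 1 -> enorm s = 1 ->
  r + dotp u s + crsp u s ^+ 2 / (2 * (r + 1)) <= enorm (padd (pscale r u) s).
Proof.
move=> r0 u1 s1.
have uu := enorm1_sqr u1.
have hst : dotp u s ^+ 2 + crsp u s ^+ 2 = 1.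
  by rewrite dotp_crsp_sqr -!sqr_enorm u1 s1 !expr1n mulr1.
set E := enorm _.
have E0 : 0 <= E by exact: enorm_ge0.
have E2 : E ^+ 2 = (r + dotp u s) ^+ 2 + crsp u s ^+ 2.
  rewrite sqr_enorm /dotp /crsp /padd /pscale /=.
  transitivity (r ^+ 2 * (u.1 ^+ 2 + u.2 ^+ 2) + 2 * r * (u.1 * s.1 + u.2 * s.2) + (s.1 ^+ 2 + s.2 ^+ 2)).
    by ring.
  rewrite uu -[in LHS](mul1r (s.1 ^+2 + s.2 ^+ 2)) -[in X in X * (s.1 ^+ _ + _)]uu; ring.
have Er : E <= r + 1.
  have := enorm_padd (pscale r u) s; rewrite enorm_scale ?u1 ?s1 ?mulr1// ltW//.
have [d1 d2 c1 c2] := unit_abs_le1 hst.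
set d := dotp u s in E2 d1 d2 *; set c := crsp u s in E2 c1 c2 *.
have hE : r + d <= E by nra.
have r1 : 0 < 2 * (r + 1) by lra.
suff : c ^+ 2 / (2 * (r + 1)) <= E - (r + d) by lra.
rewrite ler_pdivrMr//; nra.
Qed.

(** The previous position lies at distance 1 almost straight behind, so the walker is at most 1 past
    the vertex of its rhombus and within 1/80 of the axis: the depth is at least -1 - 40/80. *)
Lemma penalty_ge_behind x n (r : R) u : 200 <= r -> enorm u = 1 -> (0 < n)%N -> x n = pscale r u ->
  enorm (padd (x n.-1) (pscale (-1) (x n))) = 1 ->
  160 * `|crsp u (x n.-1)| <= r - dotp u (x n.-1) -> 40 <= penalty x n (x n).
Proof.
move=> r200 u1 n0 xn z1 h.
have uu := enorm1_sqr u1.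
have Y0 : x n.-1 != 0.
  apply/eqP => Y0; move: z1; rewrite Y0 (_ : padd _ _ = pscale r (pscale (-1) u)).
    rewrite enorm_scale; last lra.
    rewrite (_ : enorm _ = 1) ?mulr1; first by lra.
    by rewrite -[RHS]u1 /enorm /= !mulN1r !sqrrN.
  by rewrite xn /padd/pscale/=; congr pair; ring.
have N0 := enorm_gt0 Y0.
have n1 : (n.-1 < n)%N by rewrite prednK.
apply: le_trans (@bigmax_ub (fun k => penalty_term (x n) (x k)) n n.-1 n1).
rewrite /penalty_term (negbTE Y0) xn.
have [hab -> _] := depth_along_frame r u1 u Y0.
set Y := x n.-1 in z1 h Y0 N0 hab *.
set a := _ / _ in hab *; set b := _ / _ in hab *.
have Na : enorm Y * a = dotp u Y by rewrite mulrC divfK// gt_eqF.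
have Nb : enorm Y * b = crsp u Y by rewrite mulrC divfK// gt_eqF.
have hz : (dotp u Y - r) ^+ 2 + crsp u Y ^+ 2 = 1.
  move/enorm1_sqr: z1; rewrite xn /dotp /crsp /padd /pscale /= => <-.
  transitivity ((u.1 ^+ 2 + u.2 ^+ 2) * (Y.1 ^+ 2 + Y.2 ^+ 2)
    - 2 * r * (u.1 * Y.1 + u.2 * Y.2) + r ^+ 2); first by ring.
  rewrite uu mul1r; transitivity ((Y.1 ^+ 2 + Y.2 ^+ 2)
    - 2 * r * (u.1 * Y.1 + u.2 * Y.2) + r ^+ 2 * (u.1 ^+ 2 + u.2 ^+ 2)); last by ring.
  by rewrite uu mulr1.
set p := dotp u Y in Na h hz; set q := crsp u Y in Nb h hz.
have hpq := enorm_ge0 Y.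
have hN2 : enorm Y ^+ 2 = p ^+ 2 + q ^+ 2.
  rewrite -Na -Nb; transitivity (enorm Y ^+ 2 * (a ^+ 2 + b ^+ 2)); last by ring.
  by rewrite hab mulr1.
have q0 : 0 <= `|q| by [].
have [p1 p2 _ _] := unit_abs_le1 hz.
have pN : p <= enorm Y by nra.
have q160 : `|q| <= 1 / 160 by lra.
have q2 : q ^+ 2 <= 1/160 * `|q| by rewrite -(real_normK (num_real q)) expr2 ler_wpM2r.
rewrite /rhombus_depth.
have ra : r * a <= enorm Y + 1.
  rewrite -(ler_pM2l N0).
  have -> : enorm Y * (r * a) = r * p by rewrite -Na; ring.
  have -> : enorm Y * (enorm Y + 1) = p ^+ 2 + q ^+ 2 + enorm Y by rewrite -hN2; ring.
  have : r * p <= (p + 1) * p by apply: ler_wpM2r; lra.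
  have : 0 <= q ^+ 2 by rewrite sqr_ge0.
  rewrite expr2; lra.
have ra0 : 0 <= r * a.
  apply: mulr_ge0; first lra.
  by rewrite divr_ge0//; rewrite -/p; lra.
have rb : `|r * b| <= 1 / 80.
  rewrite normrM (ger0_norm (_ : 0 <= r)); last lra.
  rewrite -(ler_pM2l N0).
  have -> : enorm Y * (r * `|b|) = r * `|q|.
    by rewrite -Nb (normrM (enorm Y) b) (gtr0_norm N0); ring.
  have : r * `|q| <= (enorm Y * 2) * (1 / 160) by apply: ler_pM; lra.
  lra.
have : - 1 <= Num.min (enorm Y - r * a) (r * a) by rewrite le_min; apply/andP; split; lra.
set m := Num.min _ _; lra.
Qed.

(** The walker is inside the rhombus. With p and q the radial and transversal parts of [x k] and N
    its norm, the height over the axis is r |q| / N, and the distances along it to the two ends are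
    r p / N and at least r (p - r) / N; the slope 1/40 of the last hypothesis is that of the
    rhombus. *)
Lemma penalty_ge_beyond x n k (r : R) u : 0 < r -> enorm u = 1 -> (k < n)%N -> x n = pscale r u ->
  x k != 0 -> r < dotp u (x k) -> 40 * `|crsp u (x k)| <= dotp u (x k) - r ->
  40 <= penalty x n (x n).
Proof.
move=> r0 u1 kn xn Y0 h1 h2.
have N0 := enorm_gt0 Y0.
apply: le_trans (@bigmax_ub (fun k => penalty_term (x n) (x k)) n k kn).
rewrite /penalty_term (negbTE Y0) xn.
have [hab -> _] := depth_along_frame r u1 u Y0.
set Y := x k in h1 h2 Y0 N0 hab *.
set a := _ / _ in hab *; set b := _ / _ in hab *.
have Na : enorm Y * a = dotp u Y by rewrite mulrC divfK// gt_eqF.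
have Nb : enorm Y * b = crsp u Y by rewrite mulrC divfK// gt_eqF.
set p := dotp u Y in Na h1 h2; set q := crsp u Y in Nb h2.
have hN2 : enorm Y ^+ 2 = p ^+ 2 + q ^+ 2.
  rewrite -Na -Nb; transitivity (enorm Y ^+ 2 * (a ^+ 2 + b ^+ 2)); last by ring.
  by rewrite hab mulr1.
have rb : enorm Y * `|r * b| = r * `|q|.
  have -> : `|q| = enorm Y * `|b| by rewrite -[in LHS]Nb (normrM (enorm Y) b) (gtr0_norm N0).
  by rewrite normrM (gtr0_norm r0); ring.
suff : 0 <= rhombus_depth (enorm Y) (r * a) (r * b) by lra.
rewrite /rhombus_depth subr_ge0 le_min; apply/andP; split; rewrite -(ler_pM2l N0).
  have -> : enorm Y * (40 * `|r * b|) = 40 * (r * `|q|) by rewrite -rb; ring.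
  have -> : enorm Y * (enorm Y - r * a) = p ^+ 2 + q ^+ 2 - r * p.
    by rewrite -hN2 -Na; ring.
  have : r * (40 * `|q|) <= r * (p - r) by rewrite ler_pM2l.
  have : 0 <= q ^+ 2 by rewrite sqr_ge0.
  nra.
have -> : enorm Y * (40 * `|r * b|) = r * (40 * `|q|) by rewrite mulrCA rb mulrCA.
have -> : enorm Y * (r * a) = r * p by rewrite -Na; ring.
rewrite ler_pM2l//; lra.
Qed.

End Plane.

(** * Convex hulls of finitely many points: compactness, separation, interior *)

Section Hull.
Variable R : realType.
Local Notation pt := (R * R)%type.
Implicit Types (p q s u v y z : pt) (x : nat -> pt) (n k : nat).

Definition psub p q : pt := (p.1 - q.1, p.2 - q.2).

Lemma dotpBl p q s : dotp (psub p q) s = dotp p s - dotp q s.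
Proof. by rewrite /dotp/psub/=; ring. Qed.

Lemma hull_in x n k : (k <= n)%N -> hull_pts x n (x k).
Proof.
move=> kn; exists (fun i => (i == k)%:R); split; first by move=> i; case: eqP.
have kn' : (k < n.+1)%N by [].
have e (f : nat -> R) : \sum_(i < n.+1) (i == k :> nat)%:R * f i = f k.
  rewrite (bigD1 (Ordinal kn'))//= eqxx mul1r big1 ?addr0// => i /negP ik.
  rewrite (_ : (i == k :> nat) = false) ?mul0r//; apply/negP => /eqP e; apply: ik.
  by apply/eqP/val_inj.
split; last by rewrite (e (fun i => (x i).1)) (e (fun i => (x i).2)).
by rewrite -[RHS](e (fun=> 1)); apply: eq_bigr => i _ /=; rewrite mulr1.
Qed.

Lemma hull_sub x n y : hull_pts x n y -> hull_pts x n.+1 y.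
Proof.
move=> [lam [l0 [l1 [e1 e2]]]].
exists (fun i => if (i < n.+1)%N then lam i else 0); split.
  by move=> k; case: ifP.
have e (f : nat -> R) : \sum_(i < n.+2) (if (i < n.+1)%N then lam i else 0) * f i =
    \sum_(i < n.+1) lam i * f i.
  rewrite big_ord_recr/= ltnn mul0r addr0; apply: eq_bigr => i _.
  by rewrite ltn_ord.
split; last by rewrite (e (fun i => (x i).1)) (e (fun i => (x i).2)).
transitivity (\sum_(i < n.+1) lam i * 1).
  rewrite -(e (fun=> 1)); by apply: eq_bigr => i _ /=; rewrite mulr1.
by rewrite -[RHS]l1; apply: eq_bigr => i _; rewrite mulr1.
Qed.

Definition pmix (t : R) p q : pt := ((1 - t) * p.1 + t * q.1, (1 - t) * p.2 + t * q.2).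

Lemma hull_convex x n t y z : 0 <= t <= 1 -> hull_pts x n y -> hull_pts x n z ->
  hull_pts x n (pmix t y z).
Proof.
move=> /andP[t0 t1] [l [l0 [l1 [e1 e2]]]] [m [m0 [m1 [f1 f2]]]].
have e (f : nat -> R) : \sum_(i < n.+1) ((1 - t) * l i + t * m i) * f i =
    (1 - t) * (\sum_(i < n.+1) l i * f i) + t * (\sum_(i < n.+1) m i * f i).
  rewrite !mulr_sumr -big_split/=; apply: eq_bigr => i _; ring.
exists (fun i => (1 - t) * l i + t * m i); split.
  by move=> k; rewrite addr_ge0// mulr_ge0// subr_ge0.
split; last by rewrite (e (fun i => (x i).1)) (e (fun i => (x i).2)) -e1 -e2 -f1 -f2.
transitivity (\sum_(i < n.+1) ((1 - t) * l i + t * m i) * 1).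
  by apply: eq_bigr => i _; rewrite mulr1.
rewrite (e (fun=> 1)).
under eq_bigr do rewrite mulr1.
under [X in _ + _ * X]eq_bigr do rewrite mulr1.
rewrite l1 m1; ring.
Qed.

Lemma hullS x n : hull_pts x n.+1 =
  (fun pt : (R * R) * R => pmix pt.2 pt.1 (x n.+1)) @` (hull_pts x n `*` `[0, 1]%classic).
Proof.
apply/seteqP; split => [y [l [l0 [l1 [e1 e2]]]]|_ [[y t] /= [hy ht]] <-]; last first.
  by apply: hull_convex; rewrite ?in_itv//=; [exact: hull_sub|exact: hull_in].
set L := l n.+1; move: l1 e1 e2; rewrite !(big_ord_recr n.+1) /= -/L => l1 e1 e2.
have L1 : L <= 1.
  by rewrite -l1 lerDr sumr_ge0.
(* With all weight on the last point the other weights cannot be renormalized; [x 0] then serves as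
   an arbitrary base point. *)
move: L1; rewrite le_eqVlt => /predU1P[L1|L1].
  exists (x 0%N, 1) => /=.
    split; first exact: hull_in.
    by rewrite in_itv/= ler01 lexx.
  have /psumr_eq0P z : \sum_(i < n.+1) l i = 0 by move: l1; rewrite L1 => h; lra.
  have z' (f : nat -> R) : \sum_(i < n.+1) l i * f i = 0.
    by apply: big1 => i _; rewrite z// mul0r.
  case: y e1 e2 => y1 y2 /=.
  rewrite (z' (fun i => (x i).1)) (z' (fun i => (x i).2)) L1 => -> ->.
  by rewrite /pmix /=; congr pair; ring.
have L1' : 1 - L != 0 by rewrite subr_eq0 eq_sym lt_eqF.
have e (f : nat -> R) : \sum_(i < n.+1) ((1 - L)^-1 * l i) * f i =
    (1 - L)^-1 * \sum_(i < n.+1) l i * f i.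
  by rewrite mulr_sumr; apply: eq_bigr => i _; ring.
exists (((1 - L)^-1 * \sum_(i < n.+1) l i * (x i).1,
         (1 - L)^-1 * \sum_(i < n.+1) l i * (x i).2), L) => /=; last first.
  by case: y e1 e2 => y1 y2 /= -> ->; rewrite /pmix /= !mulrA divff// !mul1r.
split; last by rewrite in_itv/= l0 ltW.
exists (fun i => (1 - L)^-1 * l i); split.
  by move=> k; rewrite mulr_ge0// invr_ge0 subr_ge0 ltW.
rewrite (e (fun i => (x i).1)) (e (fun i => (x i).2)); split => //.
rewrite -mulr_sumr (_ : \sum_(i < n.+1) l i = 1 - L) ?mulVf//.
by rewrite -l1 addrK.
Qed.

(** By [hullS] each hull is a continuous image of the previous one times [0, 1]. Compactness yields
    the nearest point used for separation. *)
Lemma hull_compact x n : compact (hull_pts x n : set (R * R)%type).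
Proof.
elim: n => [|n ih].
  have -> : hull_pts x 0 = [set x 0%N].
    apply/seteqP; split => [y [l [_]]|_ ->]; last exact: hull_in.
    rewrite !big_ord_recr !big_ord0 /= !add0r => -[-> ] [].
    by rewrite !mul1r; case: y (x 0%N) => [? ?] [? ?] /= -> ->.
  exact: compact_set1.
rewrite hullS; apply: continuous_compact; last first.
  by apply: compact_setX => //; exact: segment_compact.
apply: continuous_subspaceT => -[p t].
have h1 : (fun q : (R * R) * R => (1 - q.2) * q.1.1 + q.2 * (x n.+1).1) @ (p, t) -->
    (1 - t) * p.1 + t * (x n.+1).1.
  apply: cvgD; apply: cvgM.
  - by apply: cvgB; [exact: cvg_cst|exact: cvg_snd].
  - by apply: (cvg_comp _ _ cvg_fst); exact: cvg_fst.
  - exact: cvg_snd.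
  - exact: cvg_cst.
have h2 : (fun q : (R * R) * R => (1 - q.2) * q.1.2 + q.2 * (x n.+1).2) @ (p, t) -->
    (1 - t) * p.2 + t * (x n.+1).2.
  apply: cvgD; apply: cvgM.
  - by apply: cvgB; [exact: cvg_cst|exact: cvg_snd].
  - by apply: (cvg_comp _ _ cvg_fst); exact: cvg_snd.
  - exact: cvg_snd.
  - exact: cvg_cst.
exact: (cvg_pair h1 h2).
Qed.

Lemma unitv_polar p : exists t : R, 0 <= t < pi *+ 2 /\ p = pscale (enorm p) (unitv t).
Proof.
have [->|p0] := eqVneq p 0.
  exists 0; split; first by rewrite lexx mulrn_wgt0// pi_gt0.
  by rewrite enorm0 /pscale/= !mul0r.
have N0 := enorm_gt0 p0.
have h : (p.1 / enorm p) ^+ 2 + (p.2 / enorm p) ^+ 2 = 1.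
  rewrite !expr_div_n -mulrDl sqr_enorm /dotp -!expr2 divff//.
  by have := exprn_gt0 2 N0; rewrite sqr_enorm /dotp -!expr2 => /lt0r_neq0.
have [a1 a2 b1 b2] := unit_abs_le1 h.
set a := _ / _ in h a1 a2; set b := _ / _ in h b1 b2.
have ha : -1 <= a <= 1 by rewrite a1 a2.
have ca : cos (acos a) = a by rewrite acosK// in_itv/= ha.
have sa : sin (acos a) = `|b|.
  by rewrite sin_acos// -h addrAC subrr add0r sqrtr_sqr.
have pi0 := @pi_gt0 R.
have A0 := acos_ge0 ha; have Api := acos_lepi ha.
have pa : p.1 = enorm p * a by rewrite mulrC divfK// gt_eqF.
have pb : p.2 = enorm p * b by rewrite mulrC divfK// gt_eqF.
have [b0|b0] := leP 0 b.
  exists (acos a); split; first by rewrite A0/= mulr2n; lra.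
  rewrite /pscale /unitv /= ca sa ger0_norm// -pa -pb; by case: (p).
exists (pi *+ 2 - acos a); split.
  apply/andP; split; first by rewrite mulr2n; lra.
  have : acos a != 0.
    by apply/eqP => A00; move: sa; rewrite A00 sin0 => /eqP; rewrite eq_sym normr_eq0 lt_eqF.
  rewrite neq_lt ltNge A0 /= => h0; by rewrite ltrBlDr ltrDl.
rewrite /pscale /unitv /= addrC cosD2pi sinD2pi cosN sinN ca sa ltr0_norm// opprK -pa -pb.
by case: (p).
Qed.

(* The point of the hull nearest to a point outside it gives a separating direction *)
Lemma hull_separation x n y : ~ hull_pts x n y ->
  exists t : R, forall k, (k <= n)%N -> dotp (psub (x k) y) (unitv t) < 0.
Proof.
move=> hy.
have cf : {within hull_pts x n : set (R * R)%type,
    continuous (fun p : R * R => (y.1 - p.1) * (y.1 - p.1) + (y.2 - p.2) * (y.2 - p.2))}.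
  apply: continuous_subspaceT => p.
  have h1 : (fun q : R * R => y.1 - q.1) @ p --> y.1 - p.1.
    by apply: cvgB; [exact: cvg_cst|exact: cvg_fst].
  have h2 : (fun q : R * R => y.2 - q.2) @ p --> y.2 - p.2.
    by apply: cvgB; [exact: cvg_cst|exact: cvg_snd].
  by apply: cvgD; apply: cvgM.
have [|c hc cmin] := compact_EVT_min _ (@hull_compact x n) cf.
  by exists (x 0%N); exact: hull_in.
rewrite inE in hc.
set w := psub y c.
have w0 : w != 0.
  apply/eqP => w0; apply: hy; rewrite (_ : y = c)//.
  by case: w0; case: (y) (c) => [? ?] [? ?] /= /subr0_eq -> /subr0_eq ->.
have N0 := enorm_gt0 w0.
have [t [_ ht]] := unitv_polar w.
have wt q : dotp q (unitv t) = dotp q w / enorm w.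
  by rewrite {1}ht /dotp /pscale/=; field; rewrite gt_eqF.
exists t => k kn; rewrite wt pmulr_llt0 ?invr_gt0//.
have ww : 0 < dotp w w by rewrite -sqr_enorm exprn_gt0.
set z := psub (x k) c.
have zw : dotp z w <= 0.
  rewrite leNgt; apply/negP => zw.
  (* moving from c towards x k would come nearer to y *)
  have zz : 0 <= dotp z z by rewrite -sqr_enorm sqr_ge0.
  (* The [+ 1] gives a positive denominator at once; all that is needed is that [t0 * dotp z z]
     stays below [2 * dotp z w]. *)
  pose t0 := Num.min 1 (dotp z w / (dotp z z + 1)).
  have zz1 : 0 < dotp z z + 1 by lra.
  have t00 : 0 < t0 by rewrite lt_min ltr01 divr_gt0.
  have t01 : t0 <= 1 by rewrite ge_min lexx.
  have t02 : t0 * (dotp z z + 1) <= dotp z w by rewrite -ler_pdivlMr// ge_min lexx orbT.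
  have /cmin : pmix t0 c (x k) \in hull_pts x n.
    by rewrite inE; apply: hull_convex => //; [rewrite (ltW t00)|exact: hull_in].
  rewrite /pmix/= => h.
  have : 0 <= t0 * (t0 * dotp z z - 2 * dotp z w).
    move: h; rewrite /dotp /z /w /psub /=; nra.
  rewrite pmulr_rge0//; nra.
have -> : dotp (psub (x k) y) w = dotp z w - dotp w w.
  by rewrite /z /w /dotp /psub/=; ring.
lra.
Qed.

(** A point y outside the hull would be strictly separated in some direction t, but the point
    supplied for t reaches at least as far as the whole ball. *)
Lemma hull_support_ball x n p (eta : R) y :
  (forall t : R, exists2 k, (k <= n)%N & eta <= dotp (psub (x k) p) (unitv t)) ->
  enorm (psub y p) < eta -> hull_pts x n y.
Proof.
move=> h hy; apply: contrapT => /hull_separation[t ht].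
have [k kn hk] := h t.
have := ht k kn; have := dotp_le (psub y p) (unitv t).
rewrite enorm_unitv mulr1 => /ler_normlW.
move: hk; rewrite !dotpBl; lra.
Qed.

Lemma interior_euclid (A : set (R * R)) p (eta : R) : 0 < eta ->
  (forall y, enorm (psub y p) < eta -> A y) -> interior A p.
Proof.
(* Balls of the product topology are squares; the one of half-side eta / 2 fits into the Euclidean
   ball. *)
move=> e0 h; apply/nbhs_ballP; exists (eta / 2) => /=; first by rewrite divr_gt0.
move=> y [/=]; rewrite /ball/= => h1 h2; apply: h.
have hs : `|p.1 - y.1| ^+ 2 < (eta / 2) ^+ 2 by rewrite ltr_pXn2r ?nnegrE// divr_ge0// ltW.
have ht : `|p.2 - y.2| ^+ 2 < (eta / 2) ^+ 2 by rewrite ltr_pXn2r ?nnegrE// divr_ge0// ltW.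
rewrite -(@ltr_pXn2r _ 2)// ?nnegrE ?enorm_ge0 ?ltW// sqr_enorm /dotp /psub/=.
rewrite !real_normK ?num_real// in hs ht.
nra.
Qed.

Lemma interior_euclidE (A : set (R * R)) p : interior A p ->
  exists2 eta : R, 0 < eta & forall y, enorm (psub y p) < eta -> A y.
Proof.
move=> /nbhs_ballP[e /= e0 he]; exists e => // y hy; apply: he.
have := enorm_ge0 (psub y p) => N0.
have h2 : enorm (psub y p) ^+ 2 < e ^+ 2 by rewrite ltr_pXn2r ?nnegrE// ltW.
rewrite sqr_enorm /dotp /psub/= in h2.
split; rewrite /ball/= -(@ltr_pXn2r _ 2)// ?nnegrE ?(ltW e0)// real_normK ?num_real//.
  have : 0 <= (y.2 - p.2) * (y.2 - p.2) by rewrite -expr2 sqr_ge0.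
  nra.
have : 0 <= (y.1 - p.1) * (y.1 - p.1) by rewrite -expr2 sqr_ge0.
nra.
Qed.

Lemma hull_halfplane x n c e y : (forall k, (k <= n)%N -> dotp (x k) e <= c) ->
  hull_pts x n y -> dotp y e <= c.
Proof.
move=> h [l [l0 [l1 [e1 e2]]]].
have -> : dotp y e = \sum_(k < n.+1) l k * dotp (x k) e.
  rewrite /dotp e1 e2 !mulr_suml -big_split/=; apply: eq_bigr => i _; ring.
rewrite -[c]mul1r -l1 mulr_suml; apply: ler_sum => i _.
by rewrite ler_wpM2l// h// -ltnS.
Qed.

Lemma hull_interior_halfplane x n c t y :
  (forall k, (k <= n)%N -> dotp (x k) (unitv t) <= c) ->
  interior (hull_pts x n : set (R * R)%type) y -> dotp y (unitv t) < c.
Proof.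
move=> h /interior_euclidE[eta e0 he].
have e20 : 0 < eta / 2 by rewrite divr_gt0.
have /(hull_halfplane h) : hull_pts x n (padd y (pscale (eta / 2) (unitv t))).
  apply: he; rewrite (_ : psub _ _ = pscale (eta / 2) (unitv t)).
    by rewrite enorm_scale ?enorm_unitv ?mulr1 ?ltW// ltr_pdivrMr// ltr_pMr// ltr1n.
  by rewrite /psub /padd /pscale/=; congr pair; ring.
have -> : dotp (padd y (pscale (eta / 2) (unitv t))) (unitv t) = dotp y (unitv t) + eta / 2.
  rewrite -[X in _ = _ + X]mulr1 -(@dotp_unitv R t) /dotp /padd /pscale/=; ring.
lra.
Qed.

(** Otherwise the support function, a maximum of finitely many continuous functions of the angle,
    has a positive minimum over a full turn, and a ball of that radius about p lies in the hull. *)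
Lemma support_exists x n p : ~ interior (hull_pts x n : set (R * R)%type) p ->
  exists t : R, forall k, (k <= n)%N -> dotp (psub (x k) p) (unitv t) <= 0.
Proof.
move=> hp; apply: contrapT => /forallNP hn; apply: hp.
have cdot k : continuous (fun t : R => dotp (psub (x k) p) (unitv t)).
  move=> t; rewrite /dotp/=; apply: cvgD; apply: cvgM; try exact: cvg_cst.
    exact: continuous_cos.
  exact: continuous_sin.
have [f [cf fle fge]] : exists f : R -> R, [/\ continuous f,
    (forall t, exists2 k, (k <= n)%N & f t <= dotp (psub (x k) p) (unitv t)) &
    forall t k, (k <= n)%N -> dotp (psub (x k) p) (unitv t) <= f t].
  elim: (n) => [|m [f [cf fle fge]]].
    exists (fun t => dotp (psub (x 0%N) p) (unitv t)); split => //.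
      by move=> t; exists 0%N.
    by move=> t k; rewrite leqn0 => /eqP ->.
  exists (f \max (fun t => dotp (psub (x m.+1) p) (unitv t))); split.
  - by move=> t; apply: continuous_max; [exact: cf|exact: cdot].
  - move=> t /=; rewrite /Num.max; case: ifP => _; first by exists m.+1.
    by have [k km hk] := fle t; exists k => //; exact: leqW.
  - move=> t k; rewrite leq_eqVlt => /predU1P[->|km] /=.
      by rewrite le_max lexx orbT.
    by rewrite le_max fge.
have pi20 : 0 <= pi *+ 2 :> R by rewrite mulrn_wge0// pi_ge0.
have [c _ cmin] := @EVT_min R f 0 (pi *+ 2) pi20 (continuous_subspaceT cf).
have fc : 0 < f c.
  rewrite ltNge; apply/negP => fc; apply: (hn c) => k kn.
  exact: le_trans (fge c k kn) fc.
apply: (@interior_euclid _ _ (f c)) => // y hy.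
apply: (@hull_support_ball _ _ p (f c)) => // t.
have [t' [/andP[t0 t2] ht]] := unitv_polar (unitv t).
rewrite enorm_unitv in ht.
have -> : unitv t = unitv t' by rewrite ht /pscale !mul1r.
have [k kn hk] := fle t'; exists k => //.
by apply: le_trans hk; apply: cmin; rewrite in_itv/= t0 ltW.
Qed.

End Hull.

(** * The cone in which the past is seen from the current position *)

Section Cone.
Variable R : realType.
Local Notation pt := (R * R)%type.
Implicit Types (p q s u v y z : pt) (x : nat -> pt) (n k : nat).

Lemma dotp_unitv2 (a b : R) : dotp (unitv a) (unitv b) = cos (b - a).
Proof. by rewrite cosB /dotp/=; ring. Qed.

Lemma crsp_unitv2 (a b : R) : crsp (unitv a) (unitv b) = sin (b - a).
Proof. by rewrite sinB /crsp/=; ring. Qed.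

Lemma dotp_pscalel (a : R) p q : dotp (pscale a p) q = a * dotp p q.
Proof. by rewrite /dotp /pscale/=; ring. Qed.

Lemma crsp_pscalel (a : R) p q : crsp (pscale a p) q = a * crsp p q.
Proof. by rewrite /crsp /pscale/=; ring. Qed.

Lemma crsp_pscaler (a : R) p q : crsp q (pscale a p) = a * crsp q p.
Proof. by rewrite /crsp /pscale/=; ring. Qed.

Lemma dotp_paddl p q s : dotp (padd p q) s = dotp p s + dotp q s.
Proof. by rewrite /dotp/padd/=; ring. Qed.

Lemma sin_le0_pi2pi (t : R) : pi < t < pi *+ 2 -> sin t < 0.
Proof.
move=> /andP[h1 h2]; rewrite -[t](subrK pi) sinDpi oppr_lt0.
by apply: sin_gt0_pi; rewrite subr_gt0 h1 ltrBlDr -mulr2n.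
Qed.

(** Taking the angle in a window of length pi that depends only on the half-plane lets the
    directions of all past points be compared as real numbers. *)
Lemma halfplane_polar z (e : R) : dotp z (unitv e) <= 0 ->
  exists t : R, e + pi / 2 <= t <= e + pi / 2 + pi /\ z = pscale (enorm z) (unitv t).
Proof.
move=> h; have pi0 := @pi_gt0 R.
have [->|z0] := eqVneq z 0.
  exists (e + pi / 2); rewrite lexx lerDl ltW//; split=> //.
  by rewrite enorm0 /pscale/= !mul0r.
set a := e + pi / 2.
pose z' : pt := (dotp (unitv a) z, crsp (unitv a) z).
have zz : enorm z' = enorm z.
  by rewrite /enorm /= dotp_crsp_sqr dotp_unitv mul1r /dotp -!expr2.
have N0 := enorm_gt0 z0.
have [t [/andP[t0 t2] zt]] := unitv_polar z'.
have st : 0 <= sin t.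
  rewrite -(pmulr_rge0 _ N0) -zz (_ : _ * _ = z'.2); last by rewrite [in RHS]zt.
  rewrite /= (_ : crsp _ _ = - dotp z (unitv e)) ?oppr_ge0//.
  by rewrite /crsp /dotp /a /= cosDpihalf sinDpihalf; ring.
exists (a + t); split.
  rewrite lerDl t0 lerD2l leNgt; apply/negP => ht.
  have := @sin_le0_pi2pi t; rewrite ht t2 => /(_ isT); lra.
rewrite -zz.
have := cos2Dsin2 a => ca.
have e1 : z'.1 = enorm z' * cos t by rewrite [in LHS]zt.
have e2 : z'.2 = enorm z' * sin t by rewrite [in LHS]zt.
rewrite /pscale /unitv /= cosD sinD.
have -> : enorm z' * (cos a * cos t - sin a * sin t) = cos a * z'.1 - sin a * z'.2.
  by rewrite e1 e2; ring.
have -> : enorm z' * (sin a * cos t + cos a * sin t) = sin a * z'.1 + cos a * z'.2.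
  by rewrite e1 e2; ring.
rewrite /z' /dotp /crsp /=; case: (z) => z1 z2 /=; congr pair.
  by rewrite -[LHS]mul1r -ca; ring.
by rewrite -[LHS]mul1r -ca; ring.
Qed.

Lemma cone_structure x n : (exists2 k, (k <= n)%N & psub (x k) (x n) != 0) ->
  (exists t : R, forall k, (k <= n)%N -> dotp (psub (x k) (x n)) (unitv t) <= 0) ->
  exists (m M : R) (psi : nat -> R) (i j : nat),
  [/\ 0 <= m < pi *+ 2, m <= M <= m + pi,
    (forall k, (k <= n)%N -> m <= psi k <= M /\
      psub (x k) (x n) = pscale (enorm (psub (x k) (x n))) (unitv (psi k))),
    [/\ (i <= n)%N, psub (x i) (x n) != 0 & psi i = m] &
    [/\ (j <= n)%N, psub (x j) (x n) != 0 & psi j = M]].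
Proof.
move=> [k0 k0n zk0] [e he].
have /choice[psi0 hpsi0] : forall k : nat, exists t : R, (k <= n)%N ->
    e + pi / 2 <= t <= e + pi / 2 + pi /\
    psub (x k) (x n) = pscale (enorm (psub (x k) (x n))) (unitv t).
  move=> k; case: (leqP k n) => kn; last by exists 0.
  by have [t ht] := halfplane_polar (he k kn); exists t.
pose P (k : 'I_n.+1) := psub (x k) (x n) != 0.
have k0n' : (k0 < n.+1)%N by [].
have Pk0 : P (Ordinal k0n') by [].
have [i Pi imin] := @arg_minP _ R _ (Ordinal k0n') P (fun k : 'I_n.+1 => psi0 k) Pk0.
have [j Pj jmax] := @arg_maxP _ R _ (Ordinal k0n') P (fun k : 'I_n.+1 => psi0 k) Pk0.
have [t [t02 tE]] := unitv_polar (psub (x i) (x n)).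
have iN : (i <= n)%N by rewrite -ltnS.
have jN : (j <= n)%N by rewrite -ltnS.
have Ni := enorm_gt0 Pi.
have [hi1 hi2] := hpsi0 i iN.
have [hj1 hj2] := hpsi0 j jN.
have ut : unitv t = unitv (psi0 i).
  move: hi2; rewrite {1}tE => -[] /(mulfI (lt0r_neq0 Ni)) h1 /(mulfI (lt0r_neq0 Ni)) h2.
  by rewrite /unitv h1 h2.
have [ct st] : cos t = cos (psi0 i) /\ sin t = sin (psi0 i) by case: ut.
(* This shift is a multiple of 2 pi bringing the smallest angle into [0, 2 pi); only its cosine and
   sine are needed. *)
pose sh := t - psi0 i.
have csh : cos sh = 1.
  by rewrite cosB ct st -!expr2 cos2Dsin2.
have ssh : sin sh = 0 by rewrite sinB ct st; ring.
have ush a : unitv (a + sh) = unitv a.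
  by rewrite /unitv cosD sinD csh ssh !mulr1 !mulr0 subr0 addr0.
(* A past point equal to [x n] has no direction and receives the smallest angle by default. *)
exists t, (psi0 j + sh), (fun k => if psub (x k) (x n) == 0 then t else psi0 k + sh), i, j.
have mM : t <= psi0 j + sh.
  by have := imin j Pj; rewrite /sh; lra.
split => //.
- rewrite mM /=; move: hi1 hj1; rewrite /sh; lra.
- move=> k kn; case: eqP => [->|/eqP zk].
    by rewrite lexx mM; split => //; rewrite enorm0 /pscale/= !mul0r.
  rewrite ush; have [hk1 hk2] := hpsi0 k kn; split => //.
  have kn' : (k < n.+1)%N by [].
  have Pk : P (Ordinal kn') by [].
  have := imin _ Pk; have := jmax _ Pk; rewrite /sh /=; lra.
- by split => //; rewrite (negbTE Pi) /sh; ring.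
- by split => //; rewrite (negbTE Pj).
Qed.

(** The weight missing from 1 falls to [x n]. Arguing by separation avoids building weights for
    indices that may coincide. *)
Lemma hull_combo x n a b c (ca cb cc : R) y : (a <= n)%N -> (b <= n)%N -> (c <= n)%N ->
  0 < ca -> 0 <= cb -> 0 <= cc -> ca + cb + cc <= 1 ->
  psub y (x n) = padd (padd (pscale ca (psub (x a) (x n))) (pscale cb (psub (x b) (x n))))
    (pscale cc (psub (x c) (x n))) ->
  hull_pts x n y.
Proof.
move=> an bn cn a0 b0 c0 c1 hy; apply: contrapT => /hull_separation[t ht].
have W q : dotp (psub q y) (unitv t) =
    dotp (psub q (x n)) (unitv t) - dotp (psub y (x n)) (unitv t).
  by rewrite /dotp /psub/=; ring.
have := ht a an; have := ht b bn; have := ht c cn; have := ht n (leqnn n).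
rewrite !W.
have -> : dotp (psub (x n) (x n)) (unitv t) = 0 by rewrite /dotp /psub/= !subrr !mul0r addr0.
have : dotp (psub y (x n)) (unitv t) = ca * dotp (psub (x a) (x n)) (unitv t)
   + cb * dotp (psub (x b) (x n)) (unitv t) + cc * dotp (psub (x c) (x n)) (unitv t).
  by rewrite hy !dotp_paddl !dotp_pscalel.
set w := dotp (psub y _) _; set wa := dotp _ _; set wb := dotp _ _; set wc := dotp _ _.
move=> e h1 h2 h3 h4.
have : ca * wa < ca * w by rewrite ltr_pM2l//; lra.
have : cb * wb <= cb * w by rewrite ler_wpM2l//; lra.
have : cc * wc <= cc * w by rewrite ler_wpM2l//; lra.
have : (ca + cb + cc) * w <= 1 * w by rewrite ler_wpM2r//; lra.
lra.
Qed.

Lemma hull_cone_interior x n a b c (ca cb cc : R) s :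
  (a <= n)%N -> (b <= n)%N -> (c <= n)%N -> 0 < ca -> 0 < cb -> 0 <= cc ->
  crsp (psub (x a) (x n)) (psub (x b) (x n)) != 0 ->
  s = padd (padd (pscale ca (psub (x a) (x n))) (pscale cb (psub (x b) (x n))))
    (pscale cc (psub (x c) (x n))) ->
  exists2 t : R, 0 <= t <= 1 &
    interior (hull_pts x n : set (R * R)%type) (padd (x n) (pscale t s)).
Proof.
move=> an bn cn a0 b0 c0 D0 hs.
set za := psub (x a) _ in D0 hs *; set zb := psub (x b) _ in D0 hs *.
set zc := psub (x c) _ in hs *.
set D := crsp za zb in D0.
(* This normalization lets the first two coefficients double while the total stays below 1, which
   leaves room for the perturbation [d]. *)
set S := 1 + 2 * ca + 2 * cb + cc.
have S0 : 0 < S by rewrite /S; lra.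
pose t := S^-1.
have t0 : 0 < t by rewrite invr_gt0.
have tS : t * S = 1 by rewrite mulVf// gt_eqF.
exists t.
  by rewrite ltW//= invf_le1// /S; lra.
have D0' : 0 < `|D| by rewrite normr_gt0.
pose L := enorm za + enorm zb + 1.
have za0 := enorm_ge0 za; have zb0 := enorm_ge0 zb.
have L0 : 0 < L by rewrite /L; lra.
pose mc := Num.min ca cb.
have mc0 : 0 < mc by rewrite lt_min a0 b0.
apply: (@interior_euclid _ _ _ (t * mc * `|D| / L)).
  by rewrite divr_gt0// !mulr_gt0.
move=> y; set d := psub y _ => hd.
(* Cramer's rule: the coordinates of [d] in the basis [za], [zb]. *)
pose al := crsp d zb / D; pose be := crsp za d / D.
have bound (w : R) : `|w| <= enorm d * L -> `|w / D| < t * mc.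
  move=> hw; rewrite normrM normfV ltr_pdivrMr//.
  apply: (le_lt_trans hw); rewrite -ltr_pdivlMr//.
have hal : `|al| < t * mc.
  apply: bound; apply: le_trans (crsp_le _ _) _; rewrite ler_wpM2l ?enorm_ge0//.
  rewrite /L; lra.
have hbe : `|be| < t * mc.
  apply: bound; apply: le_trans (crsp_le _ _) _; rewrite mulrC ler_wpM2l ?enorm_ge0//.
  rewrite /L; lra.
have mca : t * mc <= t * ca by rewrite ler_pM2l// ge_min lexx.
have mcb : t * mc <= t * cb by rewrite ler_pM2l// ge_min lexx orbT.
move: hal hbe; rewrite !ltr_norml => /andP[al1 al2] /andP[be1 be2].
have tS' : t + 2 * (t * ca) + 2 * (t * cb) + t * cc = 1.
  by rewrite -[RHS]tS /S; ring.
have tc0 : 0 <= t * cc by rewrite mulr_ge0// ltW.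
apply: (@hull_combo x n a b c (t * ca + al) (t * cb + be) (t * cc)) => //; [lra|lra|lra|].
have -> : psub y (x n) = padd d (pscale t s).
  by rewrite /d /psub /padd /pscale/=; congr pair; ring.
have dE : d = padd (pscale al za) (pscale be zb).
  have D1 : za.1 * zb.2 - za.2 * zb.1 != 0 := D0.
  rewrite /al /be /D /padd /pscale /crsp; case: (d) => d1 d2 /=.
  by congr pair; field.
rewrite {1}dE hs /psub /padd /pscale/=; congr pair; ring.
Qed.

End Cone.

(** * The allowed directions are the complement of the cone *)

Section Allowed.
Variable R : realType.
Local Notation pt := (R * R)%type.
Implicit Types (p q s u v y z : pt) (x : nat -> pt) (n k : nat).

Lemma unitv_comb (m M th : R) : sin (M - m) != 0 ->
  unitv th = padd (pscale (sin (M - th) / sin (M - m)) (unitv m))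
                  (pscale (sin (th - m) / sin (M - m)) (unitv M)).
Proof.
move=> h; rewrite /unitv /padd /pscale /=.
have e1 : sin (M - m) * cos th = sin (M - th) * cos m + sin (th - m) * cos M.
  rewrite !sinB; ring.
have e2 : sin (M - m) * sin th = sin (M - th) * sin m + sin (th - m) * sin M.
  rewrite !sinB; ring.
congr pair; apply: (mulfI h); rewrite ?e1 ?e2; field.
  exact: h.
exact: h.
Qed.

(** Interior points lie strictly inside every half-plane through [x n] that contains the past; the
    two half-planes along the sides of the cone give the two sines. *)
Lemma interior_in_cone x n (m M : R) (psi : nat -> R) (th t : R) : m <= M <= m + pi ->
  (forall k, (k <= n)%N -> m <= psi k <= M /\
      psub (x k) (x n) = pscale (enorm (psub (x k) (x n))) (unitv (psi k))) ->
  0 <= t -> interior (hull_pts x n : set (R * R)%type) (padd (x n) (pscale t (unitv th))) ->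
  0 < sin (th - m) /\ 0 < sin (M - th).
Proof.
move=> /andP[mM Mm] hpsi t0 hi.
have key a : (forall k, (k <= n)%N -> cos (psi k - a) <= 0) -> cos (th - a) < 0.
  move=> ha.
  have : dotp (padd (x n) (pscale t (unitv th))) (unitv a) < dotp (x n) (unitv a).
    apply: (@hull_interior_halfplane _ x n) => // k kn.
    rewrite -subr_le0 -dotpBl (hpsi k kn).2 dotp_pscalel dotp_unitv2 -opprB cosN.
    by rewrite mulr_ge0_le0 ?enorm_ge0// ha.
  rewrite dotp_paddl gtrDl dotp_pscalel dotp_unitv2 -opprB cosN => h.
  rewrite ltNge; apply/negP => h'; move: h; rewrite ltNge mulr_ge0//.
split.
  have := key (m - pi / 2); rewrite (_ : th - _ = (th - m) + pi / 2); last by ring.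
  rewrite cosDpihalf oppr_lt0; apply => k kn.
  rewrite (_ : psi k - _ = (psi k - m) + pi / 2); last by ring.
  rewrite cosDpihalf oppr_le0; have [hk _] := hpsi k kn.
  by apply: sin_ge0_pi; lra.
have := key (M + pi / 2); rewrite (_ : th - _ = - (M - th) - pi / 2); last by ring.
rewrite cosBpihalf sinN oppr_lt0; apply => k kn.
rewrite (_ : psi k - _ = - (M - psi k) - pi / 2); last by ring.
rewrite cosBpihalf sinN oppr_le0; have [hk _] := hpsi k kn.
by apply: sin_ge0_pi; lra.
Qed.

(** For an opening below pi the two extreme points span the cone. At opening pi they are opposite
    and span only a line, so a third point off that line joins them. *)
Lemma cone_in_interior x n (m M : R) (psi : nat -> R) i j (th : R) : m <= M <= m + pi ->
  (forall k, (k <= n)%N -> m <= psi k <= M /\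
      psub (x k) (x n) = pscale (enorm (psub (x k) (x n))) (unitv (psi k))) ->
  [/\ (i <= n)%N, psub (x i) (x n) != 0 & psi i = m] ->
  [/\ (j <= n)%N, psub (x j) (x n) != 0 & psi j = M] ->
  (exists2 k, (k <= n)%N & psub (x k) (x n) != 0 /\ sin (psi k - m) != 0) ->
  0 < sin (th - m) -> 0 < sin (M - th) ->
  exists2 t : R, 0 <= t <= 1 &
    interior (hull_pts x n : set (R * R)%type) (padd (x n) (pscale t (unitv th))).
Proof.
move=> /andP[mM Mm] hpsi [iN zi ei] [jN zj ej] [k kN [zk sk]] s1 s2.
have Ni := enorm_gt0 zi; have Nj := enorm_gt0 zj; have Nk := enorm_gt0 zk.
have [hi1 hi2] := hpsi i iN; have [hj1 hj2] := hpsi j jN; have [hk1 hk2] := hpsi k kN.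
rewrite ei in hi2; rewrite ej in hj2.
set ri := enorm _ in Ni hi2; set rj := enorm _ in Nj hj2; set rk := enorm _ in Nk hk2.
move: Mm; rewrite le_eqVlt => /predU1P[Mpi|Mpi]; last first.
  have mM' : m < M.
    rewrite lt_neqAle mM andbT; apply/eqP => e; move: s2.
    rewrite -e -opprB sinN; lra.
  have sM : 0 < sin (M - m) by apply: sin_gt0_pi; lra.
  have sM0 := lt0r_neq0 sM.
  apply: (@hull_cone_interior _ x n i j n
    (sin (M - th) / sin (M - m) / ri)
    (sin (th - m) / sin (M - m) / rj) 0) => //.
  - by rewrite !divr_gt0.
  - by rewrite !divr_gt0.
  - rewrite hi2 hj2 crsp_pscalel crsp_pscaler crsp_unitv2.
    by rewrite !mulf_neq0// lt0r_neq0.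
  - have ni0 := lt0r_neq0 Ni; have nj0 := lt0r_neq0 Nj.
    rewrite hi2 hj2 {1}(unitv_comb th sM0) /padd /pscale /=.
    by congr pair; field; rewrite sM0 ni0 nj0.
have uM : unitv M = pscale (-1) (unitv m).
  by rewrite Mpi /unitv /pscale /= cosDpi sinDpi !mulN1r.
set q := sin (psi k - m) in sk.
have q0 : 0 < q by rewrite lt_neqAle eq_sym sk /= sin_ge0_pi//; lra.
pose c3 := sin (th - m) / q.
have c30 : 0 < c3 by rewrite divr_gt0.
pose c := cos (th - m) - c3 * cos (psi k - m).
have hs : unitv th = padd (pscale c (unitv m)) (pscale c3 (unitv (psi k))).
  have c3q : c3 * q = sin (th - m) by rewrite divfK.
  have e1 : cos th = cos m * cos (th - m) - sin m * sin (th - m).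
    by rewrite -cosD addrC subrK.
  have e2 : sin th = sin m * cos (th - m) + cos m * sin (th - m).
    by rewrite -sinD addrC subrK.
  have e3 : cos (psi k) = cos m * cos (psi k - m) - sin m * q.
    by rewrite -cosD addrC subrK.
  have e4 : sin (psi k) = sin m * cos (psi k - m) + cos m * q.
    by rewrite -sinD addrC subrK.
  rewrite /unitv /padd /pscale /= e1 e2 e3 e4 -c3q /c.
  by congr pair; ring.
(* Since [c] may be negative, the direction m receives the weight |c| + 1 and the opposite direction
   M the weight |c| + 1 - c. *)
have c0 : 0 <= `|c| by [].
have cc : 0 <= `|c| + 1 - c by have := ler_norm c; lra.
apply: (@hull_cone_interior _ x n i k j ((`|c| + 1) / ri) (c3 / rk) ((`|c| + 1 - c) / rj)) => //.
- by rewrite divr_gt0//; lra.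
- by rewrite divr_gt0.
- by rewrite divr_ge0// ltW.
- by rewrite hi2 hk2 crsp_pscalel crsp_pscaler crsp_unitv2 !mulf_neq0// lt0r_neq0.
- rewrite hi2 hj2 hk2 hs uM /padd /pscale /=; congr pair; field.
    by rewrite !lt0r_neq0.
  by rewrite !lt0r_neq0.
Qed.

Lemma collinear_no_interior x n (m : R) y :
  (forall k, (k <= n)%N -> crsp (unitv m) (psub (x k) (x n)) = 0) ->
  ~ interior (hull_pts x n : set (R * R)%type) y.
Proof.
move=> h hi.
have h1 : dotp y (unitv (m + pi / 2)) < dotp (x n) (unitv (m + pi / 2)).
  apply: (@hull_interior_halfplane _ x n) => // k kn.
  rewrite -subr_le0 -dotpBl /dotp /= cosDpihalf sinDpihalf.
  by have := h k kn; rewrite /crsp/=; lra.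
have h2 : dotp y (unitv (m - pi / 2)) < dotp (x n) (unitv (m - pi / 2)).
  apply: (@hull_interior_halfplane _ x n) => // k kn.
  rewrite -subr_le0 -dotpBl /dotp /= cosBpihalf sinBpihalf.
  by have := h k kn; rewrite /crsp/=; lra.
move: h1 h2; rewrite /dotp /= cosDpihalf sinDpihalf cosBpihalf sinBpihalf; lra.
Qed.

(* [m, M] is the angular range in which the past is seen from the current
   position; the second alternative of the last clause is the collinear case. *)
Lemma allowed_structure x n : x 0%N = 0 -> x n != 0 -> allowed_angles x n !=set0 ->
  exists (m M : R) (psi : nat -> R) (i j : nat),
  [/\ [/\ 0 <= m < pi *+ 2, m <= M <= m + pi &
    (forall k, (k <= n)%N -> m <= psi k <= M /\
      psub (x k) (x n) = pscale (enorm (psub (x k) (x n))) (unitv (psi k)))],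
    [/\ (i <= n)%N, psub (x i) (x n) != 0 & psi i = m],
    [/\ (j <= n)%N, psub (x j) (x n) != 0 & psi j = M] &
    allowed_angles x n = [set th | 0 <= th < 2 * pi /\ ~ (0 < sin (th - m) /\ 0 < sin (M - th))]
    \/ (allowed_angles x n = [set th | 0 <= th < 2 * pi] /\
        forall k, (k <= n)%N -> psub (x k) (x n) != 0 -> sin (psi k - m) = 0)].
Proof.
move=> x0 xn0 [th0 [hth0 hA]].
have nint : ~ interior (hull_pts x n : set (R * R)%type) (x n).
  have := hA 0; rewrite lexx ler01 => /(_ isT).
  rewrite (_ : padd _ _ = x n)//.
  by rewrite /padd /pscale /= !mul0r !addr0; case: (x n).
have z0 : exists2 k, (k <= n)%N & psub (x k) (x n) != 0.
  exists 0%N => //; rewrite x0; apply: contra xn0 => /eqP[]; rewrite !sub0r => /eqP.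
  by rewrite oppr_eq0 => /eqP h1 /eqP; rewrite oppr_eq0 => /eqP h2; case: (x n) h1 h2 => ? ? /= -> ->.
have [m [M [psi [i [j [h1 h2 h3 h4 h5]]]]]] := cone_structure z0 (support_exists nint).
exists m, M, psi, i, j; split => //.
have [hc|hc] := pselect (exists2 k, (k <= n)%N & psub (x k) (x n) != 0 /\ sin (psi k - m) != 0).
  left; apply/seteqP; split => th /= [hth h]; split => //.
    move=> [s1 s2].
    have [t t01 hi] := cone_in_interior h2 h3 h4 h5 hc s1 s2.
    exact: (h t t01).
  move=> t /andP[t0 _] hi; apply: h; exact: interior_in_cone h2 h3 t0 hi.
right; have hs k : (k <= n)%N -> psub (x k) (x n) != 0 -> sin (psi k - m) = 0.
  by move=> kn zk; apply: contrapT => /eqP sk; apply: hc; exists k.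
split => //; apply/seteqP; split => th /= hth; first by case: hth.
split => // t _; apply: (@collinear_no_interior _ _ m) => k kn.
have [_ ->] := h3 k kn; rewrite crsp_pscaler crsp_unitv2.
have [->|zk] := eqVneq (psub (x k) (x n)) 0; first by rewrite enorm0 mul0r.
by rewrite hs// mulr0.
Qed.

End Allowed.

(** * Integrals of the trigonometric drift bounds over intervals *)

Section TrigIntegral.
Variable R : realType.
Implicit Types (a b c d t m M : R).

(** Form of the lower bounds for the increment of the potential: [b] weighs the radial part of the
    step and [d] the squared transversal part. The family is stable under the affine map that bounds
    the exponential. *)
Definition trigf a b d c t : R := a + b * cos (t - c) + d * sin (t - c) ^+ 2.

Definition trigF a b d c t : R :=
  a * t + b * sin (t - c) + d * ((t - c) - sin (t - c) * cos (t - c)) / 2.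

Lemma is_derive_shift (f : R -> R) (df c t : R) :
  is_derive (t - c) 1 f df -> is_derive t 1 (fun x => f (x - c)) df.
Proof.
move=> h.
have hs : is_derive t 1 (fun x : R => x - c) 1.
  by apply: (is_derive_eq (is_deriveB _ _)); rewrite subr0.
have := @is_derive1_comp _ f (fun x => x - c) t _ _ h hs.
by rewrite mulr1.
Qed.

Lemma is_derive_trigF a b d c t : is_derive t 1 (trigF a b d c) (trigf a b d c t).
Proof.
have hs := is_derive_shift (is_derive_sin (t - c)).
have hc := is_derive_shift (is_derive_cos (t - c)).
have hi : is_derive t 1 (fun x : R => x - c) 1.
  by apply: (is_derive_eq (is_deriveB _ _)); rewrite subr0.
have h1 : is_derive t 1 (fun x : R => a * x) a.
  by apply: (is_derive_eq (is_deriveZ _ _)); rewrite /GRing.scale/= mulr1.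
have h2 : is_derive t 1 (fun x : R => b * sin (x - c)) (b * cos (t - c)).
  exact: (is_deriveZ b hs).
have h3 : is_derive t 1 (fun x => sin (x - c) * cos (x - c))
    (sin (t - c) *: - sin (t - c) + cos (t - c) *: cos (t - c)) := is_deriveM hs hc.
have h4 : is_derive t 1 (fun x => x - c - sin (x - c) * cos (x - c)) _ := is_deriveB hi h3.
have h5 : is_derive t 1 (fun x => d / 2 * (x - c - sin (x - c) * cos (x - c))) _ :=
  is_deriveZ (d / 2) h4.
have h6 : is_derive t 1 (fun x => a * x + b * sin (x - c)) _ := is_deriveD h1 h2.
have h7 : is_derive t 1 (fun x => a * x + b * sin (x - c) +
  d / 2 * (x - c - sin (x - c) * cos (x - c))) _ := is_deriveD h6 h5.
have -> : trigF a b d c = (fun x => a * x + b * sin (x - c) +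
  d / 2 * (x - c - sin (x - c) * cos (x - c))).
  by rewrite funeqE => x; rewrite /trigF; ring.
apply: (is_derive_eq h7); rewrite /trigf /GRing.scale /=.
have := cos2Dsin2 (t - c); set C := cos _; set S := sin _ => e.
transitivity (a + b * C + d / 2 * (C ^+ 2 + S ^+ 2 - (S * - S + C * C))).
    by rewrite e.
by field.
Qed.

Lemma continuous_trigf a b d c : continuous (trigf a b d c).
Proof.
have hc : continuous (fun t => cos (t - c)).
  move=> t; apply: (@continuous_comp _ _ _ (fun t => t - c) cos); last exact: continuous_cos.
  by apply: cvgB; [exact: cvg_id|exact: cvg_cst].
have hs : continuous (fun t => sin (t - c)).
  move=> t; apply: (@continuous_comp _ _ _ (fun t => t - c) sin); last exact: continuous_sin.
  by apply: cvgB; [exact: cvg_id|exact: cvg_cst].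
move=> t; rewrite /trigf; apply: cvgD; last first.
  by apply: cvgM; [exact: cvg_cst|apply: cvgM; exact: hs].
by apply: cvgD; [exact: cvg_cst|apply: cvgM; [exact: cvg_cst|exact: hc]].
Qed.

Lemma measurable_trigf a b d c (D : set R) : measurable_fun D (fun t : R => (trigf a b d c t)%:E).
Proof.
apply/measurable_EFinP; apply: measurable_funS (measurableT) (@subsetT _ _) _.
by apply: continuous_measurable_fun; exact: continuous_trigf.
Qed.

Lemma trigF_2pi a b d c t :
  trigF a b d c (t + pi *+ 2) = trigF a b d c t + (trigF a b d c (pi *+ 2) - trigF a b d c 0).
Proof.
have s2 u : sin (u + pi *+ 2 - c) = sin (u - c) by rewrite addrAC sinD2pi.
have c2 u : cos (u + pi *+ 2 - c) = cos (u - c) by rewrite addrAC cosD2pi.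
by rewrite -{2}[pi *+ 2]add0r /trigF !s2 !c2; field.
Qed.

Lemma integral_trigf a b d c (b0 b1 : bool) x y : x <= y ->
  (\int[lebesgue_measure]_(t in [set` Interval (BSide b0 x) (BSide b1 y)])
    (trigf a b d c t)%:E = (trigF a b d c y - trigF a b d c x)%:E)%E.
Proof.
move=> xy; rewrite integral_itv_bndoo; last exact: measurable_trigf.
rewrite -(@integral_itv_bndoo _ _ _ _ true false); last exact: measurable_trigf.
move: xy; rewrite le_eqVlt => /predU1P[->|xy].
  by rewrite set_itv1 integral_set1 subrr.
have der t : derivable (trigF a b d c) t 1 by have [] := is_derive_trigF a b d c t.
rewrite (@continuous_FTC2 _ _ (trigF a b d c)) ?EFinB//.
- exact/continuous_subspaceT/continuous_trigf.
- have ct t : {for t, continuous (trigF a b d c)}.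
    by apply: differentiable_continuous; apply/derivable1_diffP.
  split => //; first by apply: cvg_at_right_filter; exact: ct.
  by apply: cvg_at_left_filter; exact: ct.
- move=> t _; rewrite derive1E.
  by have hd := is_derive_trigF a b d c t; exact: derive_val.
Qed.

(** M may exceed 2 pi, and then the cone wraps past angle 0; hence the second alternative. *)
Lemma in_arc m M th : 0 <= m < pi *+ 2 -> m <= M <= m + pi -> 0 <= th < pi *+ 2 ->
  (0 < sin (th - m) /\ 0 < sin (M - th)) <-> (m < th < M \/ th < M - pi *+ 2).
Proof.
move=> hm hM hth; have pi0 := @pi_gt0 R.
have sneg t : pi < t < pi *+ 2 -> sin t < 0 by exact: sin_le0_pi2pi.
rewrite mulr2n in hm hth *.
have [th1|th1] := ltP m th.
  have [th2|th2] := ltP th M; last first.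
    split => [[h1 h2]|]; last by move=> []; lra.
    have : sin (th - M) = - sin (M - th) by rewrite -sinN opprB.
    have [e|e] := leP (th - M) pi.
      by have := @sin_ge0_pi R (th - M); rewrite e subr_ge0 th2 => /(_ isT); lra.
    have := sneg (th - m); rewrite mulr2n; lra.
  split => [_|_]; first by left.
  by split; apply: sin_gt0_pi; lra.
have [th2|th2] := ltP th (M - (pi + pi)).
  split => [_|_]; first by right.
  split.
    rewrite -sinD2pi; apply: sin_gt0_pi; rewrite mulr2n; lra.
  rewrite -[M - th](subrK (pi *+ 2)) sinD2pi; apply: sin_gt0_pi; rewrite mulr2n; lra.
split; last by move=> []; lra.
move=> [h1 h2].
have [e|e] := leP (m - th) pi.
  have := @sin_ge0_pi R (m - th); rewrite e subr_ge0 th1 => /(_ isT).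
  rewrite -opprB sinN; lra.
have := @sin_ge0_pi R (M - th - pi).
rewrite -[M - th](subrK pi) sinDpi in h2; move=> h; have := h; lra.
Qed.

End TrigIntegral.

(** * Integrals over the complement of the cone *)

Section ArcIntegral.
Variable R : realType.
Local Notation pt := (R * R)%type.
Implicit Types (x : nat -> pt) (n k : nat).

Lemma arc_compl_cover (m M : R) : 0 <= m < pi *+ 2 -> m <= M <= m + pi ->
  let A := [set th | 0 <= th < 2 * pi /\ ~ (0 < sin (th - m) /\ 0 < sin (M - th))] in
  let B := [set` `]m, (Num.min M (pi *+ 2))[] `|` [set` `[0, (M - pi *+ 2)[] in
  [set` `[0, (pi *+ 2)[] = A `|` B /\ A `&` B = set0.
Proof.
move=> hm hM A B; have pi0 := @pi_gt0 R; have pi2E : 2 * pi = pi *+ 2 :> R by rewrite mulr_natl.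
have disj : A `&` B = set0.
  apply/seteqP; split => th //= [].
  rewrite /A /B /= !in_itv/= lt_min pi2E => -[hth hs].
  have hin := in_arc hm hM hth.
  by case=> h; apply: hs; apply/hin; [left|right]; lra.
split => //.
apply/seteqP; split => th /=;
  rewrite !in_itv /= ?lt_min /A /B /= pi2E !in_itv/= ?lt_min; rewrite mulr2n in hm pi2E *.
  move=> hth.
  have hin := in_arc hm hM; rewrite mulr2n in hin; have {hin} hin := hin _ hth.
  have [/hin h|hn] := pselect (0 < sin (th - m) /\ 0 < sin (M - th)); last by left.
  by right; case: h => h; [left|right]; lra.
by move=> [[//]|[h|h]]; lra.
Qed.

Lemma measurable_arc_compl (m M : R) : 0 <= m < pi *+ 2 -> m <= M <= m + pi ->
  measurable [set th | 0 <= th < 2 * pi /\ ~ (0 < sin (th - m) /\ 0 < sin (M - th))].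
Proof.
move=> hm hM; have [fullE disj] := arc_compl_cover hm hM.
set A := (X in measurable X); set B := (X in _ = _ `|` X) in fullE disj.
rewrite -/A in fullE disj.
rewrite (_ : A = [set` `[0, (pi *+ 2)[] `\` B).
  by apply: measurableD => //; exact: measurableU.
rewrite fullE setDE setIUl -setDE -setDE setDv setU0.
apply/seteqP; split => th //=; last by move=> [].
by move=> hth; split => // hB; have : set0 th by rewrite -disj.
Qed.

(** A full turn minus the cone, whose wrapped piece is moved by [trigF_2pi]. Nonnegativity gives
    additivity without integrability. *)
Lemma integral_trigf_arc_compl (a b d c m M : R) : 0 <= m < pi *+ 2 -> m <= M <= m + pi ->
  (forall t, 0 <= trigf a b d c t) ->
  (\int[lebesgue_measure]_(t in [set th | (0 <= th < 2 * pi)%R /\ ~ (0 < sin (th - m) /\ 0 < sin (M - th))%R])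
    (trigf a b d c t)%:E =
  (trigF a b d c (pi *+ 2) - trigF a b d c 0 - (trigF a b d c M - trigF a b d c m))%:E)%E.
Proof.
move=> hm hM h0; have pi0 := @pi_gt0 R; have pi2E : 2 * pi = pi *+ 2 :> R by rewrite mulr_natl.
set A := [set _ | _].
have [fullE /disj_set2P disj1] := arc_compl_cover hm hM.
have mA := measurable_arc_compl hm hM.
rewrite -/A in fullE disj1 mA.
have disj2 : [disjoint [set` `]m, (Num.min M (pi *+ 2))[] & [set` `[0, (M - pi *+ 2)[] : set R].
  by apply/disj_set2P; apply/seteqP; split => th //= []; rewrite !in_itv/= mulr2n; lra.
have mt (D : set R) : measurable_fun D (fun t : R => (trigf a b d c t)%:E).
  exact: measurable_trigf.
have tot := @integral_trigf R a b d c true true 0 (pi *+ 2) (mulrn_wge0 _ (ltW pi0)).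
have mB1 : measurable [set` `]m, (Num.min M (pi *+ 2))[] by [].
have mB2 : measurable [set` `[0, (M - pi *+ 2)[] by [].
have mB := measurableU _ _ mB1 mB2.
have t0 (D : set R) t : D t -> (0 <= (trigf a b d c t)%:E)%E by rewrite lee_fin.
have i1 := @ge0_integral_setU _ _ R (@lebesgue_measure R) _ _ mA mB _ (mt _) (t0 _) disj1.
have i2 := @ge0_integral_setU _ _ R (@lebesgue_measure R) _ _ mB1 mB2 _ (mt _) (t0 _) disj2.
rewrite fullE i1 i2 in tot.
rewrite integral_trigf in tot; last by rewrite le_min; move: hm hM; rewrite mulr2n; lra.
have e2 : (\int[lebesgue_measure]_(x in [set` `[0%R, (M - pi *+ 2)%R[]) (trigf a b d c x)%:E =
    (trigF a b d c M - trigF a b d c (Num.min M (pi *+ 2)))%:E)%E.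
  have [MN|MN] := leP M (pi *+ 2).
    rewrite set_itv_ge ?integral_set0 ?subrr// -leNgt bnd_simp subr_le0//.
  rewrite integral_trigf; last by rewrite subr_ge0 ltW.
  congr EFin; have := trigF_2pi a b d c (M - pi *+ 2); rewrite subrK; lra.
rewrite e2 in tot.
have h (I : \bar R) (p q r : R) : (I + (p%:E + q%:E) = r%:E -> I = (r - (p + q))%:E)%E.
  by case: I => [I| |] //= [] <-; congr EFin; ring.
by rewrite (h _ _ _ _ tot); congr EFin; ring.
Qed.

End ArcIntegral.

(** * The potential and the average of its exponential *)

Section PotentialDrift.
Variable R : realType.
Local Notation pt := (R * R)%type.
Implicit Types (x : nat -> pt) (n k : nat).

(** Small enough for the weakest radial gain, (1/800)/8, to cover the crude loss 83 eps and the
    required drift 2 eps. *)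
Definition eps : R := (1 / 1000) * (1 / 1000).

Definition potential x n (X : pt) : R := enorm X - eps * penalty x n X.

(* Here trigf a b d c bounds the increment of the potential from below, and the displayed
   function is the resulting upper bound 1 - l T + 8 l^2 for exp (- l T). *)
Lemma trigf_ge0 (a b d c l t : R) : `|a| + `|b| + `|d| <= 2 -> 0 < l <= 1 / 4 ->
  0 <= trigf (1 + 8 * l ^+ 2 - l * a) (- (l * b)) (- (l * d)) c t.
Proof.
move=> h hl; rewrite /trigf.
have h1 : a + b * cos (t - c) + d * sin (t - c) ^+ 2 <= 2.
  have e1 : b * cos (t - c) <= `|b|.
    apply: le_trans (ler_norm _) _; rewrite normrM ler_piMr// cos_max//.
  have e2 : d * sin (t - c) ^+ 2 <= `|d|.
    apply: le_trans (ler_norm _) _; rewrite normrM ler_piMr// normrX exprn_ile1// sin_max//.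
  have := ler_norm a; lra.
have -> : 1 + 8 * l ^+ 2 - l * a + - (l * b) * cos (t - c) + - (l * d) * sin (t - c) ^+ 2 =
   1 + 8 * l ^+ 2 - l * (a + b * cos (t - c) + d * sin (t - c) ^+ 2) by ring.
have : l * (a + b * cos (t - c) + d * sin (t - c) ^+ 2) <= l * 2 by rewrite ler_pM2l//; lra.
have : 0 <= l ^+ 2 by rewrite sqr_ge0.
lra.
Qed.

Lemma sin_cos_ge (t : R) : - (1/2) <= sin t * cos t.
Proof.
have := cos2Dsin2 t; have : 0 <= (sin t + cos t) ^+ 2 by rewrite sqr_ge0.
rewrite sqrrD; lra.
Qed.

(** With [psi0] the direction of the origin, the cosine relative to the outward direction has
    integral 0 over a full turn, hence over A minus its integral over the cone: the sum of the two
    sines. Besides this, only two facts are kept: the length L of A is at most 8, and the integral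
    of sin^2 is at least L / 4. *)
Lemma integral_drift (A : set R) (m M psi0 a b d : R) : 0 <= m < pi *+ 2 -> m <= M <= m + pi ->
  A = [set th | 0 <= th < 2 * pi /\ ~ (0 < sin (th - m) /\ 0 < sin (M - th))] \/
  (A = [set th | 0 <= th < 2 * pi] /\ sin (psi0 - m) + sin (M - psi0) = 0) ->
  `|a| + `|b| + `|d| <= 2 -> 0 <= d ->
  (forall L, 0 <= L <= 8 ->
    2 * eps * L <= a * L + b * (sin (psi0 - m) + sin (M - psi0)) + d * L / 4) ->
  forall l, 0 < l <= 1 / 4 ->
  (\int[lebesgue_measure]_(t in A)
     (trigf (1 + 8 * l ^+ 2 - l * a) (- (l * b)) (- (l * d)) (psi0 - pi) t)%:E
   <= (1 + 8 * l ^+ 2 - 2 * eps * l)%:E * lebesgue_measure A)%E.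
Proof.
move=> hm hM hA habd d0 hL l hl; set w := sin _ + sin _ in hA hL.
have pi0 := @pi_gt0 R.
have pi4 : pi < 4 :> R by have := @pihalf_lt2 R; lra.
have pi2 := @pi_ge2 R.
suff [L [s [hL8 hs hI]]] : exists L s : R, [/\ 0 <= L <= 8, L / 4 <= s &
  forall a b d, (forall t, 0 <= trigf a b d (psi0 - pi) t) ->
  (\int[lebesgue_measure]_(t in A) (trigf a b d (psi0 - pi) t)%:E =
    (a * L + b * w + d * s)%:E)%E].
  (* The case a = 1, b = d = 0 of the integral formula computes the length of A. *)
  have mA : lebesgue_measure A = L%:E :> \bar R.
    have := hI 1 0 0; rewrite (_ : trigf 1 0 0 (psi0 - pi) = fun=> 1).
      rewrite integral_cst ?mul1e//; last first.
        move: hA => [->|[-> _]].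
          exact: measurable_arc_compl.
        rewrite (_ : [set _ | _] = `[0, (pi *+ 2)[%classic)//.
        by apply/seteqP; split => t /=; rewrite in_itv/= mulr_natl.
      by move=> -> //; rewrite ?ler01//; congr EFin; ring.
    by rewrite funeqE => t; rewrite /trigf; ring.
  rewrite mA hI; last by move=> t; exact: trigf_ge0.
  rewrite -EFinM lee_fin.
  have := hL L hL8 => h.
  have h1 : d * (L / 4) <= d * s by rewrite ler_wpM2l.
  have : l * (2 * eps * L) <= l * (a * L + b * w + d * s) by rewrite ler_pM2l//; lra.
  lra.
case: hA => [->|[-> w0]].
  exists (pi *+ 2 - (M - m)),
    (pi - (M - m - sin (psi0 - m) * cos (psi0 - m) - sin (M - psi0) * cos (M - psi0)) / 2).
  split.
  - by rewrite mulr2n; lra.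
  - have h1 := sin_cos_ge (psi0 - m); have h2 := sin_cos_ge (M - psi0).
    move: h1 h2; set p := sin _ * cos _; set q := sin _ * cos _.
    by clearbody p q => h1 h2; rewrite (mulr2n pi); lra.
  - move=> a' b' d' h0; rewrite integral_trigf_arc_compl//; congr EFin.
    have sD : forall t : R, sin (t + pi) = - sin t by move=> t; rewrite sinDpi.
    have cD : forall t : R, cos (t + pi) = - cos t by move=> t; rewrite cosDpi.
    have e1 : M - (psi0 - pi) = (M - psi0) + pi by ring.
    have e2 : m - (psi0 - pi) = - (psi0 - m) + pi by ring.
    have e3 : 0 - (psi0 - pi) = - psi0 + pi by ring.
    have e4 : pi *+ 2 - (psi0 - pi) = - psi0 + pi + pi *+ 2 by ring.
    by rewrite /trigF e1 e2 e3 e4 !sinD2pi !cosD2pi !sD !cD !sinN !cosN /w mulr2n; field.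
exists (pi *+ 2 : R), (pi : R); split.
- by rewrite mulr2n; lra.
- by rewrite mulr2n; lra.
- move=> a' b' d' h0.
  rewrite (_ : [set th : R | 0 <= th < 2 * pi] =
      [set` Interval (BSide true 0) (BSide true (pi *+ 2))]); last first.
    by apply/seteqP; split => t /=; rewrite in_itv/= mulr_natl.
  rewrite integral_trigf; last by rewrite mulrn_wge0// ltW.
  congr EFin; rewrite w0 /trigF.
  have e4 : pi *+ 2 - (psi0 - pi) = - (psi0 - pi) + pi *+ 2 by ring.
  by rewrite e4 sinD2pi cosD2pi sub0r mulr2n; field.
Qed.

End PotentialDrift.

(** * Steps from a degenerate position *)

Section BadStep.
Variable R : realType.
Local Notation pt := (R * R)%type.
Implicit Types (x : nat -> pt) (n k : nat).

Lemma cos_gt_small_sin (t : R) : 0 <= cos t -> `|sin t| <= 1 / 400 -> 1 / 2 <= cos t.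
Proof.
move=> c0 s; have e := cos2Dsin2 t.
have : sin t ^+ 2 <= 1 / 400 by rewrite -(real_normK (num_real (sin t))); have : 0 <= `|sin t| by []; nra.
nra.
Qed.

Lemma sin_le_pihalf (s t : R) : 0 <= s <= t -> t <= pi / 2 -> 0 <= sin s <= sin t.
Proof.
move=> /andP[s0 st] tp; have pi0 := @pi_gt0 R.
rewrite sin_ge0_pi; last by lra.
have hs : s \in `[- (pi / 2), pi / 2] by rewrite in_itv/=; lra.
have ht : t \in `[- (pi / 2), pi / 2] by rewrite in_itv/=; lra.
move: st; rewrite le_eqVlt => /predU1P[->|st] /=; first exact: lexx.
by apply: ltW; rewrite ltr_sin.
Qed.

(** Read S, C as sine and cosine of [th - psi0], and sa, ca, sb, cb as those of [psi0 - m] and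
    [M - psi0]. The conclusions become sin (th - m) > 0 and sin (M - th) > 0: a step to the wide
    side by more than 1/400 would enter the cone. The wide side is next to m here and next to M in
    [gap_right]. *)
Lemma gap_left (S C sa ca sb cb : R) : 0 <= sa -> 0 <= sb -> sa + sb < 1 / 800 ->
  ca <= - (1/2) -> 1/2 <= cb -> -1 <= C -> C <= 1 -> 1 / 400 < - S ->
  0 < S * ca + C * sa /\ 0 < sb * C - cb * S.
Proof.
move=> sa0 sb0 hab hca hcb C1 C2 hS; have S0 : S < 0 by lra.
have /andP[k1 _] := ler_mul_unit sb C1 C2; have /andP[k2 _] := ler_mul_unit sa C1 C2.
rewrite !ger0_norm// in k1 k2.
have : S * - (1/2) <= S * ca by rewrite ler_nM2l.
have : S * cb <= S * (1/2) by rewrite ler_nM2l.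
by move: k1 k2 hab hS sa0 sb0; clear; split; lra.
Qed.

Lemma gap_right (S C sa ca sb cb : R) : 0 <= sa -> 0 <= sb -> sa + sb < 1 / 800 ->
  1/2 <= ca -> cb <= - (1/2) -> -1 <= C -> C <= 1 -> - S < - (1 / 400) ->
  0 < S * ca + C * sa /\ 0 < sb * C - cb * S.
Proof.
move=> sa0 sb0 hab hca hcb C1 C2 hS; have S0 : 0 < S by lra.
have /andP[k1 _] := ler_mul_unit sb C1 C2; have /andP[k2 _] := ler_mul_unit sa C1 C2.
rewrite !ger0_norm// in k1 k2.
have : S * (1/2) <= S * ca by rewrite ler_pM2l.
have : S * cb <= S * - (1/2) by rewrite ler_pM2l.
by move: k1 k2 hab hS sa0 sb0; clear; split; lra.
Qed.

Lemma cos_lt_small_sin (t : R) : cos t <= 0 -> `|sin t| <= 1 / 400 -> cos t <= - (1/2).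
Proof.
move=> c0 s; have := @cos_gt_small_sin (t + pi).
have -> : cos (t + pi) = - cos t by rewrite cosDpi.
have -> : sin (t + pi) = - sin t by rewrite sinDpi.
by rewrite normrN oppr_ge0 => /(_ c0 s); lra.
Qed.

Lemma cos_lt0_pihalf (t : R) : pi / 2 < t <= pi -> cos t < 0.
Proof.
move=> ht; have pi0 := @pi_gt0 R.
rewrite -oppr_gt0 -cosDpi -(subrK (pi *+ 2) (t + pi)) cosD2pi (mulr2n pi).
by apply: cos_gt0_pihalf; lra.
Qed.

Lemma small_angle (t a : R) : `|t| <= a -> a <= pi / 2 -> sin a <= 1 / 800 ->
  `|sin t| <= 1 / 400 /\ 0 <= cos t.
Proof.
move=> ta ap sa; have t0 : 0 <= `|t| by [].
split; last by rewrite -cos_norm; apply: cos_ge0_pihalf; lra.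
have [h|h] := leP 0 t.
  have h0 : 0 <= t <= a by move: ta; rewrite ger0_norm// h.
  by have /andP[h1 h2] := sin_le_pihalf h0 ap; rewrite ger0_norm//; lra.
have h0 : 0 <= - t <= a by move: ta; rewrite ltr0_norm// => ->; rewrite oppr_ge0 (ltW h).
by have /andP[] := sin_le_pihalf h0 ap; rewrite sinN => h1 h2; rewrite ler0_norm//; lra.
Qed.

Section state.
Variables (x : nat -> pt) (n : nat) (psi0 r : R).
Hypotheses (rE : r = enorm (x n)) (xnE : x n = pscale r (unitv (psi0 - pi))).

(** As [psi0] points from [x n] to the origin, [psi0 - pi] is the outward radial direction; the
    half-turn between them causes the minus signs. *)
Lemma frame_coords k (t : R) : psub (x k) (x n) = pscale (enorm (psub (x k) (x n))) (unitv t) ->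
  dotp (unitv (psi0 - pi)) (x k) = r - enorm (psub (x k) (x n)) * cos (t - psi0) /\
  crsp (unitv (psi0 - pi)) (x k) = - (enorm (psub (x k) (x n)) * sin (t - psi0)).
Proof.
set rho := enorm _ => h.
have xk : x k = padd (pscale r (unitv (psi0 - pi))) (pscale rho (unitv t)).
  by rewrite -xnE -h /padd /psub/=; case: (x k) => ? ? /=; congr pair; ring.
have e : t - (psi0 - pi) = (t - psi0) + pi by ring.
have cD u : cos (u + pi) = - cos u :> R by rewrite cosDpi.
have sD u : sin (u + pi) = - sin u :> R by rewrite sinDpi.
rewrite xk; split.
  transitivity (r * dotp (unitv (psi0 - pi)) (unitv (psi0 - pi)) + rho * dotp (unitv (psi0 - pi)) (unitv t)).
    by rewrite /dotp /padd /pscale/=; ring.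
  by rewrite dotp_unitv dotp_unitv2 e cD; ring.
transitivity (rho * crsp (unitv (psi0 - pi)) (unitv t)).
  by rewrite /crsp /padd /pscale/=; ring.
by rewrite crsp_unitv2 e sD; ring.
Qed.

End state.

(** A small sum of sines puts each of [psi0 - m] and [M - psi0] near 0 or pi; their sum is at most
    pi, which leaves three cases. Both near 0: all past points are behind, and the previous position
    yields the penalty 40. One near pi: the extreme point on that wide side is beyond the walker and
    yields the penalty; points on the other side are behind, and those on the wide side are beside,
    because an allowed step goes towards them by at most 1/400. *)
Lemma bad_step x n (m M : R) (psi : nat -> R) i j :
  x 0%N = 0 -> x n != 0 ->
  enorm (padd (x n.-1) (pscale (-1) (x n))) = 1 ->
  200 <= enorm (x n) -> m <= M <= m + pi ->
  (forall k, (k <= n)%N -> m <= psi k <= M /\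
      psub (x k) (x n) = pscale (enorm (psub (x k) (x n))) (unitv (psi k))) ->
  [/\ (i <= n)%N, psub (x i) (x n) != 0 & psi i = m] ->
  [/\ (j <= n)%N, psub (x j) (x n) != 0 & psi j = M] ->
  allowed_angles x n = [set th | 0 <= th < 2 * pi /\ ~ (0 < sin (th - m) /\ 0 < sin (M - th))]
    \/ (allowed_angles x n = [set th | 0 <= th < 2 * pi] /\
        forall k, (k <= n)%N -> psub (x k) (x n) != 0 -> sin (psi k - m) = 0) ->
  sin (psi 0%N - m) + sin (M - psi 0%N) < 1 / 800 ->
  forall th, allowed_angles x n th ->
  penalty x n.+1 (padd (x n) (unitv th)) <=
    penalty x n (x n) + 8 - 40 * `|sin (th - (psi 0%N - pi))|.
Proof.
move=> x0 xn0 lastu r200 hM hpsi [iN zi ei] [jN zj ej] hA hw th hth.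
have pi0 := @pi_gt0 R.
set psi0 := psi 0%N in hw *; set r := enorm (x n) in r200.
have z0 : psub (x 0%N) (x n) = pscale (-1) (x n).
  by rewrite x0 /psub /pscale /=; congr pair; ring.
have r0E : enorm (psub (x 0%N) (x n)) = r.
  by rewrite z0 /r /enorm /pscale/= !mulN1r !sqrrN.
have r0 : 0 < r by lra.
have [hpsi0 hz0] := hpsi 0%N (leq0n n).
rewrite r0E -/psi0 in hz0.
have xnE : x n = pscale r (unitv (psi0 - pi)).
  have cB : cos (psi0 - pi) = - cos psi0.
    by rewrite -[in RHS](subrK pi psi0) cosDpi opprK.
  have sB : sin (psi0 - pi) = - sin psi0.
    by rewrite -[in RHS](subrK pi psi0) sinDpi opprK.
  have : x n = pscale (-1) (psub (x 0%N) (x n)).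
    by rewrite z0 /pscale/=; case: (x n) => ? ? /=; congr pair; ring.
  by rewrite hz0 => ->; rewrite /pscale /unitv/= cB sB; congr pair; ring.
have n0 : (0 < n)%N by rewrite lt0n; apply: contra xn0 => /eqP ->; rewrite x0.
have coords k kn := @frame_coords x n psi0 r xnE k (psi k) (hpsi k kn).2.
pose al := psi0 - m; pose be := M - psi0.
have al0 : 0 <= al by rewrite /al; move: hpsi0; rewrite -/psi0; lra.
have be0 : 0 <= be by rewrite /be; move: hpsi0; rewrite -/psi0; lra.
have abpi : al + be <= pi by rewrite /al /be; lra.
have sal0 : 0 <= sin al by apply: sin_ge0_pi; lra.
have sbe0 : 0 <= sin be by apply: sin_ge0_pi; lra.
rewrite -/al -/be in hw.
have phi k : (k <= n)%N -> - al <= psi k - psi0 <= be.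
  by move=> /hpsi[h _]; rewrite /al /be; lra.
have sal8 : sin al <= 1 / 800 by move: hw sbe0; clear; lra.
have sbe8 : sin be <= 1 / 800 by move: hw sal0; clear; lra.
have smallR k : (k <= n)%N -> 0 <= psi k - psi0 -> be <= pi / 2 ->
    `|sin (psi k - psi0)| <= 1 / 400 /\ 0 <= cos (psi k - psi0).
  move=> kn h b; apply: (@small_angle _ be) => //; rewrite ger0_norm//.
  by have /andP[] := phi k kn.
have smallL k : (k <= n)%N -> psi k - psi0 <= 0 -> al <= pi / 2 ->
    `|sin (psi k - psi0)| <= 1 / 400 /\ 0 <= cos (psi k - psi0).
  move=> kn h b; apply: (@small_angle _ al) => //; rewrite ler0_norm// lerNl.
  by have /andP[] := phi k kn.
have u1 := enorm_unitv (psi0 - pi).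
have s1 := enorm_unitv th.
have Vstep := @penalty_step_bad R r (unitv (psi0 - pi)) r200 u1 x n (unitv th) xnE s1.
rewrite crsp_unitv2 in Vstep.
(* points seen from x n almost in the direction of the origin *)
have behind k : (k <= n)%N -> `|sin (psi k - psi0)| <= 1 / 400 -> 0 <= cos (psi k - psi0) ->
    160 * `|crsp (unitv (psi0 - pi)) (x k)| <= r - dotp (unitv (psi0 - pi)) (x k).
  move=> kn hs hc; have [-> ->] := coords k kn.
  have hc2 := cos_gt_small_sin hc hs.
  rewrite normrN normrM ger0_norm ?enorm_ge0//.
  set rho := enorm _; have rho0 : 0 <= rho by exact: enorm_ge0.
  have : rho * `|sin (psi k - psi0)| <= rho * (1/400) by rewrite ler_wpM2l.
  have : rho * (1 / 2) <= rho * cos (psi k - psi0) by rewrite ler_wpM2l.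
  lra.
have ltn_of k : (k <= n)%N -> psub (x k) (x n) != 0 -> (k < n)%N.
  rewrite leq_eqVlt => /predU1P[->|//].
  by rewrite /psub !subrr eqxx.
have beyond k : (k <= n)%N -> psub (x k) (x n) != 0 -> `|sin (psi k - psi0)| <= 1 / 400 ->
    cos (psi k - psi0) <= 0 -> 40 <= penalty x n (x n).
  move=> kn zk hs hc.
  have hc2 := cos_lt_small_sin hc hs.
  have [d1 d2] := coords k kn.
  set rho := enorm _ in d1 d2; have rho0 : 0 < rho by exact: enorm_gt0.
  have h1 : rho * `|sin (psi k - psi0)| <= rho * (1/400) by rewrite ler_pM2l.
  have h2 : rho * cos (psi k - psi0) <= rho * - (1 / 2) by rewrite ler_pM2l.
  have d3 : r < dotp (unitv (psi0 - pi)) (x k) by rewrite d1; move: h2 rho0; clear; lra.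
  apply: (@penalty_ge_beyond R x n k r (unitv (psi0 - pi))) => //.
  - exact: ltn_of.
  - by apply/eqP => xk0; move: d3 r0; rewrite xk0 /dotp /= !mulr0; clear; lra.
  - by rewrite d2 d1 normrN normrM gtr0_norm//; move: h1 h2 rho0; clear; lra.
(* In the collinear case every direction is allowed, but all past points lie on the radial line, so
   the side conditions hold with [crsp] equal to 0. *)
have coll : allowed_angles x n = [set th | 0 <= th < 2 * pi] /\
    (forall k, (k <= n)%N -> psub (x k) (x n) != 0 -> sin (psi k - m) = 0) ->
    forall k, (k <= n)%N -> crsp (unitv (psi0 - pi)) (x k) = 0.
  move=> [_ hc] k kn; have [_ ->] := coords k kn.
  have [z|z] := eqVneq (psub (x k) (x n)) 0; first by rewrite z enorm0 mul0r oppr0.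
  have : sin (psi0 - m) = 0.
    by apply: hc => //; apply/eqP => e; move: r0E r0; rewrite e enorm0 => <-; rewrite ltxx.
  have := hc k kn z => s2 s3.
  rewrite (_ : psi k - psi0 = (psi k - m) - (psi0 - m)); last by ring.
  by rewrite sinB s2 s3; ring.
have thE : sin (th - (psi0 - pi)) = - sin (th - psi0).
  by rewrite (_ : th - (psi0 - pi) = (th - psi0) + pi) ?sinDpi//; ring.
have [alh|alh] := leP al (pi / 2); last first.
  (* the past fills almost a half-plane on the left *)
  have beh : be <= pi / 2 by move: alh abpi; clear; lra.
  have cal : cos al < 0 by apply: cos_lt0_pihalf; move: alh abpi be0; clear; lra.
  have V40 : 40 <= penalty x n (x n).
    apply: (@beyond i) => //; rewrite ei -opprB -/al ?sinN ?cosN ?normrN; last exact: ltW.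
    by rewrite ger0_norm//; move: hw sbe0; clear; lra.
  have left : sin (th - (psi0 - pi)) <= 1 / 400 \/
     forall k, (k <= n)%N -> crsp (unitv (psi0 - pi)) (x k) = 0.
    case: hA => [hA|hA]; last by right; exact: coll.
    left; rewrite thE.
    move: hth; rewrite hA /= => -[_ hn]; rewrite leNgt; apply/negP => hs; apply: hn.
    have e1 : th - m = (th - psi0) + al by rewrite /al; ring.
    have e2 : M - th = be - (th - psi0) by rewrite /be; ring.
    rewrite e1 e2 (sinD (th - psi0) al) (sinB be (th - psi0)).
    apply: gap_left; rewrite ?cos_geN1 ?cos_le1//.
    - by apply: cos_lt_small_sin; [exact: ltW|rewrite ger0_norm//; move: hw sbe0; clear; lra].
    - apply: cos_gt_small_sin; first by apply: cos_ge0_pihalf; move: beh be0 pi0; clear; lra.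
      by rewrite ger0_norm//; move: hw sal0; clear; lra.
  apply: Vstep => // k kn xk0; have kn' := ltnW kn.
  have [hk|hk] := leP (psi k - psi0) 0; last first.
    left; have [h1 h2] := smallR k kn' (ltW hk) beh.
    exact: behind.
  right; case: left => [hl|hl]; last first.
    rewrite (hl k kn'); have [h|h] := leP (sin (th - (psi0 - pi))) (1/400).
      by right; split; [exact: lexx|].
    by left; split; [exact: lexx|move: h; clear; lra].
  right; split => //; have [_ ->] := coords k kn'.
  rewrite -mulrN -sinN mulr_ge0 ?enorm_ge0//; apply: sin_ge0_pi.
  have /andP[h1 h2] := phi k kn'; rewrite oppr_ge0 hk /=.
  by move: h1 abpi be0; clear; lra.
have [beh|beh] := leP be (pi / 2).
  have allb k : (k <= n)%N -> `|sin (psi k - psi0)| <= 1 / 400 /\ 0 <= cos (psi k - psi0).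
    move=> kn; have [h|h] := leP 0 (psi k - psi0); first exact: smallR.
    by apply: smallL => //; exact: ltW.
  have n1 : (n.-1 <= n)%N by exact: leq_pred.
  have V40 : 40 <= penalty x n (x n).
    apply: (@penalty_ge_behind R x n r (unitv (psi0 - pi))) => //.
    by have [h1 h2] := allb _ n1; exact: behind.
  apply: Vstep => // k kn xk0; left.
  by have [h1 h2] := allb _ (ltnW kn); exact: behind (ltnW kn) h1 h2.
(* the past fills almost a half-plane on the right *)
have cbe : cos be < 0 by apply: cos_lt0_pihalf; move: beh abpi al0; clear; lra.
have V40 : 40 <= penalty x n (x n).
  apply: (@beyond j) => //; rewrite ej -/be; last exact: ltW.
  by rewrite ger0_norm//; move: hw sal0; clear; lra.
have right : - (1 / 400) <= sin (th - (psi0 - pi)) \/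
   forall k, (k <= n)%N -> crsp (unitv (psi0 - pi)) (x k) = 0.
  case: hA => [hA|hA]; last by right; exact: coll.
  left; rewrite thE.
  move: hth; rewrite hA /= => -[_ hn]; rewrite leNgt; apply/negP => hs; apply: hn.
  have e1 : th - m = (th - psi0) + al by rewrite /al; ring.
  have e2 : M - th = be - (th - psi0) by rewrite /be; ring.
  rewrite e1 e2 (sinD (th - psi0) al) (sinB be (th - psi0)).
  apply: gap_right; rewrite ?cos_geN1 ?cos_le1//.
  - apply: cos_gt_small_sin; first by apply: cos_ge0_pihalf; move: alh al0 pi0; clear; lra.
    by rewrite ger0_norm//; move: hw sbe0; clear; lra.
  - by apply: cos_lt_small_sin; [exact: ltW|rewrite ger0_norm//; move: hw sal0; clear; lra].
apply: Vstep => // k kn xk0; have kn' := ltnW kn.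
have [hk|hk] := ltP (psi k - psi0) 0.
  left; have [h1 h2] := smallL k kn' (ltW hk) alh.
  exact: behind.
right; case: right => [hl|hl]; last first.
  rewrite (hl k kn'); have [h|h] := leP (sin (th - (psi0 - pi))) (1/400).
    by right; split; [exact: lexx|].
  by left; split; [exact: lexx|move: h; clear; lra].
left; split => //; have [_ ->] := coords k kn'.
rewrite oppr_le0 mulr_ge0 ?enorm_ge0//; apply: sin_ge0_pi.
have /andP[h1 h2] := phi k kn'; rewrite hk /=.
by move: h2 abpi al0; clear; lra.
Qed.

End BadStep.

(** * Drift of the potential in every position *)

Section StepDrift.
Variable R : realType.
Local Notation pt := (R * R)%type.
Local Notation eps := (eps R).
Implicit Types (x : nat -> pt) (n k : nat).

Lemma eps_gt0 : 0 < eps. Proof. by rewrite /eps; lra. Qed.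
Lemma eps_small : eps <= 1 / 1000 * (1 / 1000). Proof. by rewrite /eps. Qed.

Lemma integral_drift_const (A : set R) (a c : R) : measurable A -> 2 * eps <= a ->
  forall l, 0 < l <= 1 / 4 ->
  (\int[lebesgue_measure]_(t in A)
     (trigf (1 + 8 * l ^+ 2 - l * a) (- (l * 0)) (- (l * 0)) c t)%:E
   <= (1 + 8 * l ^+ 2 - 2 * eps * l)%:E * lebesgue_measure A)%E.
Proof.
move=> mA ha l /andP[l0 l1].
rewrite (_ : trigf _ _ _ _ = fun=> (1 + 8 * l ^+ 2 - l * a)); last first.
  by rewrite funeqE => t; rewrite /trigf; ring.
rewrite integral_cst//; apply: lee_wpmul2r => //; rewrite lee_fin.
have : l * (2 * eps) <= l * a by rewrite ler_pM2l.
lra.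
Qed.

(** The blocked directions form a union of open sets, one for each position t on the segment. *)
Lemma allowed_angles_measurable x n : measurable (allowed_angles x n).
Proof.
pose U t := (fun th : R => padd (x n) (pscale t (unitv th))) @^-1`
  (interior (hull_pts x n : set (R * R)%type)).
have -> : allowed_angles x n = `[0, (pi *+ 2)[%classic `\` \bigcup_(t in [set t : R | 0 <= t <= 1]) U t.
  rewrite /allowed_angles -(mulr_natl pi 2).
  apply/seteqP; split => th /=; rewrite in_itv/= => -[h1 h2]; split => //.
    by move=> [t /= ht hU]; exact: (h2 t ht hU).
  by move=> t ht hU; apply: h2; exists t.
apply: measurableD => //.
apply: open_measurable; apply: bigcup_open => t _.
apply: open_comp; last exact: open_interior.
move=> th _.
have h1 : (fun th : R => (x n).1 + t * cos th) @ th --> (x n).1 + t * cos th.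
  by apply: cvgD; [exact: cvg_cst|apply: cvgM; [exact: cvg_cst|exact: continuous_cos]].
have h2 : (fun th : R => (x n).2 + t * sin th) @ th --> (x n).2 + t * sin th.
  by apply: cvgD; [exact: cvg_cst|apply: cvgM; [exact: cvg_cst|exact: continuous_sin]].
exact: (cvg_pair h1 h2).
Qed.

(** Four positions: at the origin, within distance 200, with a sum of sines bounded below, and
    degenerate. The integral is not normalized, so that a null allowed set needs no separate
    treatment here. *)
Lemma step_drift x n : x 0%N = 0 ->
  ((0 < n)%N -> enorm (padd (x n.-1) (pscale (-1) (x n))) = 1) ->
  allowed_angles x n !=set0 ->
  exists a b d c : R, [/\ `|a| + `|b| + `|d| <= 2,
    forall th, allowed_angles x n th ->
      trigf a b d c th <= potential x n.+1 (padd (x n) (unitv th)) - potential x n (x n) &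
    forall l, 0 < l <= 1 / 4 ->
    (\int[lebesgue_measure]_(t in allowed_angles x n)
       (trigf (1 + 8 * l ^+ 2 - l * a) (- (l * b)) (- (l * d)) c t)%:E
     <= (1 + 8 * l ^+ 2 - 2 * eps * l)%:E * lebesgue_measure (allowed_angles x n))%E].
Proof.
move=> x0 lastu A0; have e0 := eps_gt0; have e1 := eps_small.
have crude th : - (83 * eps) + (enorm (padd (x n) (unitv th)) - enorm (x n)) <=
    potential x n.+1 (padd (x n) (unitv th)) - potential x n (x n).
  have := @penalty_step_le R x n (unitv th) (enorm_unitv th).
  rewrite -(ler_pM2l e0) /potential mulrDr; clear; lra.
have [xn0|xn0] := eqVneq (x n) 0.
  exists (1 - 83 * eps), 0, 0, 0; split.
  - by rewrite normr0 ger0_norm; move: e0 e1; clear; lra.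
  - move=> th _; apply: le_trans (crude th).
    have -> : enorm (padd (x n) (unitv th)) = 1.
      rewrite xn0 -(enorm_unitv th); congr enorm.
      by rewrite /padd /unitv /=; congr pair; rewrite add0r.
    by rewrite xn0 enorm0 /trigf; move: e0; clear; lra.
  - by apply: integral_drift_const; [exact: allowed_angles_measurable|move: e0 e1; clear; lra].
have [m [M [psi [i [j [[hm hM hpsi] hi hj hA]]]]]] := allowed_structure x0 xn0 A0.
have pi0 := @pi_gt0 R.
set psi0 := psi 0%N; set r := enorm (x n).
have r0 : 0 < r by exact: enorm_gt0.
have z0 : psub (x 0%N) (x n) = pscale (-1) (x n).
  by rewrite x0 /psub /pscale /=; congr pair; ring.
have z0n : psub (x 0%N) (x n) != 0.
  apply/eqP => h; move: r0; rewrite /r (_ : enorm (x n) = enorm (psub (x 0%N) (x n))).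
    by rewrite h enorm0 ltxx.
  by rewrite z0 /enorm /pscale/= !mulN1r !sqrrN.
have xnE : x n = pscale r (unitv (psi0 - pi)).
  have [_ hz0] := hpsi 0%N (leq0n n).
  have r0E : enorm (psub (x 0%N) (x n)) = r.
    by rewrite z0 /r /enorm /pscale/= !mulN1r !sqrrN.
  have cB : cos (psi0 - pi) = - cos psi0.
    by rewrite -[in RHS](subrK pi psi0) cosDpi opprK.
  have sB : sin (psi0 - pi) = - sin psi0.
    by rewrite -[in RHS](subrK pi psi0) sinDpi opprK.
  have : x n = pscale (-1) (psub (x 0%N) (x n)).
    by rewrite z0 /pscale/=; case: (x n) => ? ? /=; congr pair; ring.
  by rewrite hz0 r0E => ->; rewrite /pscale /unitv/= cB sB; congr pair; ring.
have [/andP[p1 p2] _] := hpsi 0%N (leq0n n).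
have sal0 : 0 <= sin (psi0 - m).
  by apply: sin_ge0_pi; rewrite /psi0; move: hM p1 p2; clear; lra.
have sbe0 : 0 <= sin (M - psi0).
  by apply: sin_ge0_pi; rewrite /psi0; move: hM p1 p2; clear; lra.
have hA' : allowed_angles x n =
    [set th | 0 <= th < 2 * pi /\ ~ (0 < sin (th - m) /\ 0 < sin (M - th))] \/
    (allowed_angles x n = [set th | 0 <= th < 2 * pi] /\ sin (psi0 - m) + sin (M - psi0) = 0).
  case: hA => [hA|[hA hc]]; [by left|right; split => //].
  have s1 : sin (psi0 - m) = 0 by exact: hc.
  have s2 : sin (M - m) = 0 by case: hj => jN zj <-; exact: hc.
  have -> : M - psi0 = (M - m) - (psi0 - m) by ring.
  by rewrite (sinB (M - m)) s1 s2; ring.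
have dr th : r + cos (th - (psi0 - pi)) + sin (th - (psi0 - pi)) ^+ 2 / (2 * (r + 1)) <=
    enorm (padd (x n) (unitv th)).
  rewrite xnE -dotp_unitv2 -crsp_unitv2; apply: enorm_step_ge => //; exact: enorm_unitv.
have dr' th : cos (th - (psi0 - pi)) <= enorm (padd (x n) (unitv th)) - r.
  have := dr th; have : 0 <= sin (th - (psi0 - pi)) ^+ 2 / (2 * (r + 1)).
    by rewrite divr_ge0 ?sqr_ge0//; move: r0; clear; lra.
  clear; lra.
have [r200|r200] := leP r 200.
  (* 402 = 2 (200 + 1) comes from the curvature term; the mean of sin^2 leaves at least 1/1608, more
     than 85 eps. *)
  exists (- (83 * eps)), 1, (1 / 402), (psi0 - pi); split.
  - by rewrite normr1 normrN !ger0_norm; move: e0 e1; clear; lra.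
  - move=> th _; apply: le_trans (crude th); rewrite -/r.
    have := dr th; rewrite /trigf.
    have : 1 / 402 * sin (th - (psi0 - pi)) ^+ 2 <= sin (th - (psi0 - pi)) ^+ 2 / (2 * (r + 1)).
      rewrite mulrC ler_wpM2l ?sqr_ge0// div1r lef_pV2 ?posrE; move: r0 r200; clear; lra.
    clear; lra.
  - apply: (integral_drift hm hM hA').
    + by rewrite normr1 normrN !ger0_norm; move: e0 e1; clear; lra.
    + by clear; lra.
    + move=> L /andP[L0 L8].
      have : eps * L <= (1 / 1000 * (1 / 1000)) * L by rewrite ler_wpM2r.
      by move: sal0 sbe0 L0; clear; lra.
have [hw|hw] := leP (1 / 800) (sin (psi0 - m) + sin (M - psi0)).
  (* The mean of the cosine is at least (1/800)/8, more than 85 eps. *)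
  exists (- (83 * eps)), 1, 0, (psi0 - pi); split.
  - by rewrite normr1 normr0 normrN !ger0_norm; move: e0 e1; clear; lra.
  - move=> th _; apply: le_trans (crude th); rewrite -/r.
    by have := dr' th; rewrite /trigf; clear; lra.
  - apply: (integral_drift hm hM hA') => //.
    + by rewrite normr1 normr0 normrN !ger0_norm; move: e0 e1; clear; lra.
    + move=> L /andP[L0 L8].
      have : eps * L <= (1 / 1000 * (1 / 1000)) * L by rewrite ler_wpM2r.
      by move: hw L0 L8; clear; lra.
have n0 : (0 < n)%N by rewrite lt0n; apply: contra xn0 => /eqP ->; rewrite x0.
(* Here the mean of sin^2 yields -8 eps + 40 eps / 4 = 2 eps, exactly the drift required. *)
exists (- (8 * eps)), 1, (40 * eps), (psi0 - pi); split.
- by rewrite normr1 normrN !ger0_norm; move: e0 e1; clear; lra.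
- move=> th hth.
  have := bad_step x0 xn0 (lastu n0) (ltW r200) hM hpsi hi hj hA hw hth.
  have := dr' th; rewrite /trigf /potential -/r -/psi0.
  (* Passing from |sin| to sin^2 keeps the bound in the family [trigf]. *)
  set s := sin _; have : s ^+ 2 <= `|s|.
    by rewrite -(real_normK (num_real s)) expr2 ler_piMr// /s sin_max.
  set V1 := penalty _ _ _; set V2 := penalty _ _ _ => h1 h2 h3.
  have : eps * (V1 + 40 * s ^+ 2) <= eps * (V2 + 8).
    by rewrite ler_pM2l//; move: h1 h3; clear; lra.
  by move: h2; clear; lra.
- apply: (integral_drift hm hM hA') => //.
  + by rewrite normr1 normrN !ger0_norm; move: e0 e1; clear; lra.
  + by move: e0; clear; lra.
  + by move=> L _; move: sal0 sbe0; clear; lra.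
Qed.

End StepDrift.

(** * Drift with the angle discretized into arcs *)

Section Discrete.
Variable R : realType.
Local Notation pt := (R * R)%type.
Local Notation eps := (eps R).
Implicit Types (x : nat -> pt) (n k : nat).

Lemma expRN_le (y c : R) : `|y| <= 1 / 2 -> 2 * y ^+ 2 <= c -> expR (- y) <= 1 - y + c.
Proof.
move=> /ler_normlP[y1 y2] hc.
have h : 0 < 1 + y by lra.
rewrite expRN; apply: (@le_trans _ _ (1 + y)^-1).
  by rewrite lef_pV2 ?posrE ?expR_gt0// expR_ge1Dx.
rewrite -[leLHS]mul1r ler_pdivrMr//.
have -> : (1 - y + c) * (1 + y) = 1 - y ^+ 2 + c * (1 + y) by ring.
have h1 : 0 <= y ^+ 2 * (1 + 2 * y) by rewrite mulr_ge0 ?sqr_ge0//; lra.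
have h2 : 2 * y ^+ 2 * (1 + y) <= c * (1 + y) by rewrite ler_pM2r.
by move: h1 h2; clear; lra.
Qed.

Lemma unitv_lipschitz (a b : R) : enorm (psub (unitv a) (unitv b)) <= 2 * `|a - b|.
Proof.
wlog ba : a b / b <= a.
  move=> h; have [/h//|/ltW/h] := leP b a.
  rewrite distrC (_ : enorm (psub (unitv b) (unitv a)) = enorm (psub (unitv a) (unitv b)))//.
  by rewrite /enorm /psub /= -sqrrN opprB -[in X in _ + X]sqrrN opprB.
have [c _ hc] := MVT_segment ba (fun (t : R) _ => is_derive_cos t) (continuous_subspaceT (@continuous_cos R)).
have [s _ hs] := MVT_segment ba (fun (t : R) _ => is_derive_sin t) (continuous_subspaceT (@continuous_sin R)).
have ab0 : 0 <= a - b by rewrite subr_ge0.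
rewrite (ger0_norm ab0) -ler_sqr ?nnegrE ?enorm_ge0 ?mulr_ge0//.
rewrite sqr_enorm /dotp /psub /unitv /= hc hs.
have hc1 : (- sin c) * (- sin c) <= 1 by rewrite mulrNN -expr2 -real_normK ?num_real// exprn_ile1// sin_max.
have hs1 : cos s * cos s <= 1 by rewrite -expr2 -real_normK ?num_real// exprn_ile1// cos_max.
have e0 : 0 <= (a - b) ^+ 2 by rewrite sqr_ge0.
rewrite (_ : _ + _ = (- sin c * - sin c + cos s * cos s) * (a - b) ^+ 2); last by ring.
rewrite exprMn ler_wpM2r//; lra.
Qed.

(** The constant 2 rounds up 1 + 41 eps. *)
Lemma potential_lipschitz x n X s s' :
  potential x n (padd X s) <= potential x n (padd X s') + 2 * enorm (psub s s').
Proof.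
have -> : padd X s = padd (padd X s') (psub s s').
  by rewrite /padd /psub /=; congr pair; ring.
have e0 := eps_gt0 R; have e1 := eps_small R.
have h1 := enorm_padd (padd X s') (psub s s').
have h2 := @penalty_lipschitz R x n (padd (padd X s') (psub s s')) (pscale (-1) (psub s s')).
have E : padd (padd (padd X s') (psub s s')) (pscale (-1) (psub s s')) = padd X s'.
  by rewrite /padd /pscale /psub /=; congr pair; ring.
have e : enorm (pscale (-1) (psub s s')) = enorm (psub s s').
  by rewrite /enorm /pscale/= !mulN1r !sqrrN.
rewrite E e -(ler_pM2l e0) in h2.
have N0 := enorm_ge0 (psub s s').
have : eps * enorm (psub s s') <= 1 / 1000 * (1 / 1000) * enorm (psub s s') by rewrite ler_wpM2r.
rewrite /potential; move: h1 h2 N0; clear; lra.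
Qed.

(** Length pi / N rather than 2 pi / N makes pi a division point, so that cos is monotone on each
    arc. *)
Definition arc (N i : nat) : set R := [set` `[(pi / N%:R * i%:R), (pi / N%:R * i.+1%:R)[].

(** Freezing the weight at the left end of each arc costs the first exponential factor: the
    potential is 2-Lipschitz in the step and [unitv] 2-Lipschitz in the angle. *)
Lemma drift_discretized x n (l : R) (N : nat) : x 0%N = 0 ->
  ((0 < n)%N -> enorm (padd (x n.-1) (pscale (-1) (x n))) = 1) ->
  0 < l <= 1 / 4 -> (0 < N)%N ->
  \sum_(i < 2 * N) expR (- (l * potential x n.+1 (padd (x n) (unitv (pi / N%:R * i%:R))))) *
    (fine (lebesgue_measure (arc N i `&` allowed_angles x n)) /
     fine (lebesgue_measure (allowed_angles x n))) <=
  expR (4 * l * (pi / N%:R)) * (1 + 8 * l ^+ 2 - 2 * eps * l) * expR (- (l * potential x n (x n))).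
Proof.
move=> x0 lastu hl N0; set A := allowed_angles x n.
have mA : measurable A by exact: allowed_angles_measurable.
have pi0 := @pi_gt0 R.
have NR : 0 < N%:R :> R by rewrite ltr0n.
set dl := pi / N%:R.
have dl0 : 0 < dl by rewrite divr_gt0.
have e0 := eps_gt0 R; have e1 := eps_small R.
have rho0 : 0 <= 1 + 8 * l ^+ 2 - 2 * eps * l.
  have : 0 <= l ^+ 2 by rewrite sqr_ge0.
  have : eps * l <= 1 / 2 * 1 by apply: ler_pM; move: e0 e1 hl; clear; lra.
  clear. lra.
have AE : A `<=` `[0, (pi *+ 2)[.
  by move=> th [/= h _]; rewrite in_itv/= -(mulr_natl pi 2).
have Afin (B : set R) : measurable B -> lebesgue_measure (B `&` A) \is a fin_num.
  move=> mB; rewrite ge0_fin_numE//.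
  apply: (@le_lt_trans _ _ (lebesgue_measure (`[0, (pi *+ 2)[ : set R))).
    by apply: le_measure; rewrite ?inE//; [exact: measurableI|move=> t [_ /AE]].
  by rewrite lebesgue_measure_itv/=; case: ifP => // _; rewrite -EFinB ltry.
have [A0|A0] := pselect (A !=set0); last first.
  have -> : A = set0 by apply/seteqP; split => // t At; apply: A0; exists t.
  rewrite big1 ?mulr_ge0 ?expR_ge0// => i _.
  by rewrite setI0 measure0/= mul0r mulr0.
have [a [b [d [c [habd hdr hint]]]]] := step_drift x0 lastu A0.
have {}hint := hint l hl.
rewrite -/A in hdr hint.
set F := expR (- (l * potential x n (x n))).
set C := expR (4 * l * dl) * F.
have C0 : 0 < C by rewrite mulr_gt0// expR_gt0.
pose w t := trigf (1 + 8 * l ^+ 2 - l * a) (- (l * b)) (- (l * d)) c t.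
have w0 t : 0 <= w t by exact: trigf_ge0.
pose h i := expR (- (l * potential x n.+1 (padd (x n) (unitv (dl * i%:R))))).
have l0 : 0 < l by case/andP: hl.
have hw i t : arc N i t -> A t -> h i <= C * w t.
  rewrite /arc /= in_itv /= -/dl => /andP[t1 t2] At.
  have dist : `|t - dl * i%:R| <= dl.
    rewrite ger0_norm ?subr_ge0// lerBlDl; apply: ltW; apply: lt_le_trans t2 _.
    by rewrite -natr1 mulrDr mulr1.
  have h1 : potential x n.+1 (padd (x n) (unitv t)) <=
     potential x n.+1 (padd (x n) (unitv (dl * i%:R))) + 4 * dl.
    apply: le_trans (potential_lipschitz _ _ _ _ (unitv (dl * i%:R))) _.
    rewrite lerD2l; have := unitv_lipschitz t (dl * i%:R); move: dist; clear; lra.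
  have h2 := hdr t At.
  set T := trigf a b d c t in h2.
  have T2 : `|T| <= 2.
    rewrite /T /trigf; apply: le_trans (ler_normD _ _) _.
    have : `|a + b * cos (t - c)| <= `|a| + `|b|.
      apply: le_trans (ler_normD _ _) _; rewrite lerD2l normrM ler_piMr// cos_max//.
    have : `|d * sin (t - c) ^+ 2| <= `|d|.
      by rewrite normrM ler_piMr// normrX exprn_ile1// sin_max.
    move: habd; clear; lra.
  have h3 : expR (- (l * T)) <= w t.
    have -> : w t = 1 - l * T + 8 * l ^+ 2 by rewrite /w /T /trigf; ring.
    (* With y = l T, the bounds |T| <= 2 and l <= 1/4 give |y| <= 1/2 and 2 y^2 <= 8 l^2. *)
    apply: expRN_le.
      rewrite normrM (gtr0_norm l0).
      have : l * `|T| <= 1 / 4 * 2 by apply: ler_pM => //; [exact: ltW|case/andP: hl].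
      clear; lra.
    rewrite exprMn -[T ^+ 2]real_normK ?num_real//.
    have T4 : `|T| ^+ 2 <= 4 by have : 0 <= `|T| by []; move: T2; clear; nra.
    have : l ^+ 2 * `|T| ^+ 2 <= l ^+ 2 * 4 by rewrite ler_wpM2l ?sqr_ge0.
    clear; lra.
  apply: (@le_trans _ _ (C * expR (- (l * T)))); last by rewrite ler_pM2l.
  rewrite /h /C /F -!expRD ler_expR.
  have h4 : T + potential x n (x n) <= potential x n.+1 (padd (x n) (unitv (dl * i%:R))) + 4 * dl.
    by move: h1 h2; clear; lra.
  have : l * (T + potential x n (x n)) <= l * (potential x n.+1 (padd (x n) (unitv (dl * i%:R))) + 4 * dl).
    by rewrite ler_pM2l.
  clear; lra.
have mCw (D : set R) : measurable_fun D (fun t => (C * w t)%:E).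
  apply/measurable_EFinP; apply: measurable_funM => //.
  by apply/measurable_EFinP; exact: measurable_trigf.
have Cw0 (D : set R) t : D t -> (0 <= (C * w t)%:E)%E.
  by move=> _; rewrite lee_fin mulr_ge0// ltW.
(* The union of the first k arcs; sum and integral are compared by induction on k. *)
pose S k : set R := [set` `[0, (dl * k%:R)[].
have dlk k : 0 <= dl * k%:R by rewrite mulr_ge0// ltW.
have SS k : S k.+1 `&` A = (S k `&` A) `|` (arc N k `&` A).
  rewrite -setIUl; congr (_ `&` _); rewrite /S /arc -/dl.
  apply/seteqP; split => t /=; rewrite !in_itv/=.
    by move=> /andP[t1 t2]; have [h1|h1] := ltP t (dl * k%:R); [left; rewrite t1|right].
  have hk : dl * k%:R < dl * k.+1%:R by rewrite ltr_pM2l// ltr_nat.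
  have hk0 := dlk k.
  move=> [/andP[t1 t2]|/andP[t1 t2]]; apply/andP; split => //.
    exact: lt_trans t2 hk.
  exact: le_trans hk0 t1.
have mS k : measurable (S k `&` A).
  by apply: measurableI; [exact: measurable_itv|exact: mA].
have marc k : measurable (arc N k `&` A).
  by apply: measurableI; [exact: measurable_itv|exact: mA].
have disj k : [disjoint S k `&` A & arc N k `&` A].
  apply/disj_set2P; apply/seteqP; split => t //= [[]].
  rewrite /S /arc -/dl /= !in_itv/= => /andP[_ t1] _ [/andP[t2 _] _].
  by move: (lt_le_trans t1 t2); rewrite ltxx.
have J k : ((\sum_(i < k) h i * fine (lebesgue_measure (arc N i `&` A)))%:E <=
   \int[lebesgue_measure]_(t in S k `&` A) (C * w t)%:E)%E.
  elim: k => [|k ih].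
    rewrite big_ord0; apply: integral_ge0; exact: Cw0.
  have iU := @ge0_integral_setU _ _ R (@lebesgue_measure R) _ _ (mS k) (marc k) _ (mCw _) (Cw0 _) (disj k).
  rewrite SS iU big_ord_recr /= EFinD leeD//.
  have hk0 : 0 <= h k by exact: expR_ge0.
  rewrite EFinM fineK; last by apply: Afin; exact: measurable_itv.
  rewrite -integral_cst; last exact: marc.
  apply: (@ge0_le_integral _ _ R (@lebesgue_measure R) _ (marc k)).
  - by move=> t _; rewrite lee_fin.
  - exact: measurable_cst.
  - exact: mCw.
  - by move=> t [t1 t2]; rewrite lee_fin; exact: hw.
have S2N : S (2 * N)%N `&` A = A.
  apply/setIidPr => t /AE; rewrite /S /=.
  by rewrite /dl natrM (_ : pi / N%:R * (2 * N%:R) = pi *+ 2)// mulr2n; field; exact: lt0r_neq0.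
have := J (2 * N)%N; rewrite S2N => JN.
have Lfin : lebesgue_measure A \is a fin_num by rewrite -(setTI A); exact: Afin.
set L := fine (lebesgue_measure A).
have LE : lebesgue_measure A = L%:E by rewrite fineK.
have L0 : 0 <= L by rewrite fine_ge0.
have hC : (\int[lebesgue_measure]_(t in A) (C * w t)%:E <= (C * ((1 + 8 * l ^+ 2 - 2 * eps * l) * L))%:E)%E.
  under eq_integral do rewrite EFinM.
  rewrite ge0_integralZl_EFin//; last 3 first.
  - by move=> t _; rewrite lee_fin.
  - exact: measurable_trigf.
  - exact: ltW.
  rewrite (EFinM C) (EFinM _ L) -LE; apply: lee_wpmul2l; last exact: hint.
  by rewrite lee_fin ltW.
have := le_trans JN hC; rewrite lee_fin => {JN hC} final.
(* For a null allowed set every quotient is 0, by the convention on division. *)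
have [L00|L00] := eqVneq L 0.
  rewrite big1 ?mulr_ge0 ?expR_ge0// => i _.
  by rewrite -/L L00 invr0 !mulr0.
have Lp : 0 < L by rewrite lt_neqAle eq_sym L00.
under eq_bigr do rewrite -/L mulrA.
rewrite -mulr_suml ler_pdivrMr//.
by apply: le_trans final _; rewrite /C le_eqVlt; apply/orP; left; apply/eqP; ring.
Qed.

End Discrete.

(* The transition probabilities are not known to depend measurably on the history. The
   integral of a nonnegative function is a supremum over the simple functions below it even
   when the function is not measurable; it is then still monotone and superadditive. *)
Section LowerIntegral.
Local Open Scope ereal_scope.
Context d (T : measurableType d) (R : realType) (mu : {measure set T -> \bar R}).
Implicit Types f g : T -> \bar R.
Import HBNNSimple.

Lemma lower_integral_le f g : (forall w, 0 <= f w) -> (forall w, f w <= g w) ->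
  \int[mu]_w f w <= \int[mu]_w g w.
Proof.
move=> f0 fg; have g0 w : 0 <= g w by exact: le_trans (f0 w) (fg w).
rewrite !ge0_integralTE//; apply: ereal_sup_le => _ [h hf <-].
by exists h => //= w; exact: le_trans (hf w) (fg w).
Qed.

Lemma lower_integralD f g : (forall w, 0 <= f w) -> (forall w, 0 <= g w) ->
  \int[mu]_w f w + \int[mu]_w g w <= \int[mu]_w (f w + g w).
Proof.
move=> f0 g0; have fg0 w : 0 <= f w + g w by rewrite adde_ge0.
rewrite (ge0_integralTE _ f0) (ge0_integralTE _ g0) (ge0_integralTE _ fg0) /=.
pose S (k : T -> \bar R) :=
  [set sintegral mu h | h in [set h : {nnsfun T >-> R} | forall w, (h w)%:E <= k w]].
rewrite -/(S f) -/(S g) -/(S (fun w => f w + g w)).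
set A := S f; set B := S g; set c := ereal_sup (S _).
have h a b : A a -> B b -> a + b <= c.
  move=> [h1 h1f <-] [h2 h2g <-]; rewrite -sintegralD; apply: ereal_sup_ubound.
  exists (add_nnsfun h1 h2) => //= w; exact: (leeD (h1f w) (h2g w)).
have A0 : A (sintegral mu (@nnsfun0 _ T R)) by exists (@nnsfun0 _ T R).
have B0 : B (sintegral mu (@nnsfun0 _ T R)) by exists (@nnsfun0 _ T R).
have c0 : 0 <= c by have := h _ _ A0 B0; rewrite !sintegral0 adde0.
have Ac : ereal_sup A <= c.
  apply: ge_ereal_sup => a Aa; have := h _ _ Aa B0; by rewrite sintegral0 adde0.
have Bc : ereal_sup B <= c.
  apply: ge_ereal_sup => a Aa; have := h _ _ A0 Aa; by rewrite sintegral0 add0e.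
case: (leP +oo c) => [|coo]; first by rewrite leye_eq => /eqP ->; exact: leey.
have cfin : c \is a fin_num by rewrite ge0_fin_numE.
have sA0 : 0 <= ereal_sup A by rewrite -[leLHS](sintegral0 mu); apply: ereal_sup_ubound.
have Afin : ereal_sup A \is a fin_num by rewrite ge0_fin_numE//; exact: le_lt_trans coo.
rewrite -leeBrDl//; apply: ge_ereal_sup => b Bb.
rewrite leeBrDl// -leeBrDr; last first.
  have sb0 : 0 <= b by case: Bb => hb _ <-; exact: sintegral_ge0.
  rewrite ge0_fin_numE//; apply: le_lt_trans coo; apply: le_trans Bc.
  exact: ereal_sup_ubound.
apply: ge_ereal_sup => a Aa; rewrite leeBrDr; first exact: h.
have sb0 : 0 <= b by case: Bb => hb _ <-; exact: sintegral_ge0.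
rewrite ge0_fin_numE//; apply: le_lt_trans coo; apply: le_trans Bc.
exact: ereal_sup_ubound.
Qed.

Lemma lower_integral_sum (I : Type) (s : seq I) (f : I -> T -> \bar R) :
  (forall i w, 0 <= f i w) ->
  \sum_(i <- s) \int[mu]_w f i w <= \int[mu]_w \sum_(i <- s) f i w.
Proof.
move=> f0; elim: s => [|i s ih].
  by rewrite big_nil; apply: integral_ge0 => w _; rewrite big_nil.
rewrite big_cons; under [leRHS]eq_integral do rewrite big_cons.
apply: le_trans (lower_integralD _ _) => //; first by rewrite leeD2l.
by move=> w; apply: sume_ge0.
Qed.

Lemma lower_integralZ (c : R) f : (0 <= c)%R -> (forall w, 0 <= f w) ->
  c%:E * \int[mu]_w f w <= \int[mu]_w (c%:E * f w).
Proof.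
rewrite le_eqVlt => /predU1P[<- f0|c0 f0].
  by rewrite mul0e; apply: integral_ge0 => w _; rewrite mul0e.
have cf0 w : 0 <= c%:E * f w by rewrite mule_ge0// lee_fin ltW.
rewrite -lee_pdivlMl// ge0_integralTE//; apply: ge_ereal_sup => _ [h hf <-].
rewrite lee_pdivlMl// -sintegralrM ge0_integralTE//; apply: ereal_sup_ubound.
exists (scale_nnsfun h (ltW c0)) => //= w.
by rewrite EFinM lee_pmul2l// hf.
Qed.

End LowerIntegral.

(** * Integrating functions of the history against the transition probabilities *)

Section HistoryKernel.
Local Open Scope ereal_scope.
Context d (T : measurableType d) (R : realType) (P : probability T R).
Import HBNNSimple.

(** As q need not be measurable, only an inequality is claimed: h is approximated from below by
    simple functions of the history, the hypothesis is applied on their level sets, and the lower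
    integrals are added up by superadditivity. *)
Lemma history_kernel_le (G : set (set T)) (E : set T) (q : T -> R)
  (h : g_sigma_algebraType G -> R) :
  (G `<=` @measurable d T) -> measurable E -> (forall w, 0 <= q w)%R ->
  (forall C, <<s G >> C -> P (C `&` E) = \int[P]_(w in C) (q w)%:E) ->
  measurable_fun setT h -> (forall w, 0 <= h w)%R ->
  \int[P]_(w in E) (h w)%:E <= \int[P]_w (h w * q w)%:E.
Proof.
move=> Gm mE q0 hq mh h0.
pose idG : T -> g_sigma_algebraType G := idfun.
have Gm' C : <<s G >> C -> measurable C.
  by apply: smallest_sub => //; exact: sigma_algebra_measurable.
have mid : measurable_fun setT idG.
  by move=> _ B mB; rewrite setTI; exact: Gm'.
(* P restricted to E, on the sigma-algebra generated by G *)
pose nu := pushforward (mrestr P mE) idG.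
have nuE : \int[nu]_w (h w)%:E = \int[mrestr P mE]_w (h w)%:E.
  rewrite ge0_integral_pushforward//; last 2 first.
    by apply/measurable_EFinP.
    by move=> w _; rewrite lee_fin.
have hE : \int[P]_(w in E) (h w)%:E <= \int[mrestr P mE]_w (h w)%:E.
  rewrite ge0_integralE; last by move=> w _; rewrite lee_fin.
  apply: ge_ereal_sup => _ [g gh <-].
  rewrite ge0_integralTE; last by move=> w; rewrite lee_fin.
  have -> : sintegral P g = sintegral (mrestr P mE) g.
    rewrite !sintegralEnnsfun; apply: eq_fsbigr => x; rewrite inE /= => x0.
    congr (_ * _); rewrite /mrestr /=; congr (P _); apply/seteqP; split => w /=; last by case.
    move=> gw; split => //; apply: contrapT => Ew.
    have := gh w; rewrite patchE memNset// lee_fin gw; rewrite leNgt x0//.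
  apply: ereal_sup_ubound; exists g => //= w.
  apply: le_trans (gh w) _; rewrite patchE; case: ifP => // _.
  by rewrite lee_fin.
apply: (le_trans hE); rewrite -nuE ge0_integralTE; last by move=> w; rewrite lee_fin.
apply: ge_ereal_sup => _ [phi phih <-].
rewrite sintegralE fsbig_finite//=.
have finphi : finite_set (range phi) by exact: fimfunP.
pose C x : set T := phi @^-1` [set x].
(* The truncation at 0 makes [t x] nonnegative for every real x, as [lower_integral_sum] asks; it
   changes nothing at the values of [phi]. *)
pose t (x : R) w : \bar R := (Num.max x 0)%:E * ((fun w => (q w)%:E) \_ (C x)) w.
have qC0 x w : 0 <= ((fun w => (q w)%:E) \_ (C x)) w.
  by rewrite patchE; case: ifP => // _; rewrite lee_fin.
have t0 x w : 0 <= t x w by rewrite mule_ge0// lee_fin le_max lexx orbT.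
pose s := finmap.enum_fset (fset_set (range phi)).
have h1 : \sum_(x <- s) x%:E * P (C x `&` E) <= \sum_(x <- s) \int[P]_w t x w.
  rewrite big_seq [leRHS]big_seq; apply: lee_sum => x.
  rewrite in_fset_set// inE => -[w0 _ phiw0].
  have x0 : (0 <= x)%R by rewrite -phiw0.
  apply: le_trans (lower_integralZ _ _ _) => //; last by rewrite le_max lexx orbT.
  rewrite max_l// -integral_mkcond -hq//.
  by rewrite /C -[_ @^-1` _]setTI; exact: (measurable_funP phi).
apply: (le_trans h1).
apply: le_trans (lower_integral_sum _ _ t0) _.
apply: lower_integral_le => w; first by apply: sume_ge0.
rewrite (bigD1_seq (phi w))/=; last 2 first.
- by rewrite in_fset_set// inE; exists w.
- exact: finmap.fset_uniq.
rewrite big1 ?adde0.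
  rewrite /t patchE mem_set//= max_l// -EFinM lee_fin ler_wpM2r//.
  by have := phih w; rewrite lee_fin.
move=> x xw; rewrite /t patchE memNset ?mule0//= => e.
by move: xw; rewrite /C /= in e *; rewrite e eqxx.
Qed.

End HistoryKernel.

(** * Measurability of the potential *)

Section Measurability.
Context d (O : measurableType d) (R : realType).
Local Notation pt := (R * R)%type.
Implicit Types (Y Z : O -> pt).

Lemma measurable_fun1 Y : measurable_fun setT Y -> measurable_fun setT (fun w => (Y w).1).
Proof. by move=> mY; exact: (measurableT_comp measurable_fst mY). Qed.

Lemma measurable_fun2 Y : measurable_fun setT Y -> measurable_fun setT (fun w => (Y w).2).
Proof. by move=> mY; exact: (measurableT_comp measurable_snd mY). Qed.

Lemma measurable_padd Y Z : measurable_fun setT Y -> measurable_fun setT Z ->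
  measurable_fun setT (fun w => padd (Y w) (Z w)).
Proof.
move=> mY mZ; apply: measurable_fun_pair.
  by apply: measurable_funD; exact: measurable_fun1.
by apply: measurable_funD; exact: measurable_fun2.
Qed.

Lemma measurable_pscale (c : R) Y : measurable_fun setT Y ->
  measurable_fun setT (fun w => pscale c (Y w)).
Proof.
move=> mY; apply: measurable_fun_pair.
  by apply: measurable_funM => //; exact: measurable_fun1.
by apply: measurable_funM => //; exact: measurable_fun2.
Qed.

Lemma measurable_dotp Y Z : measurable_fun setT Y -> measurable_fun setT Z ->
  measurable_fun setT (fun w => dotp (Y w) (Z w)).
Proof.
move=> mY mZ; apply: measurable_funD; apply: measurable_funM;
  by [exact: measurable_fun1|exact: measurable_fun2].
Qed.

Lemma measurable_crsp Y Z : measurable_fun setT Y -> measurable_fun setT Z ->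
  measurable_fun setT (fun w => crsp (Y w) (Z w)).
Proof.
move=> mY mZ; apply: measurable_funB; apply: measurable_funM;
  by [exact: measurable_fun1|exact: measurable_fun2].
Qed.

Lemma measurable_enorm Y : measurable_fun setT Y -> measurable_fun setT (fun w => enorm (Y w)).
Proof.
move=> mY; apply: (measurableT_comp (f := @Num.sqrt R)).
  by apply: continuous_measurable_fun; exact: sqrt_continuous.
by apply: measurable_funD; apply: measurable_funX; [exact: measurable_fun1|exact: measurable_fun2].
Qed.

Lemma measurable_penalty_term Y Z : measurable_fun setT Y -> measurable_fun setT Z ->
  measurable_fun setT (fun w => penalty_term (Y w) (Z w)).
Proof.
move=> mY mZ.
have mN : measurable_fun setT (fun w => enorm (Z w)) by exact: measurable_enorm.
have mI : measurable_fun setT (fun w => (enorm (Z w))^-1).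
  have -> : (fun w => (enorm (Z w))^-1) = (fun w => enorm (Z w) `^ (-1)).
    by apply/funext => w; rewrite powR_inv1// enorm_ge0.
  exact: (measurableT_comp (measurable_powR (-1))).
(* Comparing norms turns the test for the origin into a measurable test on real numbers. *)
have -> : (fun w => penalty_term (Y w) (Z w)) =
    (fun w => if enorm (Z w) == 0 then 0 else 42 + depth_along (Y w) (Z w)).
  apply/funext => w; rewrite /penalty_term; case: eqP => [->|/eqP Z0]; first by rewrite enorm0 eqxx.
  by rewrite gt_eqF// enorm_gt0.
apply: measurable_fun_ifT => //.
  by apply: measurable_fun_eqr.
apply: measurable_funD => //; rewrite /depth_along /rhombus_depth.
apply: measurable_funB.
  apply: measurable_minr.
    apply: measurable_funB => //; apply: measurable_funM => //; exact: measurable_dotp.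
  by apply: measurable_funM => //; exact: measurable_dotp.
apply: measurable_funM => //; apply: (measurableT_comp (f := @Num.norm R R)) => //.
by apply: measurable_funM => //; exact: measurable_crsp.
Qed.

Lemma measurable_potential (Y : nat -> O -> pt) (Z : O -> pt) n :
  (forall k, (k < n)%N -> measurable_fun setT (Y k)) -> measurable_fun setT Z ->
  measurable_fun setT (fun w => potential (fun k => Y k w) n (Z w)).
Proof.
move=> mY mZ; apply: measurable_funB; first exact: measurable_enorm.
apply: measurable_funM => //.
elim: n mY => [|n ih] mY.
  rewrite (_ : (fun w => _) = fun=> 0)//.
  by apply/funext => w; rewrite /penalty big_ord0.
rewrite (_ : (fun w => _) =
    (fun w => penalty (fun k => Y k w) n (Z w)) \max (fun w => penalty_term (Z w) (Y n w))).
  apply: measurable_maxr; first by apply: ih => k kn; apply: mY; exact: leqW.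
  by apply: measurable_penalty_term => //; exact: mY.
apply/funext => w /=; apply/le_anti/andP; split.
  by apply: penaltyS; rewrite le_max lexx ?orbT.
rewrite ge_max; apply/andP; split.
  apply: (@bigmax_lub R (fun k => penalty_term (Z w) (Y k w))); first exact: penalty_ge0.
  by move=> k kn; apply: (@bigmax_ub R (fun k => penalty_term (Z w) (Y k w))); exact: leqW.
exact: (@bigmax_ub R (fun k => penalty_term (Z w) (Y k w))).
Qed.

End Measurability.

(** * Measurability of the event that a step falls in an arc *)

Section Arcs.
Variable R : realType.
Local Notation pt := (R * R)%type.

(** Since cos decreases on [0, pi], an arc of the upper half circle is a Borel condition on the
    coordinates, free of the quantifier over angles. *)
Lemma unitv_upper_arc (a b : R) (p : pt) : 0 <= a -> b <= pi ->
  (exists2 t, a <= t < b & p = unitv t) <->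
  [/\ p.1 ^+ 2 + p.2 ^+ 2 = 1, 0 <= p.2, cos b < p.1, p.1 <= cos a & a < b].
Proof.
move=> a0 bpi; have pi0 := @pi_gt0 R; split.
  move=> [t /andP[at_ tb] ->] /=; split.
  - exact: cos2Dsin2.
  - by apply: sin_ge0_pi; lra.
  - by rewrite ltr_cos// in_itv/=; lra.
  - by rewrite leNgt ltr_cos ?in_itv/=; [rewrite -leNgt|lra|lra].
  - lra.
move=> [p1 p2 hb ha ab].
have [q1 q2 _ _] := unit_abs_le1 p1.
have hp : -1 <= p.1 <= 1 by rewrite q1.
have c1 : cos (acos p.1) = p.1 by rewrite acosK// in_itv/= hp.
have A0 := acos_ge0 hp; have Api := acos_lepi hp.
exists (acos p.1).
  apply/andP; split.
    rewrite leNgt; apply/negP => h.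
    have : cos a < cos (acos p.1) by rewrite ltr_cos// in_itv/=; lra.
    by rewrite c1 ltNge ha.
  by rewrite -ltr_cos ?in_itv/=; [rewrite c1|lra|lra].
rewrite /unitv c1 sin_acos//.
have -> : 1 - p.1 ^+ 2 = p.2 ^+ 2 by rewrite -p1; ring.
by rewrite sqrtr_sqr ger0_norm//; case: p {p1 p2 hb ha q1 q2 hp c1 A0 Api}.
Qed.

Lemma unitvDpi (t : R) : unitv (t + pi) = pscale (-1) (unitv t).
Proof. by rewrite /unitv /pscale /= sinDpi cosDpi !mulN1r. Qed.

Lemma measurable_arc_step d (O : measurableType d) (Y Z : O -> pt) (N i : nat) :
  measurable_fun setT Y -> measurable_fun setT Z -> (0 < N)%N -> (i < 2 * N)%N ->
  measurable [set w | exists theta : R, arc N i theta /\ 0 <= theta < 2 * pi /\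
     Z w = padd (Y w) (unitv theta)].
Proof.
move=> mY mZ N0 iN.
have pi0 := @pi_gt0 R.
have NR : 0 < N%:R :> R by rewrite ltr0n.
pose dl : R := pi / N%:R.
have dl0 : 0 < dl by rewrite divr_gt0.
have dlN : dl * N%:R = pi by rewrite divfK// gt_eqF.
pose D w := padd (Z w) (pscale (-1) (Y w)).
have mD : measurable_fun setT D by apply: measurable_padd => //; exact: measurable_pscale.
have DE w t : Z w = padd (Y w) (unitv t) <-> D w = unitv t.
  rewrite /D; split => [->|]; rewrite /padd /pscale /unitv/=.
    by congr pair; ring.
  case: (Z w) (Y w) => [z1 z2] [y1 y2] /= [h1 h2].
  by rewrite -h1 -h2; congr pair; ring.
have upper (D' : O -> pt) (a b : R) : measurable_fun setT D' -> 0 <= a -> b <= pi ->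
    measurable [set w | exists2 t, a <= t < b & D' w = unitv t].
  move=> mD' a0 bpi.
  have [ab|ab] := ltP a b; last first.
    rewrite (_ : [set _ | _] = set0)//; apply/seteqP; split => w //= [t /andP[t1 t2]].
    by have := le_lt_trans t1 t2; rewrite ltNge ab.
  have -> : [set w | exists2 t, a <= t < b & D' w = unitv t] =
     ((fun w => (D' w).1 ^+ 2 + (D' w).2 ^+ 2) @^-1` [set 1] `&`
     (fun w => (D' w).2) @^-1` `[0, +oo[%classic) `&`
     (fun w => (D' w).1) @^-1` `](cos b), (cos a)]%classic.
    apply/seteqP; split => w /=.
      by move/(unitv_upper_arc _ a0 bpi) => [h1 h2 h3 h4 _]; rewrite !in_itv/= h2 h3 h4.
    rewrite !in_itv/= => -[[h1]]; rewrite andbT => h2 /andP[h3 h4].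
    by apply/(unitv_upper_arc _ a0 bpi).
  have m1 := measurable_fun1 mD'; have m2 := measurable_fun2 mD'.
  have m3 : measurable_fun setT (fun w => (D' w).1 ^+ 2 + (D' w).2 ^+ 2).
    by apply: measurable_funD; apply: measurable_funX.
  apply: measurableI; first apply: measurableI.
  - by rewrite -[_ @^-1` _]setTI; apply: m3.
  - by rewrite -[_ @^-1` _]setTI; apply: m2.
  - by rewrite -[_ @^-1` _]setTI; apply: m1.
have i0 : 0 <= dl * i%:R by rewrite mulr_ge0// ltW.
have bnd (k m : nat) : (k <= m)%N -> dl * k%:R <= dl * m%:R by move=> km; rewrite ler_pM2l// ler_nat.
have [iN'|iN'] := ltnP i N.
  rewrite (_ : [set _ | _] = [set w | exists2 t, dl * i%:R <= t < dl * i.+1%:R & D w = unitv t]).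
    by apply: upper => //; rewrite -dlN; exact: bnd.
  apply/seteqP; split => w /=.
    by move=> [t [ht [_ /DE e]]]; exists t => //; move: ht; rewrite /arc/= in_itv.
  move=> [t ht /DE e]; exists t; split; first by rewrite /arc /= in_itv.
  split => //; have := bnd _ _ iN'; rewrite dlN; move: ht i0 pi0; clear; lra.
(* Arcs of the lower half circle are turned by pi into the upper one, which negates the step. *)
pose a := dl * i%:R - pi; pose b := dl * i.+1%:R - pi.
have a0 : 0 <= a by rewrite /a subr_ge0 -dlN; exact: bnd.
have b0 : b <= pi.
  rewrite /b lerBlDr -mulr2n -(mulr_natl pi 2) -dlN mulrCA -natrM.
  exact: bnd.
rewrite (_ : [set _ | _] = [set w | exists2 t, a <= t < b & pscale (-1) (D w) = unitv t]).
  by apply: upper => //; exact: measurable_pscale.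
have NN (p : pt) : pscale (-1) (pscale (-1) p) = p.
  by rewrite /pscale /=; case: p => ? ?; congr pair => /=; ring.
apply/seteqP; split => w /=.
  move=> [t [ht [_ /DE e]]]; exists (t - pi).
    by move: ht; rewrite /arc/= in_itv/= -/dl /a /b; clear; lra.
  by rewrite e -[in LHS](subrK pi t) unitvDpi NN.
move=> [t ht e]; exists (t + pi); split.
  by move: ht; rewrite /arc/= in_itv/= -/dl /a /b; clear; lra.
split.
  by move: ht b0 a0 pi0; clear; lra.
by apply/DE; rewrite unitvDpi -e NN.
Qed.

Lemma arc_cover (N : nat) (t : R) : (0 < N)%N -> 0 <= t < 2 * pi ->
  exists2 i, (i < 2 * N)%N & arc N i t.
Proof.
move=> N0 /andP[t0 t2]; have pi0 := @pi_gt0 R.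
have NR : 0 < N%:R :> R by rewrite ltr0n.
pose dl : R := pi / N%:R.
have dl0 : 0 < dl by rewrite divr_gt0.
have dlN : dl * N%:R = pi by rewrite divfK// gt_eqF.
have q0 : 0 <= t / dl by rewrite divr_ge0// ltW.
have := Num.Theory.truncn_itv q0; set i := Num.truncn _ => /andP[h1 h2].
have e : dl * (t / dl) = t by rewrite mulrC divfK// gt_eqF.
have a1 : dl * i%:R <= t by rewrite -[leRHS]e ler_pM2l.
have a2 : t < dl * i.+1%:R by rewrite -[ltLHS]e ltr_pM2l.
exists i; last by rewrite /arc /= in_itv/= -/dl a1 a2.
rewrite -(ltr_nat R) -(ltr_pM2l dl0) natrM mulrCA dlN.
exact: le_lt_trans a1 t2.
Qed.

End Arcs.

(** * A measurable form of being interior to the hull *)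

Section Crowded.
Variable R : realType.
Local Notation pt := (R * R)%type.
Implicit Types (x : nat -> pt) (n k : nat) (p q : pt).

(* Quantifies "p is interior to the hull of x 0, ..., x n" by the distance eta from p to the
   supporting lines; rational directions suffice and make it a measurable condition. *)
Definition crowded x n p (eta : R) : Prop :=
  forall a : rat, exists2 k, (k <= n)%N & eta <= dotp (psub (x k) p) (unitv (ratr a)).

Lemma crowded_interior x n p eta : 0 < eta -> crowded x n p eta ->
  interior (hull_pts x n : set (R * R)%type) p.
Proof.
move=> e0 h; apply: (@interior_euclid _ _ _ (eta / 2)); first by rewrite divr_gt0.
move=> y hy; apply: (@hull_support_ball _ _ _ p (eta / 2)) => // t.
(* B bounds all the vectors involved, so a rational direction within eta / (4 B) of t changes each
   scalar product by at most eta / 2. *)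
pose B := 1 + \sum_(k < n.+1) enorm (psub (x k) p).
have B1 : 1 <= B by rewrite lerDl sumr_ge0// => k _; exact: enorm_ge0.
have Bk k : (k <= n)%N -> enorm (psub (x k) p) <= B.
  move=> kn; have kn' : (k < n.+1)%N by [].
  rewrite /B (bigD1 (Ordinal kn'))//= addrCA lerDl addr_ge0// sumr_ge0// => i _.
  exact: enorm_ge0.
have B0 : 0 < B by lra.
have d0 : t < t + eta / (4 * B) by rewrite ltrDl divr_gt0// mulr_gt0.
have [a] := rat_in_itvoo d0; rewrite in_itv/= => /andP[a1 a2].
have [k kn hk] := h a; exists k => //.
have hu := unitv_lipschitz (ratr a) t.
have at_ : `|ratr a - t| <= eta / (4 * B) by rewrite ger0_norm; lra.
have := dotp_le (psub (x k) p) (psub (unitv (ratr a)) (unitv t)).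
have : enorm (psub (x k) p) * enorm (psub (unitv (ratr a)) (unitv t)) <= B * (2 * (eta / (4 * B))).
  by apply: ler_pM; rewrite ?enorm_ge0 ?Bk//; lra.
have -> : B * (2 * (eta / (4 * B))) = eta / 2 by field; exact: lt0r_neq0.
have -> : dotp (psub (x k) p) (psub (unitv (ratr a)) (unitv t)) =
  dotp (psub (x k) p) (unitv (ratr a)) - dotp (psub (x k) p) (unitv t).
  by rewrite /dotp /psub/=; ring.
move=> h1 /ler_normlP[h2 h3]; move: hk h1 h3; clear; lra.
Qed.

Lemma interior_crowded x n p : interior (hull_pts x n : set (R * R)%type) p ->
  exists j : nat, crowded x n p j.+1%:R^-1.
Proof.
move=> /interior_euclidE[eta e0 he].
have e40 : 0 < eta / 4 by rewrite divr_gt0.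
exists (Num.truncn (eta / 4)^-1) => a.
have : (Num.truncn (eta / 4)^-1).+1%:R^-1 <= eta / 4.
  rewrite invf_ple ?posrE ?ltr0n// ltW//.
  have : 0 <= (eta / 4)^-1 by rewrite invr_ge0 ltW.
  by move/truncn_itv => /andP[].
move=> hj; apply: contrapT => hn.
have hk k : (k <= n)%N -> dotp (x k) (unitv (ratr a)) <= dotp p (unitv (ratr a)) + eta / 4.
  move=> kn; rewrite leNgt; apply/negP => hk; apply: hn; exists k => //.
  by rewrite dotpBl; apply: le_trans hj _; move: hk; clear; lra.
have /(hull_halfplane hk) : hull_pts x n (padd p (pscale (eta / 2) (unitv (ratr a)))).
  apply: he; rewrite (_ : psub _ _ = pscale (eta / 2) (unitv (ratr a))).
    by rewrite enorm_scale ?enorm_unitv ?mulr1; move: e0; clear; lra.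
  by rewrite /psub /padd /pscale/=; congr pair; ring.
rewrite dotp_paddl dotp_pscalel dotp_unitv; move: e0; clear; lra.
Qed.

Lemma crowded_move x n p q eta e : crowded x n p eta -> enorm (psub q p) <= e ->
  crowded x n q (eta - e).
Proof.
move=> h he a; have [k kn hk] := h a; exists k => //.
have := dotp_le (psub q p) (unitv (ratr a)); rewrite enorm_unitv mulr1 => /ler_normlP[_].
move: hk he; rewrite !dotpBl; clear; lra.
Qed.

(** The point itself contributes scalar product 0, below eta, so the witnesses are earlier points:
    landing in the interior of the new hull means landing in that of the old one. *)
Lemma crowded_self x n eta : 0 < eta -> crowded x n.+1 (x n.+1) eta -> crowded x n (x n.+1) eta.
Proof.
move=> e0 h a; have [k + hk] := h a; rewrite leq_eqVlt => /predU1P[kn|kn]; last by exists k.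
by move: hk; rewrite kn /dotp /psub /= !subrr !mul0r addr0 leNgt e0.
Qed.

Lemma measurable_crowded d (O : measurableType d) (Y : nat -> O -> pt) (Z : O -> pt) n eta :
  (forall k, (k <= n)%N -> measurable_fun setT (Y k)) -> measurable_fun setT Z ->
  measurable [set w | crowded (fun k => Y k w) n (Z w) eta].
Proof.
move=> mY mZ.
pose E (a : rat) k : set O := [set w | eta <= dotp (psub (Y k w) (Z w)) (unitv (ratr a))].
have mE a k : (k <= n)%N -> measurable (E a k).
  move=> kn; rewrite (_ : E a k =
      setT `&` (fun w => dotp (psub (Y k w) (Z w)) (unitv (ratr a))) @^-1` `[eta, +oo[%classic).
    have m : measurable_fun setT (fun w => dotp (psub (Y k w) (Z w)) (unitv (ratr a))).
      apply: measurable_dotp => //; apply: measurable_fun_pair.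
        by apply: measurable_funB; apply: measurable_fun1 => //; exact: mY.
      by apply: measurable_funB; apply: measurable_fun2 => //; exact: mY.
    exact: m.
  by rewrite setTI; apply/seteqP; split => w /=; rewrite in_itv/= andbT.
rewrite (_ : [set _ | _] = ~` \bigcup_(a : rat) ~` \bigcup_(k in [set k | (k <= n)%N]) E a k).
  apply: measurableC; apply: bigcupT_measurable_rat => a; apply: measurableC.
  by apply: bigcup_measurable => k /= kn; exact: mE.
apply/seteqP; split => w /=.
  by move=> h [a _ ha]; apply: ha; have [k kn hk] := h a; exists k.
move=> h a; apply: contrapT => hn; apply: h; exists a => // -[k kn hk].
Qed.

(** All directions making an angle of at most pi / 2 with an outer normal of a supporting line are
    allowed; the quarter turn before or after the normal stays within [0, 2 pi). *)
Lemma allowed_measure_gt0 x n : ~ interior (hull_pts x n : set (R * R)%type) (x n) ->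
  0 < fine (lebesgue_measure (allowed_angles x n)).
Proof.
move=> /support_exists[e0 he0]; have pi0 := @pi_gt0 R.
have [e [he1 ue]] := unitv_polar (unitv e0).
rewrite enorm_unitv in ue.
have ue' : unitv e0 = unitv e by rewrite ue /pscale !mul1r.
set A := allowed_angles x n.
have mA : measurable A by exact: allowed_angles_measurable.
have sub th : 0 <= th < pi *+ 2 -> 0 <= cos (th - e) -> A th.
  move=> hth hc; split; first by rewrite (mulr_natl pi 2).
  move=> t /andP[t0 _] hi.
  have : dotp (padd (x n) (pscale t (unitv th))) (unitv e) < dotp (x n) (unitv e).
    apply: (@hull_interior_halfplane _ x n) => // k kn.
    by rewrite -subr_le0 -dotpBl -ue'; exact: he0.
  rewrite dotp_paddl dotp_pscalel dotp_unitv2 gtrDl -opprB cosN => h.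
  by move: h; rewrite ltNge mulr_ge0.
have Afin : lebesgue_measure A \is a fin_num.
  rewrite ge0_fin_numE//.
  apply: (@le_lt_trans _ _ (lebesgue_measure (`[0, (pi *+ 2)[ : set R))).
    by apply: le_measure; rewrite ?inE// => t [/= ht _]; rewrite in_itv/= -(mulr_natl pi 2).
  by rewrite lebesgue_measure_itv/=; case: ifP => // _; rewrite -EFinB ltry.
suff : (0 < lebesgue_measure A)%E.
  by move=> h; rewrite -lte_fin fineK.
have key a b : a < b -> [set` `]a, b[] `<=` A -> (0 < lebesgue_measure A)%E.
  move=> ab hab; apply: (@lt_le_trans _ _ (lebesgue_measure ([set` `]a, b[] : set R))).
    by rewrite lebesgue_measure_itv/= lte_fin ab -EFinB lte_fin subr_gt0.
  by apply: le_measure; rewrite ?inE.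
rewrite (mulr2n pi) in he1 sub.
have [h|h] := leP e pi.
  apply: (@key e (e + pi / 2)); first by move: pi0; clear; lra.
  move=> th /=; rewrite in_itv/= => hth; apply: sub; first by move: hth he1 h pi0; clear; lra.
  by apply: cos_ge0_pihalf; move: hth pi0; clear; lra.
apply: (@key (e - pi / 2) e); first by move: pi0; clear; lra.
move=> th /=; rewrite in_itv/= => hth; apply: sub; first by move: hth he1 h pi0; clear; lra.
by apply: cos_ge0_pihalf; move: hth pi0; clear; lra.
Qed.

End Crowded.

(** * Almost sure properties of the walk *)

Section Walk.
Context d (T : measurableType d) (R : realType).
Local Notation pt := (R * R)%type.
Variables (P : probability T R) (X : nat -> T -> pt).

Definition hist_gen (n : nat) : set (set T) :=
  [set A | exists k (B : set pt), (k <= n)%N /\ measurable B /\ A = X k @^-1` B].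

Definition step_set (n : nat) (B : set R) : set T :=
  [set w | exists theta, B theta /\ 0 <= theta < 2 * pi /\
     X n.+1 w = padd (X n w) (unitv theta)].

Definition step_prob (n : nat) (B : set R) (w : T) : R :=
  fine (lebesgue_measure (B `&` allowed_angles (fun k => X k w) n)) /
  fine (lebesgue_measure (allowed_angles (fun k => X k w) n)).

(** The law constrains the steps only almost surely; this event carries what pathwise arguments need
    about them. *)
Definition unit_steps (n : nat) : set T :=
  [set w | forall k, (k < n)%N -> enorm (padd (X k w) (pscale (-1) (X k.+1 w))) = 1].

Lemma step_prob_ge0 n B w : 0 <= step_prob n B w.
Proof. by rewrite divr_ge0// fine_ge0. Qed.

Lemma measurable_hist n k : (k <= n)%N ->
  measurable_fun setT (X k : g_sigma_algebraType (hist_gen n) -> pt).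
Proof.
by move=> kn _ B mB; rewrite setTI; apply: sub_gen_smallest; exists k, B.
Qed.

Hypothesis HX : hull_avoiding_walk P X.

Lemma walk_start w : X 0%N w = 0. Proof. by case: HX. Qed.

Lemma walk_measurable k : measurable_fun setT (X k). Proof. by case: HX => _ []. Qed.

Lemma hist_gen_measurable n : hist_gen n `<=` @measurable d T.
Proof.
move=> _ [k [B [_ [mB ->]]]]; rewrite -[_ @^-1` _]setTI.
exact: walk_measurable.
Qed.

Lemma hist_measurable n C : <<s hist_gen n >> C -> measurable C.
Proof.
by apply: smallest_sub; [exact: sigma_algebra_measurable|exact: hist_gen_measurable].
Qed.

Lemma walk_step n C B : <<s hist_gen n >> C -> measurable B ->
  P (C `&` step_set n B) = (\int[P]_(w in C) (step_prob n B w)%:E)%E.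
Proof. by case: HX => _ [_ h]; exact: h. Qed.

Lemma step_setTE n : step_set n setT =
  [set w | enorm (padd (X n w) (pscale (-1) (X n.+1 w))) = 1].
Proof.
apply/seteqP; split => w /=.
  move=> [t [_ [_ ->]]].
  rewrite (_ : padd _ _ = pscale (-1) (unitv t)).
    by rewrite /enorm /pscale /= !mulN1r !sqrrN cos2Dsin2 sqrtr1.
  by rewrite /padd /pscale /=; congr pair; ring.
move=> h; have [t [ht e]] := unitv_polar (padd (X n.+1 w) (pscale (-1) (X n w))).
exists t; split => //; split; first by rewrite (mulr_natl pi 2).
have e1 : enorm (padd (X n.+1 w) (pscale (-1) (X n w))) = 1.
  rewrite -[RHS]h /enorm /padd /pscale /= !mulN1r.
  by congr Num.sqrt; ring.
have : padd (X n.+1 w) (pscale (-1) (X n w)) = unitv t.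
  by rewrite e e1 /pscale !mul1r.
rewrite /padd /pscale /unitv /=; case: (X n.+1 w) (X n w) => [a1 a2] [b1 b2] /= [<- <-].
by congr pair; ring.
Qed.

Definition crowded_event (n : nat) : set T :=
  [set w | exists j : nat, crowded (fun k => X k w) n (X n w) j.+1%:R^-1].

Lemma measurable_crowded_event n : measurable (crowded_event n).
Proof.
rewrite (_ : crowded_event n = \bigcup_j [set w | crowded (fun k => X k w) n (X n w) j.+1%:R^-1]).
  apply: bigcupT_measurable => j; apply: measurable_crowded; last exact: walk_measurable.
  by move=> k _; exact: walk_measurable.
by apply/seteqP; split => w /= [j]; [exists j|move=> _ h; exists j].
Qed.

Lemma measurable_step_setT n : measurable (step_set n setT).
Proof.
rewrite step_setTE; rewrite (_ : [set _ | _] =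
    setT `&` (fun w => enorm (padd (X n w) (pscale (-1) (X n.+1 w)))) @^-1` [set 1]); last by rewrite setTI.
have m : measurable_fun setT (fun w => enorm (padd (X n w) (pscale (-1) (X n.+1 w)))).
  apply: measurable_enorm; apply: measurable_padd; first exact: walk_measurable.
  by apply: measurable_pscale; exact: walk_measurable.
exact: m.
Qed.

(** If the left end of the arc leads eta deep into the hull, every point reached from the arc is
    within 8 / N of it, hence interior; the arc contains no allowed direction and has transition
    probability 0. *)
Lemma step_set_crowded_null n (eta : R) (N i : nat) : 0 < eta -> (0 < N)%N -> 16 / N%:R <= eta ->
  P ([set w | crowded (fun k => X k w) n (padd (X n w) (unitv (pi / N%:R * i%:R))) eta]
     `&` step_set n (arc N i)) = 0%E.
Proof.
move=> e0 N0 hN.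
have NR : 0 < N%:R :> R by rewrite ltr0n.
set H := [set _ | _].
have mH : <<s hist_gen n >> H.
  have := @measurable_crowded R _ (g_sigma_algebraType (hist_gen n)) X
    (fun w => padd (X n w) (unitv (pi / N%:R * i%:R))) n eta.
  apply; first by move=> k kn; exact: measurable_hist.
  by apply: measurable_padd; [exact: measurable_hist|exact: measurable_cst].
rewrite walk_step; [|exact: mH|exact: measurable_itv].
apply: integral0_eq => w hw; congr EFin.
rewrite /step_prob (_ : _ `&` _ = set0) ?measure0 ?mul0r//.
apply/seteqP; split => // t [ht [_ hA]].
apply: (hA 1); first by rewrite lexx ler01.
have -> : pscale 1 (unitv t) = unitv t by rewrite /pscale !mul1r.
apply: (@crowded_interior _ _ _ _ (eta - 8 / N%:R)).
  have : 8 / N%:R < 16 / N%:R :> R by rewrite ltr_pM2r ?invr_gt0// ltr_nat.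
  by move: hN; lra.
apply: crowded_move; first exact: hw.
rewrite (_ : psub _ _ = psub (unitv t) (unitv (pi / N%:R * i%:R))); last first.
  by rewrite /psub /padd /=; congr pair; ring.
apply: le_trans (unitv_lipschitz _ _) _.
have : `|t - pi / N%:R * i%:R| <= 4 / N%:R.
  move: ht; rewrite /arc /= in_itv /= => /andP[h1 h2].
  rewrite ger0_norm ?subr_ge0//.
  have : pi / N%:R <= 4 / N%:R :> R.
    by rewrite ler_pM2r ?invr_gt0//; have := @pihalf_lt2 R; lra.
  move: h2; rewrite -natr1; lra.
lra.
Qed.

(** By [crowded_self], a unit step ending in the interior lands deep in the old hull, hence in one
    of countably many null events of the previous lemma. *)
Lemma crowded_unit_null n : P (step_set n setT) = 1%E -> P (crowded_event n.+1) = 0%E.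
Proof.
move=> h1.
apply/negligibleP; first exact: measurable_crowded_event.
(* Chosen so that 16 / NN j is half of 1 / (j + 1), the depth lost in moving to the end of the
   arc. *)
pose NN (j : nat) := (32 * j.+1)%N.
pose H j i : set T := [set w | crowded (fun k => X k w) n
   (padd (X n w) (unitv (pi / (NN j)%:R * i%:R))) (j.+1%:R^-1 / 2)] `&` step_set n (arc (NN j) i).
apply: (@negligibleS _ _ _ _ (~` (step_set n setT) `|`
    \bigcup_j \bigcup_i (if (i < 2 * NN j)%N then H j i else set0))); last first.
  apply: negligibleU.
    apply/negligibleP; first by apply: measurableC; exact: measurable_step_setT.
    by have := probability_setC P (measurable_step_setT n); rewrite h1 subee.
  apply: negligible_bigcup => j; apply: negligible_bigcup => i.
  case: ifP => iN; last exact: negligible_set0.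
  apply/negligibleP; last first.
    apply: step_set_crowded_null => //.
    by rewrite (_ : 16 / (NN j)%:R = j.+1%:R^-1 / 2 :> R)// /NN natrM; field; rewrite ?pnatr_eq0.
  apply: measurableI.
    apply: measurable_crowded; first by move=> k _; exact: walk_measurable.
    by apply: measurable_padd; [exact: walk_measurable|exact: measurable_cst].
  by apply: measurable_arc_step => //; exact: walk_measurable.
move=> w [j hj]; have [hs|hs] := pselect (step_set n setT w); last by left.
right; exists j => //.
have [t [_ [ht e]]] := hs.
have j0 : 0 < j.+1%:R^-1 :> R by rewrite invr_gt0 ltr0n.
have [i iN hi] := @arc_cover R (NN j) t (isT : (0 < 32 * j.+1)%N) ht.
exists i => //; rewrite iN; split; last by exists t.
have /crowded_self := hj; move=> /(_ j0) h2.
have -> : j.+1%:R^-1 / 2 = j.+1%:R^-1 - j.+1%:R^-1 / 2 :> R by field; rewrite ?pnatr_eq0.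
apply: crowded_move; first exact: h2.
rewrite e (_ : psub _ _ = psub (unitv (pi / (NN j)%:R * i%:R)) (unitv t)); last first.
  by rewrite /psub /padd /=; congr pair; ring.
apply: le_trans (unitv_lipschitz _ _) _.
move: hi; rewrite /arc /= in_itv /= => /andP[q1 q2].
rewrite distrC ger0_norm ?subr_ge0//.
have NR : 0 < (NN j)%:R :> R by rewrite ltr0n.
have : pi / (NN j)%:R <= 4 / (NN j)%:R :> R.
  by rewrite ler_pM2r ?invr_gt0//; have := @pihalf_lt2 R; lra.
have -> : 4 / (NN j)%:R = j.+1%:R^-1 / 8 :> R.
  by rewrite /NN natrM; field; rewrite ?pnatr_eq0.
move: q2 q1 j0; rewrite -[i.+1%:R]natr1; set y := pi / _; set z := _^-1; set k := i%:R; clearbody y z k; lra.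
Qed.

(* By induction: a walker that is not interior to the hull has a nondegenerate set of allowed
   directions, hence makes a unit step, and such a step cannot lead into the interior. *)
Lemma crowded_event_null n : P (crowded_event n) = 0%E /\ P (step_set n setT) = 1%E.
Proof.
have step m : P (crowded_event m) = 0%E -> P (step_set m setT) = 1%E.
  move=> h0; apply/le_anti/andP; split; first by apply: probability_le1; exact: measurable_step_setT.
  rewrite -[X in P X]setTI walk_step//; last exact: (@measurableT _ (g_sigma_algebraType (hist_gen m))).
  have mC := measurable_crowded_event m.
  (* This indicator is a measurable lower bound for the transition probability of a full turn. *)
  have -> : 1%E = (\int[P]_w (\1_(~` crowded_event m) w)%:E)%E.
    rewrite integral_indic ?setIT//; last exact: measurableC.
    by have := probability_setC P mC; rewrite h0 sube0 => hc; exact: esym hc.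
  apply: lower_integral_le => w; rewrite lee_fin indicE ?ler0n//.
  have [|_] := boolP (w \in _); last exact: step_prob_ge0.
  rewrite inE /= => hw; rewrite /step_prob setTI divff// gt_eqF//.
  by apply: allowed_measure_gt0 => /interior_crowded.
elim: n => [|n [_ ih]].
  have c0 : P (crowded_event 0) = 0%E.
    rewrite (_ : crowded_event 0 = set0) ?measure0//.
    apply/seteqP; split => // w [j h]; have [k] := h 0.
    rewrite leqn0 => /eqP ->; rewrite /dotp /psub /= !subrr !mul0r addr0.
    by rewrite leNgt invr_gt0 ltr0n.
  by split => //; exact: step.
have c := crowded_unit_null ih.
by split => //; exact: step.
Qed.

Lemma measurable_unit_steps n : <<s hist_gen n >> (unit_steps n).
Proof.
pose E k : set T := if (k < n)%N then [set w | enorm (padd (X k w) (pscale (-1) (X k.+1 w))) = 1] else setT.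
rewrite (_ : unit_steps n = \bigcap_k E k); last first.
  apply/seteqP; split => w /= h k; first by rewrite /E; case: ifP => // kn _; exact: h.
  by move=> kn; have := h k Logic.I; rewrite /E kn.
apply: (@bigcapT_measurable _ (g_sigma_algebraType (hist_gen n))) => k.
rewrite /E; case: ifP => kn; last exact: measurableT.
have m : measurable_fun setT (fun w : g_sigma_algebraType (hist_gen n) =>
    enorm (padd (X k w) (pscale (-1) (X k.+1 w)))).
  apply: measurable_enorm; apply: measurable_padd; first by apply: measurable_hist; exact: ltnW.
  by apply: measurable_pscale; exact: measurable_hist.
by rewrite (_ : [set _ | _] = setT `&` (fun w : g_sigma_algebraType (hist_gen n) =>
    enorm (padd (X k w) (pscale (-1) (X k.+1 w)))) @^-1` [set 1]); [exact: m|rewrite setTI].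
Qed.

Lemma unit_steps_as n : P (unit_steps n) = 1%E.
Proof.
have mU k : measurable (unit_steps k).
  by apply: (@hist_measurable k); exact: measurable_unit_steps.
elim: n => [|n ih].
  rewrite (_ : unit_steps 0 = setT) ?probability_setT//.
  by apply/seteqP; split.
have -> : unit_steps n.+1 = unit_steps n `&` step_set n setT.
  rewrite step_setTE; apply/seteqP; split => w /=.
    by move=> h; split => [k kn|]; apply: h => //; exact: ltnW.
  by move=> [h1 h2] k; rewrite ltnS leq_eqVlt => /predU1P[->|/h1].
have [_ h1] := crowded_event_null n.
have mS := measurable_step_setT n.
apply/le_anti/andP; split; first by apply: probability_le1; exact: measurableI.
have hc (A : set T) : measurable A -> P A = 1%E -> P.-negligible (~` A).
  move=> mA hA; apply/negligibleP; first exact: measurableC.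
  by have := probability_setC P mA; rewrite hA subee.
have mI : measurable (unit_steps n `&` step_set n setT) by exact: measurableI.
have := probability_setC P (measurableC mI); rewrite setCK => ->.
rewrite (measure_negligible (measurableC mI)) ?sube0//.
by rewrite setCI; apply: negligibleU; exact: hc.
Qed.

End Walk.

(** * Geometric decay of the exponential potential in one step *)

Section Supermartingale.
Context d (T : measurableType d) (R : realType).
Local Notation pt := (R * R)%type.
Variables (P : probability T R) (X : nat -> T -> pt).
Hypothesis HX : hull_avoiding_walk P X.
Variable l : R.
Hypothesis hl : 0 < l <= 1 / 4.

Definition exp_potential n (Z : T -> pt) (w : T) : R :=
  expR (- (l * potential (fun k => X k w) n (Z w))).

Lemma measurable_exp_potential n m (Z : T -> pt) : (m <= n.+1)%N ->
  measurable_fun setT (Z : g_sigma_algebraType (hist_gen X n) -> pt) ->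
  measurable_fun setT (exp_potential m Z : g_sigma_algebraType (hist_gen X n) -> R).
Proof.
move=> mn mZ; apply: (measurableT_comp (f := @expR R)); first exact: measurable_expR.
apply: measurable_funN; apply: measurable_funM => //.
apply: (@measurable_potential _ (g_sigma_algebraType (hist_gen X n))) => // k km.
apply: measurable_hist; rewrite -ltnS; exact: leq_trans km mn.
Qed.

Lemma hist_to_T n (f : T -> R) :
  measurable_fun setT (f : g_sigma_algebraType (hist_gen X n) -> R) -> measurable_fun setT f.
Proof.
move=> mf _ B mB; apply: (hist_measurable HX (n := n)).
exact: (mf measurableT B mB).
Qed.

Lemma measurable_unit_indic n :
  measurable_fun setT (\1_(unit_steps X n) : g_sigma_algebraType (hist_gen X n) -> R).
Proof. by apply: measurable_indic; exact: measurable_unit_steps. Qed.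

(** The indicator restricts to paths on which the pathwise drift bound applies. *)
Definition exp_walk n (w : T) : R := exp_potential n (X n) w * \1_(unit_steps X n) w.

Lemma exp_walk_ge0 n w : 0 <= exp_walk n w.
Proof. by rewrite mulr_ge0 ?expR_ge0// indicE ler0n. Qed.

Lemma measurable_exp_walk n : measurable_fun setT (exp_walk n : g_sigma_algebraType (hist_gen X n) -> R).
Proof.
apply: measurable_funM; last exact: measurable_unit_indic.
by apply: measurable_exp_potential => //; exact: measurable_hist.
Qed.

(* The angle is discretized into 2 N arcs, on each of which the weight after the step is
   replaced by its value at the end of the arc, a function of the history alone. *)
Lemma supermartingale n (N : nat) : (0 < N)%N ->
  (\int[P]_w (exp_walk n.+1 w)%:E <=
   (expR (8 * l * (pi / N%:R)) * (1 + 8 * l ^+ 2 - 2 * eps R * l))%:E * \int[P]_w (exp_walk n w)%:E)%E.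
Proof.
move=> N0; have hl' := hl; have l0 : 0 < l by case/andP: hl.
(* This cost is paid twice, here in passing to the end of the arc and again in [drift_discretized];
   hence the 8 in the statement. *)
pose C : R := expR (4 * l * (pi / N%:R)).
have C0 : 0 <= C by exact: expR_ge0.
pose th (i : nat) : R := pi / N%:R * i%:R.
pose Zi (i : nat) w : pt := padd (X n w) (unitv (th i)).
pose g (i : nat) (w : T) : R := C * (exp_potential n.+1 (Zi i) w * \1_(unit_steps X n) w).
have g0 i w : 0 <= g i w by rewrite !mulr_ge0 ?expR_ge0// indicE ler0n.
pose E i : set T := step_set X n (arc N i).
have mE i : (i < 2 * N)%N -> measurable (E i).
  by move=> iN; apply: measurable_arc_step => //; exact: (walk_measurable HX).
have mg i : measurable_fun setT (g i : g_sigma_algebraType (hist_gen X n) -> R).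
  apply: measurable_funM => //; apply: measurable_funM; last exact: measurable_unit_indic.
  apply: measurable_exp_potential => //; apply: measurable_padd; last exact: measurable_cst.
  exact: measurable_hist.
have mgT i : measurable_fun setT (g i) := hist_to_T (mg i).
have pointwise w : exp_walk n.+1 w <= \sum_(i < 2 * N) g i w * \1_(E i) w.
  have s0 (i : 'I_(2 * N)) : 0 <= g i w * \1_(E i) w by rewrite mulr_ge0// indicE ler0n.
  have [hU|hU] := pselect (unit_steps X n.+1 w); last first.
    by rewrite /exp_walk indicE memNset// mulr0 sumr_ge0.
  have : step_set X n setT w by rewrite step_setTE /=; exact: hU.
  move=> [t [_ [ht e]]].
  have [i iN hi] := arc_cover N0 ht.
  have hE : E i w by exists t.
  rewrite (bigD1 (Ordinal iN))//=; apply: (@le_trans _ _ (g i w * \1_(E i) w)); last first.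
    by rewrite lerDl sumr_ge0.
  have hUn : unit_steps X n w by move=> k kn; apply: hU; exact: leqW.
  rewrite /exp_walk /g !indicE !mem_set//= !mulr1 /exp_potential /C -expRD ler_expR.
  have h1 := potential_lipschitz (fun k => X k w) n.+1 (X n w) (unitv (th i)) (unitv t).
  have h2 := unitv_lipschitz (th i) t.
  have h3 : `|th i - t| <= pi / N%:R.
    move: hi; rewrite /arc /= in_itv /= -/(th i) => /andP[q1 q2].
    rewrite distrC ger0_norm ?subr_ge0//.
    rewrite lerBlDl /th; apply: ltW; move: q2.
    by rewrite -[i.+1%:R]natr1 mulrDr mulr1.
  rewrite e -/(Zi i w).
  have : l * potential (fun k => X k w) n.+1 (Zi i w) <=
      l * (potential (fun k => X k w) n.+1 (padd (X n w) (unitv t)) + 4 * (pi / N%:R)).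
    rewrite ler_pM2l//; apply: le_trans h1 _; lra.
  lra.
have mgE (i : 'I_(2 * N)) : measurable_fun setT (fun w => (g i w * \1_(E i) w)%:E).
  apply/measurable_EFinP; apply: measurable_funM => //; apply: measurable_indic.
  exact: mE.
apply: (@le_trans _ _ (\int[P]_w (\sum_(i < 2 * N) (g i w * \1_(E i) w)%:E))%E).
  apply: lower_integral_le => w; first by rewrite lee_fin exp_walk_ge0.
  by rewrite sumEFin lee_fin.
rewrite ge0_integral_sum//; last first.
  by move=> i w _; rewrite lee_fin mulr_ge0// indicE ler0n.
have step (i : 'I_(2 * N)) : (\int[P]_w (g i w * \1_(E i) w)%:E <=
    \int[P]_w (g i w * step_prob X n (arc N i) w)%:E)%E.
  have := @history_kernel_le d T R P (hist_gen X n) (E i) (step_prob X n (arc N i)) (g i)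
    (hist_gen_measurable HX (n := n)) (mE i (ltn_ord i)) (@step_prob_ge0 _ _ _ X n _).
  move=> /(_ _ (mg i) (g0 i)) h.
  apply: (le_trans _ (h _)); last first.
    by move=> D mD; apply: (walk_step HX) => //; exact: measurable_itv.
  rewrite [leRHS]integral_mkcond le_eqVlt; apply/orP; left; apply/eqP.
  apply: eq_integral => w _; rewrite patchE indicE; case: ifP => _; first by rewrite mulr1.
  by rewrite mulr0.
apply: (@le_trans _ _ (\sum_(i < 2 * N) \int[P]_w (g i w * step_prob X n (arc N i) w)%:E)%E).
  by apply: lee_sum => i _; exact: step.
apply: le_trans (lower_integral_sum _ _ _) _.
  by move=> i w; rewrite lee_fin mulr_ge0// step_prob_ge0.
set K := expR (8 * l * _) * _.
have K0 : 0 <= K.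
  rewrite mulr_ge0 ?expR_ge0//.
  have e1 := eps_small R; have e0 := eps_gt0 R.
  have : eps R * l <= 1 / 2 * 1 by apply: ler_pM; lra.
  have : 0 <= l ^+ 2 by rewrite sqr_ge0.
  lra.
rewrite -ge0_integralZl_EFin//; last 2 first.
- by move=> w _; rewrite lee_fin exp_walk_ge0.
- by apply/measurable_EFinP; apply: hist_to_T; exact: measurable_exp_walk.
apply: lower_integral_le => w.
  by apply: sume_ge0 => i _; rewrite lee_fin mulr_ge0// step_prob_ge0.
rewrite sumEFin -EFinM lee_fin.
have [hU|hU] := pselect (unit_steps X n w); last first.
  rewrite big1; first by rewrite mulr_ge0// exp_walk_ge0.
  by move=> i _; rewrite /g indicE memNset// mulr0 mulr0 mul0r.
have x0 : X 0%N w = 0 by exact: (walk_start HX).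
have lastu : (0 < n)%N -> enorm (padd (X n.-1 w) (pscale (-1) (X n w))) = 1.
  by move=> n0; have := hU n.-1; rewrite prednK// => /(_ (leqnn _)).
have h := ler_wpM2l C0 (@drift_discretized R (fun k => X k w) n l N x0 lastu hl N0).
rewrite /exp_walk indicE mem_set// mulr1.
apply: le_trans (le_trans h _).
  rewrite mulr_sumr; apply: ler_sum => i _.
  by rewrite /g indicE mem_set// mulr1 -mulrA.
have -> : K = C * (C * (1 + 8 * l ^+ 2 - 2 * eps R * l)).
  by rewrite mulrA /C -expRD /K; congr (expR _ * _); ring.
by rewrite /C /exp_potential !mulrA.
Qed.

End Supermartingale.

(** * Exponential estimate and almost sure speed *)

Section Conclusion.
Context d (T : measurableType d) (R : realType).
Local Notation pt := (R * R)%type.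
Variables (P : probability T R) (X : nat -> T -> pt).
Hypothesis HX : hull_avoiding_walk P X.

Lemma measurable_slow (c : R) n : measurable [set w | enorm (X n w) <= c].
Proof.
rewrite (_ : [set _ | _] = setT `&` (fun w => enorm (X n w)) @^-1` `]-oo, c]%classic).
  have m : measurable_fun setT (fun w => enorm (X n w)).
    by apply: measurable_enorm; exact: (walk_measurable HX).
  exact: m.
by rewrite setTI; apply/seteqP; split => w /=; rewrite in_itv.
Qed.

Lemma exponential_moment (l kappa : R) : 0 < l <= 1 / 4 ->
  (exists2 N : nat, (0 < N)%N &
    expR (8 * l * (pi / N%:R)) * (1 + 8 * l ^+ 2 - 2 * eps R * l) <= expR (- kappa)) ->
  forall n, (\int[P]_w (exp_walk X l n w)%:E <= (expR (- (kappa * n%:R)))%:E)%E.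
Proof.
move=> hl [N N0 hN]; elim=> [|n ih].
  apply: (@le_trans _ _ (\int[P]_w (\1_[set: T] w)%:E)%E); last first.
    by rewrite integral_indic// setIT mulr0 oppr0 expR0; exact: probability_le1.
  apply: lower_integral_le => w; rewrite lee_fin ?exp_walk_ge0//.
  rewrite [leRHS]indicE mem_setT /exp_walk /exp_potential /potential (walk_start HX) enorm0 /penalty big_ord0.
  by rewrite mulr0 subr0 mulr0 oppr0 expR0 mul1r indicE; case: (_ \in _).
apply: le_trans (supermartingale HX hl n N0) _.
have I0 : (0 <= \int[P]_w (exp_walk X l n w)%:E)%E.
  by apply: integral_ge0 => w _; rewrite lee_fin exp_walk_ge0.
apply: (@le_trans _ _ ((expR (- kappa))%:E * \int[P]_w (exp_walk X l n w)%:E)%E).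
  by apply: lee_wpmul2r => //; rewrite lee_fin.
apply: (@le_trans _ _ ((expR (- kappa))%:E * (expR (- (kappa * n%:R)))%:E)%E).
  by apply: lee_wpmul2l => //; rewrite lee_fin expR_ge0.
by rewrite -EFinM -expRD lee_fin -[n.+1%:R]natr1 le_eqVlt; apply/orP; left; apply/eqP; congr expR; ring.
Qed.

Lemma slow_probability (l kappa c : R) n : 0 < l <= 1 / 4 ->
  (exists2 N : nat, (0 < N)%N &
    expR (8 * l * (pi / N%:R)) * (1 + 8 * l ^+ 2 - 2 * eps R * l) <= expR (- kappa)) ->
  (P [set w | (enorm (X n w) <= c)%R] <= (expR (l * c - kappa * n%:R))%:E)%E.
Proof.
move=> hl hN; have l0 : 0 < l by case/andP: hl.
set A := [set _ | _]; have mA : measurable A by exact: measurable_slow.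
have mU := hist_measurable HX (@measurable_unit_steps _ _ _ X n).
have PA : P A = P (A `&` unit_steps X n).
  have := unit_steps_as HX n => PU.
  have h0 : P (A `\` unit_steps X n) = 0%E.
    apply: measure_negligible; first exact: measurableD.
    apply: (@negligibleS _ _ _ _ (~` unit_steps X n)); first by move=> w [].
    apply/negligibleP; first exact: measurableC.
    by have := probability_setC P mU; rewrite PU subee.
  apply: (etrans (measureDI P mA mU)); apply: (etrans (congr1 (fun z => (z + _)%E) h0)).
  exact: add0e.
rewrite PA.
have key : ((expR (- (l * c)))%:E * P (A `&` unit_steps X n) <= (expR (- (kappa * n%:R)))%:E)%E.
  apply: le_trans (exponential_moment hl hN n).
  rewrite -(setIT (A `&` _)) -integral_indic//; last exact: measurableI.
  apply: le_trans (lower_integralZ _ _ _) _; first exact: expR_ge0.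
    by move=> w; rewrite lee_fin indicE ler0n.
  apply: lower_integral_le => w; first by rewrite mule_ge0// lee_fin ?expR_ge0// indicE ler0n.
  rewrite -EFinM lee_fin; have [h|h] := pselect ((A `&` unit_steps X n) w); last first.
    by rewrite indicE memNset// mulr0 exp_walk_ge0.
  case: (h) => hA hU; rewrite /exp_walk !indicE !mem_set// !mulr1 ler_expR lerN2 ler_pM2l//.
  apply: le_trans hA; rewrite /potential gerBl mulr_ge0 ?penalty_ge0//.
  by apply: ltW; exact: eps_gt0.
have e0 : 0 <= expR (l * c) by exact: expR_ge0.
have := lee_wpmul2l (_ : (0 <= (expR (l * c))%:E)%E) key; rewrite lee_fin => /(_ e0).
rewrite muleA -!EFinM -!expRD subrr expR0 mul1e => h.
by apply: le_trans h _.
Qed.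

Lemma slow_exponentially_unlikely :
  exists c1 kappa : R, [/\ 0 < c1, 0 < kappa &
    forall n, (P [set w | (enorm (X n w) <= c1 * n%:R)%R] <= (expR (- (kappa * n%:R)))%:E)%E].
Proof.
pose e := eps R; have e0 : 0 < e := eps_gt0 R; have e1 := eps_small R.
(* l minimizes 8 l^2 - 2 e l, with value - e^2 / 8; half of this gain pays for the discretization
   and the other half is [kappa]. *)
pose l := e / 8; pose kappa := e ^+ 2 / 16.
have e1' : e <= 1 by rewrite /e; lra.
have hl : 0 < l <= 1 / 4 by rewrite /l divr_gt0//=; lra.
have hN : exists2 N : nat, (0 < N)%N &
    expR (8 * l * (pi / N%:R)) * (1 + 8 * l ^+ 2 - 2 * eps R * l) <= expR (- kappa).
  (* As pi <= 4, the exponent e pi / N is at most e^2 / 16 as soon as N >= 64 / e. *)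
  pose N := (Num.truncn (64 / e)).+1; exists N; first by [].
  have NR : 0 < N%:R :> R by rewrite ltr0n.
  have q0 : 0 <= 64 / e by rewrite divr_ge0// ltW.
  have hN : 64 / e < N%:R by have := truncn_itv q0 => /andP[_ h]; exact: h.
  have hN' : 64 < N%:R * e by rewrite -ltr_pdivrMr.
  have h1 : 8 * l * (pi / N%:R) <= e ^+ 2 / 16.
    have -> : 8 * l * (pi / N%:R) = (e * pi) / N%:R by rewrite /l; field; exact: lt0r_neq0.
    rewrite ler_pdivrMr//.
    have p4 : pi <= 4 :> R by have := @pihalf_lt2 R; lra.
    have : e * pi <= e * 4 by rewrite ler_pM2l.
    have : e * 64 <= e * (N%:R * e) by rewrite ler_pM2l// ltW.
    rewrite expr2; lra.
  have h2 : 1 + 8 * l ^+ 2 - 2 * eps R * l <= expR (- (e ^+ 2 / 8)).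
    apply: le_trans (expR_ge1Dx _); rewrite -/e /l le_eqVlt; apply/orP; left; apply/eqP; by field.
  have h3 : expR (8 * l * (pi / N%:R)) <= expR (e ^+ 2 / 16) by rewrite ler_expR.
  apply: (@le_trans _ _ (expR (e ^+ 2 / 16) * expR (- (e ^+ 2 / 8)))).
    apply: (@le_trans _ _ (expR (8 * l * (pi / N%:R)) * expR (- (e ^+ 2 / 8)))).
      by rewrite ler_pM2l// expR_gt0.
    by rewrite ler_pM2r// expR_gt0.
  by rewrite -expRD ler_expR /kappa le_eqVlt; apply/orP; left; apply/eqP; by field.
(* The threshold costs l c1 = e^2 / 32 per step, half of [kappa]. *)
exists (e / 4), (kappa / 2); split.
- by rewrite divr_gt0.
- by rewrite !divr_gt0// exprn_gt0.
- move=> n; apply: le_trans (slow_probability _ n hl hN) _.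
  rewrite lee_fin ler_expR /l /kappa le_eqVlt; apply/orP; left; apply/eqP; by field.
Qed.

End Conclusion.

Lemma elog_rate_le (R : realType) (v : \bar R) (kappa : R) (n : nat) : (0 < n)%N ->
  (0 <= v)%E -> (v <= (expR (- (kappa * n%:R)))%:E)%E ->
  (((n%:R)^-1)%:E * elog v <= (- kappa)%:E)%E.
Proof.
move=> n0 v0 hv; have nR : 0 < n%:R :> R by rewrite ltr0n.
have n1 : 0 < n%:R^-1 :> R by rewrite invr_gt0.
rewrite /elog; case: eqP => [_|/eqP vn0].
  by rewrite mulrNy gtr0_sg// mul1e leNye.
have vfin : v \is a fin_num by rewrite ge0_fin_numE//; apply: le_lt_trans hv _; exact: ltry.
have v0' : 0 < fine v by rewrite fine_gt0// lt_neqAle eq_sym vn0 v0 -ge0_fin_numE.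
rewrite -EFinM lee_fin mulrC ler_pdivrMr//.
rewrite -[leRHS]expRK mulNr ler_ln ?posrE ?expR_gt0//.
by rewrite -lee_fin fineK.
Qed.

Lemma limn_esup_le_eventually (R : realType) (u : (\bar R)^nat) (c : \bar R) (m : nat) :
  (forall n, (m <= n)%N -> (u n <= c)%E) -> (limn_esup u <= c)%E.
Proof.
move=> h; rewrite limn_esup_lim; apply: lime_le; first exact: is_cvg_esups.
exists m => // n /= mn; apply: ge_ereal_sup => _ [k /= nk <-].
by apply: h; exact: leq_trans nk.
Qed.

Lemma limn_einf_ge_eventually (R : realType) (u : (\bar R)^nat) (c : \bar R) (m : nat) :
  (forall n, (m <= n)%N -> (c <= u n)%E) -> (c <= limn_einf u)%E.
Proof.
move=> h; rewrite limn_einf_lim; apply: lime_ge; first exact: is_cvg_einfs.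
exists m => // n /= mn; apply: le_ereal_inf_tmp => _ [k /= nk <-].
by apply: h; exact: leq_trans nk.
Qed.

Theorem theorem1 (d : measure_display) (T : measurableType d) (R : realType)
  (P : probability T R) (X : nat -> T -> (R * R)%type) :
  hull_avoiding_walk P X ->
  exists c1 : R, 0 < c1 /\
    (limn_esup (fun n : nat =>
        ((n%:R)^-1)%:E * elog (P [set w | (enorm (X n w) <= c1 * n%:R)%R]))
      < 0)%E /\
    {ae P, forall w, (c1%:E <= limn_einf (speed X w))%E}.
Proof.
move=> HX; have [c1 [kappa [c0 k0 hP]]] := slow_exponentially_unlikely HX.
exists c1; split => //; split.
  apply: (@le_lt_trans _ _ (- kappa)%:E); last by rewrite lte_fin oppr_lt0.
  (* The term n = 0 is 0 and must be skipped. *)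
  apply: (@limn_esup_le_eventually _ _ _ 1) => n n1.
  by apply: elog_rate_le => //; exact: hP.
pose A n : set T := [set w | enorm (X n w) <= c1 * n%:R].
have mA n : measurable (A n) by exact: (measurable_slow HX).
pose q := expR (- kappa).
have q1 : q < 1 by rewrite expR_lt1 oppr_lt0.
have q0 : 0 <= q by exact: expR_ge0.
have sumA : (\sum_(0 <= n <oo) P (A n) < +oo)%E.
  apply: (@le_lt_trans _ _ ((1 - q)^-1)%:E); last exact: ltry.
  apply: lime_le; first by apply: is_cvg_nneseries => n _ _.
  apply: nearW => m; apply: (@le_trans _ _ (\sum_(0 <= n < m) (q ^+ n)%:E)%E).
    apply: lee_sum => n _; apply: le_trans (hP n) _.
    by rewrite lee_fin /q -expRM_natr mulNr.
  rewrite sumEFin lee_fin -[leRHS]mul1r ler_pdivlMr ?subr_gt0//.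
  by rewrite big_mkord mulrC -[_ * _]opprK -mulNr opprB -subrX1 opprB gerBl exprn_ge0.
have null := lim_sup_set_cvg0 mA sumA.
have mL : measurable (lim_sup_set A).
  by apply: bigcapT_measurable => n; apply: bigcup_measurable => k _.
exists (lim_sup_set A); split => // w /= hw.
apply: contrapT => hn; apply: hw.
(* Outside the null set [lim_sup_set A] only finitely many of the slow events occur. *)
have [m hm] : exists m, forall n, (m <= n)%N -> ~ A n w.
  apply: contrapT => hm; apply: hn => n _; apply: contrapT => hk.
  apply: hm; exists n => k nk Ak; apply: hk; exists k => //.
apply: (@limn_einf_ge_eventually _ _ _ (maxn m 1)) => n.
rewrite geq_max => /andP[mn n1]; rewrite /speed lee_fin.
have nR : 0 < n%:R :> R by rewrite ltr0n.
rewrite ler_pdivlMr//; apply: ltW; rewrite ltNge; apply/negP; exact: hm.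
Qed.
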